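(* Let $B$ be a finite set of loadings. The weighted KLR algebra $W^\vartheta_B$ acts on a sum of polynomial rings $\bigoplus_{B}\mathbb K[y_1,\dots,y_d]$, one for each loading (dots acting by multiplication by the corresponding variables), via the rule: - when a strand passes from right of a ghost to left, we take the identity; - when the $j$th strand passes from left of the ghost for $e$ of the $k$th strand to right of it, we multiply by $Q_e(y_k,y_j)$; - when the $j$th and $(j+1)$st strands cross and have different labels, we apply the permutation $s_j$; - when the $j$th and $(j+1)$st strands cross and have the same label $i$, we act with the Demazure operator $\partial_{j,j+1}=\frac{s_j-1}{y_{j+1}-y_j}$ if there is no loop of weight $0$ at $i$, and if there is such a loop $e$, we act by $Q_e(y_j,y_{j+1})\cdot\partial_{j,j+1}=P_e(y_j,y_{j+1})\cdot(1-s_j)$.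
   Context: **Data.** $\Gamma$ is a graph with vertex set $I$ and oriented edge set $\Omega$; $e\in\Omega$ has tail $t(e)$, head $h(e)$ and multiplicities $c_e,c_{\bar e}\in\mathbb Z_{\ge0}$, and there are $d_i$ with $d_{h(e)}c_e=d_{t(e)}c_{\bar e}$. A weighting is a map $\vartheta:\Omega\to\mathbb R$. $\mathbb K$ is a commutative ring. Each $e$ has a polynomial $Q_e(u,v)\in\mathbb K[u,v]$, homogeneous of degree $d_{h(e)}c_e$ when $\deg u=d_{h(e)}$, $\deg v=d_{t(e)}$, with unit coefficients on the pure monomials in $u$ and in $v$; for a loop of weight $0$, $Q_e=(u-v)P_e$ with $P_e$ symmetric. All bigons of edges whose weights match (perhaps after reversing the orientation of an edge, negating its weight and replacing $Q_e(u,v)$ by $Q_e(v,u)$) are replaced by single edges of that weight, with the product polynomial; so below no two edges of the same weight have matching tail and head and there are no cyclically oriented bigons with opposite weights. $P_i=P_e=Q_e/(u-v)$ if there is a loop $e$ of weight $0$ at $i$; otherwise $P_i=0$. **Loadings and diagrams.** A loading is a finite set of points of $\mathbb R$ labelled by vertices; $d$ is the number of its points. A point at $x$ labelled $h(e)$ has a ghost for $e$ at $x+\vartheta_e$. A wKLR diagram is a finite collection of smooth curves (strands) in $\mathbb R\times[0,1]$, labelled by vertices, each projecting diffeomorphically to $[0,1]$, with distinct endpoints on $y=0$ and $y=1$, possibly carrying dots; each strand labelled $h(e)$ has a ghost for $e$, its translate by $\vartheta_e$ to the right. No tangencies or triple points among strands and ghosts are allowed (except coincidences forced by edges of weight $0$),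 and no dots on crossings; diagrams are taken up to isotopy preserving this. Ghosts for $e$ interact only with strands labelled $t(e)$, and the first two rules of the claim concern such strands. $W^\vartheta_B$ is the $\mathbb K$-span of diagrams with top and bottom in $B$, with $ab$ given by stacking $a$ on $b$ ($0$ if loadings do not match), modulo the local relations below (strands numbered left to right, $y_k$ a dot on the $k$th strand, $\psi_k$ a crossing of strands $k,k+1$). (1) Dots pass freely through crossings of strands with different labels; for equal labels, (crossing with dot at top left) $=$ (crossing with dot at bottom right) $+$ (two uncrossed strands), and (dot at bottom left) $=$ (dot at top right) $+$ (two uncrossed strands). (2) A bigon between the $m$th strand, labelled $t(e)$, and the ghost for $e$ of the $n$th strand ($e$ not a loop of weight $0$) is undone by multiplying by $Q_e(y_n,y_m)$. (3) A bigon between strands $k,k+1$ is simply undone if the labels differ; if both are $i$ it equals $2P_i(y_k,y_{k+1})$ times a single crossing. (4) Triple points can be moved through without effect, except: (a) when the ghost for $e$ of the $m$th strand passes through a crossing of strands $n,n+1$ both labelled $t(e)$, the diagram with the ghost at the left differs from the one with it at the right by $\frac{Q_e(y_m,y_n)-Q_e(y_m,y_{n+1})}{y_n-y_{n+1}}$ times the diagram with the crossing opened; (b) when the $m$th strand, labelled $t(e)$, passes through the crossing of the ghosts for $e$ of strands $n,n+1$ (both labelled $h(e)$), the diagram with the strand at the left differs from the one with it at the right by $\frac{Q_e(y_n,y_m)-Q_e(y_{n+1},y_m)}{y_n-y_{n+1}}$ times the opened diagram; (c) for strands $k,k+1,k+2$ all labelled $i$ with a weight-$0$ loop at $i$, writing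 $P_{ab}=P_i(y_{k+a-1},y_{k+b-1})$, the diagram with the strand at the left differs from the one with it at the right by $(P_{12}P_{23}+P_{13}P_{21}-P_{13}P_{23})\psi_k-(P_{12}P_{23}+P_{13}P_{32}-P_{13}P_{12})\psi_{k+1}$.
   Formalization: With a loop e of weight 0 at the label, opened crossings in (1), (4a), (4b) carry a factor Q_e, without which the claim fails; bigons of strands joined by a weight-0 edge follow (2), not (3); the rule is stated for single crossings or dots with ends in B (enlarge B for the rest). *)

(* Defs.v *)
From HB Require Import structures.
From mathcomp Require Import all_boot all_order all_algebra all_fingroup.
From mathcomp Require Import boolp classical_sets functions cardinality reals.
From mathcomp Require Import topology normedtype derive lra.
From mathcomp Require Import freeg.
(* The notations of mpoly clash with those of mathcomp-analysis. *)
From mathcomp Require mpoly.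
Import -(notations) mpoly.

Set Implicit Arguments.
Unset Strict Implicit.
Unset Printing Implicit Defensive.

Import Order.TTheory GRing.Theory Num.Theory numFieldNormedType.Exports.

Local Open Scope ring_scope.
Local Open Scope classical_set_scope.
Local Open Scope quotient_scope.

Section Calculus.
Variable R : realType.
Implicit Types f g : R -> R.

Lemma is_derive_affine f (a b t : R) : derivable f (a * t + b) 1 ->
  is_derive t 1 (fun t => f (a * t + b)) (a * derive1 f (a * t + b)).
Proof.
move=> df.
have da : is_derive t (1 : R) (fun t : R => a * t + b) a.
  apply: is_derive_eq.
  by rewrite addr0 -[LHS]/(a * 1) mulr1.
have /derivable1_diffP dff := df.
have /derivable1_diffP daa : derivable (fun t : R => a * t + b) t 1 by [].
have -> : (fun t => f (a * t + b)) = f \o (fun t => a * t + b) by [].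
apply: DeriveDef; first exact/derivable1_diffP/differentiable_comp.
rewrite -derive1E derive1_comp //.
by rewrite [X in _ * X = _]derive1E (@derive_val _ _ _ _ _ _ _ da) mulrC.
Qed.

Lemma derive1_near f g t : {near t, f =1 g} -> derive1 f t = derive1 g t.
Proof. by move=> fg; rewrite !derive1E; apply: near_eq_derive. Qed.

Lemma derive1_lcst f c t : (forall u, u <= 0 -> f u = c) -> t < 0 ->
  derive1 f t = 0.
Proof.
move=> fc t0; rewrite (@derive1_near _ (cst c)) ?derive1_cst//.
near=> u; apply: fc; near: u; exact: lt_le_nbhsl.
Unshelve. all: by end_near. Qed.

Lemma derive1_rcst f c t : (forall u, 1 <= u -> f u = c) -> 1 < t ->
  derive1 f t = 0.
Proof.
move=> fc t0; rewrite (@derive1_near _ (cst c)) ?derive1_cst//.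
near=> u; apply: fc; near: u; exact: lt_le_nbhsr.
Unshelve. all: by end_near. Qed.

Section Glue.
Variables (f g : R -> R) (c : R).
Hypothesis df : forall n t, derivable (derive1n n f) t 1.
Hypothesis dg : forall n t, derivable (derive1n n g) t 1.
Let h t := f (2 * t) + g (2 * t - 1) - c.

Lemma derive1n_glue n : exists e, derive1n n h =
  (fun t => 2 ^+ n * derive1n n f (2 * t + 0) +
            2 ^+ n * derive1n n g (2 * t + - 1) - e).
Proof.
elim: n => [|n [e IH]].
  by exists c; apply/funext => t; rewrite !mul1r addr0.
exists 0; rewrite !derive1nS IH; apply/funext => t.
have D1 := is_derive_affine (@df n (2 * t + 0)).
have D2 := is_derive_affine (@dg n (2 * t + - 1)).
rewrite derive1E.
have D3 : is_derive t (1 : R) (fun t => 2 ^+ n * derive1n n f (2 * t + 0) +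
     2 ^+ n * derive1n n g (2 * t + - 1) - e)
   (2 ^+ n *: (2 * derive1 (derive1n n f) (2 * t + 0)) +
    2 ^+ n *: (2 * derive1 (derive1n n g) (2 * t + - 1)) - 0).
  apply: is_deriveB; apply: is_deriveD; exact: is_deriveZ.
by rewrite (@derive_val _ _ _ _ _ _ _ D3) exprSr -!mulrA.
Qed.

Lemma glue_smooth n t : derivable (derive1n n h) t 1.
Proof.
have [e ->] := derive1n_glue n.
have D1 := is_derive_affine (@df n (2 * t + 0)).
have D2 := is_derive_affine (@dg n (2 * t + - 1)).
apply: derivableB => //; apply: derivableD => //; exact: derivableZ.
Qed.

Lemma derive1_glue t :
  derive1 h t = 2 * derive1 f (2 * t) + 2 * derive1 g (2 * t - 1).
Proof.
have := is_derive_affine (@df 0 (2 * t + 0)).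
have := is_derive_affine (@dg 0 (2 * t + - 1)).
rewrite /= !addr0 => D2 D1; rewrite derive1E.
have D1' : is_derive t (1 : R) (fun t => f (2 * t)) (2 * derive1 f (2 * t)).
  by move: D1; congr is_derive; apply/funext => u; rewrite addr0.
have D3 : is_derive t (1 : R) h
   ((2 * derive1 f (2 * t)) + (2 * derive1 g (2 * t + - 1)) - 0).
  rewrite /h; apply: is_deriveB; exact: is_deriveD.
by rewrite (@derive_val _ _ _ _ _ _ _ D3) subr0.
Qed.

End Glue.
End Calculus.

Notation "'yy_' k" := (@mpolyX _ _ (mnm1 k))
  (at level 8, k at level 2, format "'yy_' k") : ring_scope.

Definition ev2 (K : comNzRingType) d (q : mpoly 2 K) (a b : mpoly d K) :
  mpoly d K := comp_mpoly [tuple a; b] q.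

(* The quotient is unique for the divisors y_k - y_l used below, which are not
   zero divisors over any commutative ring. *)
Definition quo (K : comNzRingType) d (p r : mpoly d K) : mpoly d K :=
  xget 0 [set q | q * r = p].

Notation uu := (yy_ (ord0 : 'I_2)).
Notation vv := (yy_ (ord_max : 'I_2)).

(* [emult e] and [emultbar e] are the multiplicities of [e] and of the opposite
   edge; [u] has degree [vdeg (ehead e)] and [v] has degree [vdeg (etail e)].
   The last two conditions hold once the bigons of edges with matching weights
   have been replaced by single edges. *)
Record wgraph (R : realType) (K : comNzRingType) := WGraph {
  vertex : Type;
  edge : Type;
  etail : edge -> vertex;
  ehead : edge -> vertex;
  emult : edge -> nat;
  emultbar : edge -> nat;
  vdeg : vertex -> nat;
  emult_vdeg : forall e,
    (vdeg (ehead e) * emult e = vdeg (etail e) * emultbar e)%N;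
  weight : edge -> R;
  Qpoly : edge -> mpoly 2 K;
  Qpoly_homog : forall e (m : multinom 2), m \in msupp (Qpoly e) ->
    (vdeg (ehead e) * m ord0 + vdeg (etail e) * m ord_max
     = vdeg (ehead e) * emult e)%N;
  Qpoly_unit_u : forall e, exists c : K,
    c * mcoeff (mnm_muln (mnm1 ord0) (emult e)) (Qpoly e) = 1;
  Qpoly_unit_v : forall e, exists c : K,
    c * mcoeff (mnm_muln (mnm1 ord_max) (emultbar e)) (Qpoly e) = 1;
  Qpoly_loop : forall e, etail e = ehead e -> weight e = 0 ->
    exists2 P : mpoly 2 K, msym (tperm ord0 ord_max) P = P &
      Qpoly e = (uu - vv) * P;
  edges_merged : forall e f, etail e = etail f -> ehead e = ehead f ->
    weight e = weight f -> e = f;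
  edges_merged_rev : forall e f, etail e = ehead f -> ehead e = etail f ->
    weight e = - weight f -> e = f
}.

Section WeightedKLR.
Variables (R : realType) (K : comNzRingType) (G : wgraph R K).
Local Notation I := (vertex G).

Definition demazure d (k l : 'I_d) (f : mpoly d K) : mpoly d K :=
  quo (msym (tperm k l) f - f) (yy_ l - yy_ k).

Definition loop0_at (i : I) (e : edge G) :=
  [/\ etail e = i, ehead e = i & weight e = 0].

Definition Ppoly (e : edge G) : mpoly 2 K := quo (Qpoly e) (uu - vv).

Definition loopP (i : I) : mpoly 2 K :=
  if pselect (exists e, loop0_at i e) is left h then Ppoly (projT1 (cid h))
  else 0.

(* Where two strands labelled [i] cross, each of them also crosses the ghost of
   the other for a loop of weight 0 at [i].  When the crossing is opened, there
   remains a bigon between a strand and a ghost, which is worth [Q_e]: the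
   relations which open a crossing have this factor. *)
Definition loopQ (i : I) : mpoly 2 K :=
  if pselect (exists e, loop0_at i e) is left h then Qpoly (projT1 (cid h))
  else 1.

(* A strand labelled [i] interacts with the translate by [delta] of a strand
   labelled [j]: either this is the strand itself, or a ghost for an edge with
   tail [i]. *)
Definition interacts (i j : I) (delta : R) :=
  delta = 0 \/ exists e : edge G,
    [/\ etail e = i, ehead e = j & weight e = delta].

Record loading (d : nat) := Loading {
  pt : 'I_d -> R;
  lab : 'I_d -> I;
  pt_mono : forall k l : 'I_d, (k < l)%N -> pt k < pt l
}.

Definition interaction d (lb : 'I_d -> I) (x : 'I_d -> R -> R)
    (t : R) (k l : 'I_d) (delta : R) :=
  [/\ k <> l, interacts (lb k) (lb l) delta & x k t = x l t + delta].

(* The strand [k] is the graph of [strand k] over [0, 1], extended by vertical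
   rays; strands are thus vertical to infinite order at both ends, so that the
   diagrams obtained by stacking are smooth.  Strands are numbered by their
   bottom points, and [dperm k] is the number of the top point of strand [k].
   Only the coincidences of a strand with another strand or with a ghost with
   which it interacts are constrained.  [dots k] lists the heights of the dots
   on strand [k]. *)
Record diagram d (b c : loading d) := Diagram {
  strand : 'I_d -> R -> R;
  dperm : {perm 'I_d};
  dots : 'I_d -> seq R;
  strand_smooth : forall k n t, derivable (derive1n n (strand k)) t 1;
  strand_bot : forall k t, t <= 0 -> strand k t = pt b k;
  strand_top : forall k t, 1 <= t -> strand k t = pt c (dperm k);
  strand_lab : forall k, lab c (dperm k) = lab b k;
  no_tangency : forall t k l delta, interaction (lab b) strand t k l delta ->
    derive1 (strand k) t <> derive1 (strand l) t;
  no_triple_point : forall t k l l' delta delta',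
    interaction (lab b) strand t k l delta ->
    interaction (lab b) strand t k l' delta' -> l = l';
  dots_sorted : forall k, sorted <%R (dots k);
  dots_inside : forall k t, t \in dots k -> 0 < t < 1;
  dots_generic : forall k l t, t \in dots k -> l <> k ->
    strand l t <> strand k t
}.

HB.instance Definition _ d b c := gen_eqMixin (@diagram d b c).
HB.instance Definition _ d b c := gen_choiceMixin (@diagram d b c).

(* The path has to be continuous for the C^1 topology: three crossings of two
   strands can be merged into one by a merely continuous family. *)
Definition isotopic d (b c : loading d) (D D' : diagram b c) :=
  exists H : R -> diagram b c,
  [/\ H 0 = D, H 1 = D',
      forall k, continuous (fun p : R * R => strand (H p.1) k p.2),
      forall k, continuous (fun p : R * R => derive1 (strand (H p.1) k) p.2) &
      forall k, (forall s, size (dots (H s) k) = size (dots D k)) /\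
        forall i, continuous (fun s => nth 0 (dots (H s) k) i)].

Section Stack.
Variables (d : nat) (b c a : loading d) (D2 : diagram c a) (D1 : diagram b c).

Definition stack_strand (k : 'I_d) (t : R) : R :=
  strand D1 k (2 * t) + strand D2 (dperm D1 k) (2 * t - 1)
  - pt c (dperm D1 k).

Definition stack_dots (k : 'I_d) : seq R :=
  [seq t / 2 | t <- dots D1 k] ++
  [seq (1 + t) / 2 | t <- dots D2 (dperm D1 k)].

Lemma interaction_out (D : diagram b c) t k l delta :
  interaction (lab b) (strand D) t k l delta -> 0 < t < 1.
Proof.
move=> ev; rewrite !ltNge -negb_or; apply/negP => /orP[t0|t1].
- have ev1 : interaction (lab b) (strand D) (-1) k l delta.
    by case: ev => kl i; rewrite !strand_bot ?lerN10//; split=> //;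
      rewrite !strand_bot ?lerN10.
  apply: (no_tangency ev1).
  by rewrite !(derive1_lcst (@strand_bot _ _ _ D _)) ?ltrN10.
- have ev2 : interaction (lab b) (strand D) 2 k l delta.
    by case: ev => kl i; rewrite !strand_top//; split=> //;
      rewrite !strand_top ?ler1n.
  apply: (no_tangency ev2).
  by rewrite !(derive1_rcst (@strand_top _ _ _ D _)) ?ltr1n.
Qed.

Lemma stack_strand_lo k t : t <= 1 / 2 ->
  stack_strand k t = strand D1 k (2 * t).
Proof.
by move=> ht; rewrite /stack_strand (strand_bot D2) ?addrK //; lra.
Qed.

Lemma stack_strand_hi k t : 1 / 2 <= t ->
  stack_strand k t = strand D2 (dperm D1 k) (2 * t - 1).
Proof.
move=> ht; rewrite /stack_strand (strand_top D1); last by lra.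
by rewrite addrAC subrr add0r.
Qed.

End Stack.

Section StackDiagram.
Variables (d : nat) (b c a : loading d) (D2 : diagram c a) (D1 : diagram b c).
Local Notation z := (stack_strand D2 D1).

Lemma stack_smooth k n t : derivable (derive1n n (z k)) t 1.
Proof. by apply: glue_smooth => *; apply: strand_smooth. Qed.

Lemma stack_derive k t : derive1 (z k) t =
  2 * derive1 (strand D1 k) (2 * t) +
  2 * derive1 (strand D2 (dperm D1 k)) (2 * t - 1).
Proof. by apply: derive1_glue => *; apply: strand_smooth. Qed.

Lemma stack_bot k t : t <= 0 -> z k t = pt b k.
Proof.
by move=> ht; rewrite stack_strand_lo ?(strand_bot D1)//; lra.
Qed.

Lemma stack_top k t : 1 <= t -> z k t = pt a ((dperm D1 * dperm D2)%g k).
Proof.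
by move=> ht; rewrite stack_strand_hi ?(strand_top D2) ?permM//; lra.
Qed.

Lemma stack_lab k : lab a ((dperm D1 * dperm D2)%g k) = lab b k.
Proof. by rewrite permM !strand_lab. Qed.

Lemma stack_interaction t k l delta : interaction (lab b) z t k l delta ->
  t < 1 / 2 /\ interaction (lab b) (strand D1) (2 * t) k l delta \/
  1 / 2 < t /\ interaction (lab c) (strand D2) (2 * t - 1)
                 (dperm D1 k) (dperm D1 l) delta.
Proof.
move=> [kl i e]; case: (leP t (1 / 2)) => ht.
  have ev : interaction (lab b) (strand D1) (2 * t) k l delta.
    by move: e; rewrite !stack_strand_lo.
  by left; split=> //; have /andP[] := interaction_out ev; lra.
right; split=> //; move: e; rewrite !stack_strand_hi ?ltW// => e.
by split; rewrite ?strand_lab// => /perm_inj.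
Qed.

Lemma stack_no_tangency t k l delta : interaction (lab b) z t k l delta ->
  derive1 (z k) t <> derive1 (z l) t.
Proof.
move/stack_interaction => [[ht ev]|[ht ev]]; rewrite !stack_derive => e.
- apply: (no_tangency ev); move: e.
  rewrite !(derive1_lcst (@strand_bot _ _ _ D2 _)); lra.
- apply: (no_tangency ev); move: e.
  rewrite !(derive1_rcst (@strand_top _ _ _ D1 _)); lra.
Qed.

Lemma stack_no_triple_point t k l l' delta delta' :
  interaction (lab b) z t k l delta -> interaction (lab b) z t k l' delta' ->
  l = l'.
Proof.
move=> /stack_interaction[[ht ev]|[ht ev]]
  /stack_interaction[[ht' ev']|[ht' ev']].
- exact: no_triple_point ev ev'.
- by exfalso; lra.
- by exfalso; lra.
- exact: perm_inj (no_triple_point ev ev').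
Qed.

Lemma stack_dots_cases k t : t \in stack_dots D2 D1 k ->
  (exists2 u, u \in dots D1 k & t = u / 2) \/
  (exists2 u, u \in dots D2 (dperm D1 k) & t = (1 + u) / 2).
Proof.
by rewrite mem_cat => /orP[] /mapP[u uD ->]; [left|right]; exists u.
Qed.

Lemma stack_dots_inside k t : t \in stack_dots D2 D1 k -> 0 < t < 1.
Proof.
by move=> /stack_dots_cases[] [u /dots_inside/andP[u0 u1] ->];
  apply/andP; split; lra.
Qed.

Lemma stack_dots_generic k l t : t \in stack_dots D2 D1 k -> l <> k ->
  z l t <> z k t.
Proof.
move=> /stack_dots_cases[] [u uD ->] lk; have /andP[u0 u1] := dots_inside uD.
- rewrite !stack_strand_lo; [|lra..].
  by rewrite mulrC divfK ?pnatr_eq0//; exact: dots_generic.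
- rewrite !stack_strand_hi; [|lra..].
  rewrite mulrC divfK ?pnatr_eq0// addrC addKr.
  by apply: (dots_generic uD) => /perm_inj.
Qed.

Lemma stack_dots_sorted k : sorted <%R (stack_dots D2 D1 k).
Proof.
rewrite (sorted_pairwise lt_trans) pairwise_cat; apply/and3P; split.
- apply/allrelP => s t /mapP[u /dots_inside/andP[u0 u1] ->].
  by move=> /mapP[v /dots_inside/andP[v0 v1] ->]; lra.
- rewrite -(sorted_pairwise lt_trans).
  by apply: homo_sorted (dots_sorted D1 k) => s t; lra.
- rewrite -(sorted_pairwise lt_trans).
  by apply: homo_sorted (dots_sorted D2 _) => s t; lra.
Qed.

Definition stack : diagram b a :=
  Diagram stack_smooth stack_bot stack_top stack_lab stack_no_tangency
    stack_no_triple_point stack_dots_sorted stack_dots_inside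
    stack_dots_generic.

End StackDiagram.

Definition generic_loading d (b : loading d) := forall (k l : 'I_d) delta,
  k <> l -> interacts (lab b k) (lab b l) delta -> pt b k <> pt b l + delta.

Section Straight.
Variables (d : nat) (b : loading d) (m : multinom d).
Hypothesis gb : generic_loading b.
Let x (k : 'I_d) : R -> R := cst (pt b k).
Let y (k : 'I_d) : seq R :=
  [seq i.+1%:R / (m k).+1%:R | i <- iota 0 (m k)].

Lemma straight_smooth k n t : derivable (derive1n n (x k)) t 1.
Proof.
suff [e ->] : exists e, derive1n n (x k) = cst e by exact: derivable_cst.
elim: n => [|n [e IH]]; first by exists (pt b k).
by exists 0; rewrite derive1nS IH; apply/funext => u; rewrite derive1_cst.
Qed.

Lemma straight_interaction t k l delta :
  ~ interaction (lab b) x t k l delta.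
Proof. by move=> [kl i]; exact: gb. Qed.

Lemma straight_dots_sorted k : sorted <%R (y k).
Proof.
apply: homo_sorted (iota_ltn_sorted 0 (m k)) => i j ij.
by rewrite ltr_pM2r ?invr_gt0 ?ltr0n// ltr_nat ltnS.
Qed.

Lemma straight_dots_inside k t : t \in y k -> 0 < t < 1.
Proof.
move=> /mapP[i]; rewrite mem_iota add0n => /andP[_ im] ->.
by rewrite divr_gt0 ?ltr0n//= ltr_pdivrMr ?ltr0n// mul1r ltr_nat ltnS.
Qed.

Lemma straight_dots_generic k l t : t \in y k -> l <> k -> x l t <> x k t.
Proof.
move=> _ lk; rewrite /x /=.
have /orP[/(pt_mono b) h|/(pt_mono b) h] : ((l < k) || (k < l))%N.
- by rewrite -neq_ltn; apply/eqP => /val_inj.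
- by move=> e; move: h; rewrite (e : pt b l = pt b k) ltxx.
- by move=> e; move: h; rewrite (e : pt b l = pt b k) ltxx.
Qed.

Lemma straight_top k t : 1 <= t -> x k t = pt b ((1 : {perm 'I_d})%g k).
Proof. by rewrite perm1. Qed.

Lemma straight_lab k : lab b ((1 : {perm 'I_d})%g k) = lab b k.
Proof. by rewrite perm1. Qed.

Definition straight : diagram b b :=
  Diagram straight_smooth (fun _ _ _ => erefl) straight_top straight_lab
    (fun t k l delta h => False_ind _ (straight_interaction h))
    (fun t k l l' delta delta' h _ => False_ind _ (straight_interaction h))
    straight_dots_sorted straight_dots_inside straight_dots_generic.

End Straight.

Definition hom d (b c : loading d) := {freeg (diagram b c) / K}.

Definition dg d (b c : loading d) (D : diagram b c) : hom b c := << D >>.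

Definition hmul d (b c a : loading d) (x : hom c a) (y : hom b c) : hom b a :=
  fglift (fun D2 => fglift (fun D1 => dg (stack D2 D1)) y) x.

(* The polynomial [p] in the dots on vertical strands.  A loading at which a
   strand meets a ghost with which it interacts is not the bottom or the top of
   any diagram. *)
Definition pol d (b : loading d) (p : mpoly d K) : hom b b :=
  if pselect (generic_loading b) is left gb then
    \sum_(m <- msupp p) mcoeff m p *: dg (straight m gb)
  else 0.

Section Shapes.
Variables (d : nat) (b c : loading d).
Implicit Types D : diagram b c.

(* A curve is a strand or one of its ghosts, given by the strand and its
   translation to the right. *)
Definition is_curve (g : 'I_d * R) :=
  g.2 = 0 \/ exists2 e : edge G, ehead e = lab b g.1 & weight e = g.2.

Definition curve_at D (g : 'I_d * R) (t : R) := strand D g.1 t + g.2.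

Definition meet_at D (g g' : 'I_d * R) (ts : seq R) :=
  forall t, curve_at D g t = curve_at D g' t <-> t \in ts.

Definition dotless D := forall k, dots D k = [::].

(* The only interactions in [D] are between the curves [gs], up to a common
   translation of the curves which meet. *)
Definition only_meet D (gs : seq ('I_d * R)) := forall t k l delta,
  interaction (lab b) (strand D) t k l delta ->
  exists g g', [/\ g \in gs, g' \in gs, k = g.1, l = g'.1 & delta = g'.2 - g.2].

Definition uncrossed D := dotless D /\ only_meet D [::].

Definition once D g g' :=
  [/\ dotless D, only_meet D [:: g; g'] & exists t, meet_at D g g' [:: t]].

Definition twice D g g' :=
  [/\ dotless D, only_meet D [:: g; g'] &
      exists t1 t2, t1 < t2 /\ meet_at D g g' [:: t1; t2]].

Definition thrice D g1 g2 g3 (t12 t13 t23 : R) :=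
  [/\ dotless D, only_meet D [:: g1; g2; g3],
      curve_at D g1 0 < curve_at D g2 0 /\ curve_at D g2 0 < curve_at D g3 0 &
      [/\ meet_at D g1 g2 [:: t12], meet_at D g1 g3 [:: t13]
        & meet_at D g2 g3 [:: t23]]].

(* The curves [g1], [g2], [g3], in this order at the bottom and in the opposite
   order at the top, form a triangle; [g2] passes on the left, or on the right,
   of the crossing of [g1] and [g3]. *)
Definition middle_left D g1 g2 g3 :=
  exists t12 t13 t23, thrice D g1 g2 g3 t12 t13 t23 /\ t12 < t13 < t23.

Definition middle_right D g1 g2 g3 :=
  exists t12 t13 t23, thrice D g1 g2 g3 t12 t13 t23 /\ t23 < t13 < t12.

Definition cross D (k l : 'I_d) := l = k.+1 :> nat /\ once D (k, 0) (l, 0).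

Definition bigon D (k l : 'I_d) := l = k.+1 :> nat /\ twice D (k, 0) (l, 0).

Definition ghost_triple (e : edge G) (g1 g2 g3 : 'I_d * R) :=
  [/\ ~ loop0_at (etail e) e, g1.2 = g3.2 & weight e = g2.2 - g1.2] /\
  [/\ lab b g1.1 = etail e, lab b g3.1 = etail e & lab b g2.1 = ehead e].

Definition strand_triple (e : edge G) (g1 g2 g3 : 'I_d * R) :=
  [/\ ~ loop0_at (etail e) e, g1.2 = g3.2 & weight e = g1.2 - g2.2] /\
  [/\ lab b g1.1 = ehead e, lab b g3.1 = ehead e & lab b g2.1 = etail e].

Definition loop_triple (i : I) (g1 g2 g3 : 'I_d * R) :=
  [/\ exists e, loop0_at i e, g1.2 = g2.2 & g2.2 = g3.2] /\
  [/\ lab b g1.1 = i, lab b g2.1 = i & lab b g3.1 = i].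

End Shapes.

(* The local relations, between diagrams in which nothing happens apart from
   the pictured move; they are put in an arbitrary diagram by stacking.
   - Two strands joined by an edge of weight 0 form a bigon together with a
     ghost, which is covered by [rel_ghost_bigon].
   - In [rel_ghost_triple] and [rel_strand_triple] the ghost (the strand) is in
     the middle, at the bottom and at the top; if it goes from one side of the
     two crossing curves to the other, [rel_triple] applies.
   - The exceptional triples are defined by relative translations, because a
     triple point of strands and ghosts has translates which are triple points
     of ghosts. *)
Inductive local_rel d (b c : loading d) : hom b c -> hom b c -> Prop :=
| rel_dot_diff1 X k l :
    cross X k l -> lab b k <> lab b l ->
    local_rel (hmul (pol c (yy_ k)) (dg X)) (hmul (dg X) (pol b (yy_ l)))
| rel_dot_diff2 X k l :
    cross X k l -> lab b k <> lab b l ->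
    local_rel (hmul (dg X) (pol b (yy_ k))) (hmul (pol c (yy_ l)) (dg X))
| rel_dot_same1 X O k l i :
    cross X k l -> lab b k = i -> lab b l = i -> uncrossed O ->
    local_rel (hmul (pol c (yy_ k)) (dg X))
      (hmul (dg X) (pol b (yy_ l)) +
       hmul (pol c (ev2 (loopQ i) (yy_ k) (yy_ l))) (dg O))
| rel_dot_same2 X O k l i :
    cross X k l -> lab b k = i -> lab b l = i -> uncrossed O ->
    local_rel (hmul (dg X) (pol b (yy_ k)))
      (hmul (pol c (yy_ l)) (dg X) +
       hmul (pol c (ev2 (loopQ i) (yy_ k) (yy_ l))) (dg O))
| rel_ghost_bigon D O e m n :
    twice D (m, 0) (n, weight e) -> lab b m = etail e -> lab b n = ehead e ->
    ~ loop0_at (etail e) e -> uncrossed O ->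
    local_rel (dg D) (hmul (pol c (ev2 (Qpoly e) (yy_ n) (yy_ m))) (dg O))
| rel_bigon_diff D O k l :
    bigon D k l -> lab b k <> lab b l -> uncrossed O ->
    (forall e : edge G, weight e = 0 ->
       ~ (etail e = lab b k /\ ehead e = lab b l) /\
       ~ (etail e = lab b l /\ ehead e = lab b k)) ->
    local_rel (dg D) (dg O)
| rel_bigon_same D X k l i :
    bigon D k l -> cross X k l -> lab b k = i -> lab b l = i ->
    local_rel (dg D)
      (hmul (pol c (2%:R * ev2 (loopP i) (yy_ k) (yy_ l))) (dg X))
| rel_triple D D' g1 g2 g3 :
    is_curve b g1 -> is_curve b g2 -> is_curve b g3 ->
    middle_left D g1 g2 g3 -> middle_right D' g1 g2 g3 ->
    (forall e, ~ ghost_triple b e g1 g2 g3) ->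
    (forall e, ~ strand_triple b e g1 g2 g3) ->
    (forall i, ~ loop_triple b i g1 g2 g3) ->
    local_rel (dg D) (dg D')
| rel_ghost_triple D D' O g1 g2 g3 e (y1 := yy_ g1.1) (y2 := yy_ g2.1)
      (y3 := yy_ g3.1) :
    is_curve b g1 -> is_curve b g2 -> is_curve b g3 ->
    middle_left D g1 g2 g3 -> middle_right D' g1 g2 g3 -> uncrossed O ->
    ghost_triple b e g1 g2 g3 ->
    local_rel (dg D - dg D')
      (hmul (pol c (ev2 (loopQ (etail e)) y1 y3 *
         quo (ev2 (Qpoly e) y2 y1 - ev2 (Qpoly e) y2 y3) (y1 - y3))) (dg O))
| rel_strand_triple D D' O g1 g2 g3 e (y1 := yy_ g1.1) (y2 := yy_ g2.1)
      (y3 := yy_ g3.1) :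
    is_curve b g1 -> is_curve b g2 -> is_curve b g3 ->
    middle_left D g1 g2 g3 -> middle_right D' g1 g2 g3 -> uncrossed O ->
    strand_triple b e g1 g2 g3 ->
    local_rel (dg D - dg D')
      (hmul (pol c (ev2 (loopQ (ehead e)) y1 y3 *
         quo (ev2 (Qpoly e) y1 y2 - ev2 (Qpoly e) y3 y2) (y1 - y3))) (dg O))
| rel_loop_triple D D' X1 X2 g1 g2 g3 i
      (P_ := fun g g' : 'I_d * R => ev2 (loopP i) (yy_ g.1) (yy_ g'.1)) :
    is_curve b g1 -> is_curve b g2 -> is_curve b g3 ->
    middle_left D g1 g2 g3 -> middle_right D' g1 g2 g3 ->
    once X1 g1 g2 -> once X2 g2 g3 -> loop_triple b i g1 g2 g3 ->
    local_rel (dg D - dg D')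
      (hmul (pol c (P_ g1 g2 * P_ g2 g3 + P_ g1 g3 * P_ g2 g1
                    - P_ g1 g3 * P_ g2 g3)) (dg X1)
       - hmul (pol c (P_ g1 g2 * P_ g2 g3 + P_ g1 g3 * P_ g3 g2
                      - P_ g1 g3 * P_ g1 g2)) (dg X2)).

Definition aloading := {d : nat & loading d}.
Definition ld d (b : loading d) : aloading := Tagged loading b.

Section Algebra.
Variable B : set aloading.

Record bdiagram := BDiagram {
  bdim : nat;
  bbot : loading bdim;
  btop : loading bdim;
  bdiag : diagram bbot btop;
  bbotP : B (ld bbot);
  btopP : B (ld btop)
}.

HB.instance Definition _ := gen_eqMixin bdiagram.
HB.instance Definition _ := gen_choiceMixin bdiagram.

Definition diagram_span := {freeg bdiagram / K}.

Definition span_dg d (b c : loading d) (hb : B (ld b)) (hc : B (ld c))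
  (D : diagram b c) : diagram_span := << BDiagram D hb hc >>.

Definition outgoing (L : aloading) :=
  {c : {c : loading (tag L) | B (ld c)} & diagram (tagged L) (sval c)}.

Definition bstack (x y : bdiagram) : diagram_span :=
  match pselect (ld (bbot x) = ld (btop y)) with
  | left h =>
      let z := eq_rect (ld (bbot x)) outgoing
        (existT _ (exist _ (btop x) (btopP x)) (bdiag x)) (ld (btop y)) h in
      span_dg (bbotP y) (proj2_sig (tag z)) (stack (tagged z) (bdiag y))
  | right _ => 0
  end.

Definition span_mul (x y : diagram_span) : diagram_span :=
  fglift (fun D2 => fglift (fun D1 => bstack D2 D1) y) x.

Lemma smulBl x x' y : span_mul (x - x') y = span_mul x y - span_mul x' y.
Proof. exact: lift_is_additive. Qed.

Lemma smulBr x y y' : span_mul x (y - y') = span_mul x y - span_mul x y'.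
Proof.
have fgB f g : fglift (fun D => f D - g D) x =
    fglift f x - fglift g x :> diagram_span.
  unlock fglift; rewrite /lift /prelift -sumrB.
  by apply: eq_bigr => D _; rewrite -scalerBr.
rewrite /span_mul -fgB; congr (fglift _ x); apply/funext => D.
exact: lift_is_additive.
Qed.

Definition in_context d (b b' c' c : loading d) (hb : B (ld b))
    (hc : B (ld c)) (U : diagram c' c) (L : diagram b b') (x : hom b' c') :
    diagram_span :=
  fglift (fun D => span_dg hb hc (stack U (stack D L))) x.

(* The heights where the relations are applied are arbitrary loadings, which do
   not have to belong to [B]. *)
Inductive null_comb : diagram_span -> Prop :=
| null0 : null_comb 0
| nullD x y : null_comb x -> null_comb y -> null_comb (x + y)
| nullZ a x : null_comb x -> null_comb (a *: x)
| nullMl x y : null_comb y -> null_comb (span_mul x y)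
| nullMr x y : null_comb x -> null_comb (span_mul x y)
| null_isotopy d (b c : loading d) (hb : B (ld b)) (hc : B (ld c))
    (D D' : diagram b c) :
    isotopic D D' -> null_comb (span_dg hb hc D - span_dg hb hc D')
| null_local d (b b' c' c : loading d) (hb : B (ld b)) (hc : B (ld c))
    (U : diagram c' c) (L : diagram b b') (x y : hom b' c') :
    local_rel x y ->
    null_comb (in_context hb hc U L x - in_context hb hc U L y).

Definition nullp : {pred diagram_span} := fun x => `[< null_comb x >].

Lemma nullp_zmod : zmod_closed nullp.
Proof.
split; first exact/asboolP/null0.
move=> x y /asboolP nx /asboolP ny; apply/asboolP/nullD => //.
by rewrite -scaleN1r; exact: nullZ.
Qed.
HB.instance Definition _ :=
  GRing.isZmodClosed.Build diagram_span nullp nullp_zmod.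

Definition wKLR := Quotient.quot nullp.
Local Notation repr := generic_quotient.repr.
HB.instance Definition _ := GRing.Zmodule.on wKLR.

Definition to_wKLR (x : diagram_span) : wKLR := \pi_(Quotient.quot nullp) x.

Lemma toW_eq x y : to_wKLR x = to_wKLR y <-> null_comb (x - y).
Proof.
split=> [/eqP|h]; last apply/eqP; rewrite /to_wKLR -Quotient.idealrBE.
  by move=> /asboolP.
exact/asboolP.
Qed.

Lemma toWD x y : to_wKLR (x + y) = to_wKLR x + to_wKLR y.
Proof. by rewrite /to_wKLR Quotient.pi_add. Qed.

Lemma toW_repr (w : wKLR) : to_wKLR (repr w) = w.
Proof. exact: reprK. Qed.

Definition wKLR_scale (a : K) (w : wKLR) : wKLR :=
  to_wKLR (a *: repr w).

Lemma toWZ a x : wKLR_scale a (to_wKLR x) = to_wKLR (a *: x).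
Proof.
apply/toW_eq; rewrite -scalerBr; apply/nullZ/toW_eq; exact: toW_repr.
Qed.

Lemma wKLR_scaleA a1 a2 w :
  wKLR_scale a1 (wKLR_scale a2 w) = wKLR_scale (a1 * a2) w.
Proof. by rewrite -(toW_repr w) !toWZ scalerA. Qed.

Lemma wKLR_scale1 : left_id 1 wKLR_scale.
Proof. by move=> w; rewrite -(toW_repr w) toWZ scale1r. Qed.

Lemma wKLR_scaleDr : right_distributive wKLR_scale +%R.
Proof.
by move=> a v w; rewrite -(toW_repr v) -(toW_repr w) -toWD !toWZ -toWD scalerDr.
Qed.

Lemma wKLR_scaleDl w : {morph wKLR_scale^~ w : a1 a2 / a1 + a2}.
Proof.
by move=> a1 a2 /=; rewrite -(toW_repr w) !toWZ -toWD scalerDl.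
Qed.

HB.instance Definition _ :=
  GRing.Zmodule_isLmodule.Build K wKLR
    wKLR_scaleA wKLR_scale1 wKLR_scaleDr wKLR_scaleDl.

Definition wKLR_mul (v w : wKLR) : wKLR :=
  to_wKLR (span_mul (repr v) (repr w)).

Lemma toWM x y : wKLR_mul (to_wKLR x) (to_wKLR y) = to_wKLR (span_mul x y).
Proof.
apply/toW_eq; set x' := repr _; set y' := repr _.
have nx : null_comb (x' - x) by apply/toW_eq; exact: toW_repr.
have ny : null_comb (y' - y) by apply/toW_eq; exact: toW_repr.
have -> : span_mul x' y' - span_mul x y =
    span_mul (x' - x) y' + span_mul x (y' - y).
  by rewrite smulBl smulBr addrA subrK.
by apply: nullD; [exact: nullMr | exact: nullMl].
Qed.

Definition wKLR_dg d (b c : loading d) (hb : B (ld b)) (hc : B (ld c))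
  (D : diagram b c) : wKLR := to_wKLR (span_dg hb hc D).

(* As [B] is finite, the product is the direct sum. *)
Definition polys := forall b : {b : aloading | B b}, mpoly (tag (sval b)) K.
HB.instance Definition _ := gen_eqMixin polys.
HB.instance Definition _ := gen_choiceMixin polys.

Let padd (f g : polys) : polys := fun b => f b + g b.
Let popp (f : polys) : polys := fun b => - f b.
Let pzero : polys := fun b => 0.
Let pscale (a : K) (f : polys) : polys := fun b => a *: f b.

Lemma polysP (f g : polys) : (forall b, f b = g b) -> f = g.
Proof. exact: functional_extensionality_dep. Qed.

Local Ltac pointwise lem := hnf; intros; apply: polysP => b; exact: lem.

Let paddA : associative padd. Proof. pointwise addrA. Qed.
Let paddC : commutative padd. Proof. pointwise addrC. Qed.
Let padd0 : left_id pzero padd. Proof. pointwise add0r. Qed.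
Let paddN : left_inverse pzero popp padd. Proof. pointwise addNr. Qed.
HB.instance Definition _ := GRing.isZmodule.Build polys paddA paddC padd0 paddN.

Let pscaleA a1 a2 f : pscale a1 (pscale a2 f) = pscale (a1 * a2) f.
Proof. pointwise scalerA. Qed.
Let pscale1 : left_id 1 pscale. Proof. pointwise scale1r. Qed.
Let pscaleDr : right_distributive pscale +%R. Proof. pointwise scalerDr. Qed.
Let pscaleDl f : {morph pscale^~ f : a1 a2 / a1 + a2}.
Proof. pointwise scalerDl. Qed.
HB.instance Definition _ :=
  GRing.Zmodule_isLmodule.Build K polys pscaleA pscale1 pscaleDr pscaleDl.

Definition component (f : polys) d (b : loading d) (hb : B (ld b)) :
  mpoly d K :=
  f (exist _ (ld b) hb).

Definition algebra_action (act : wKLR -> polys -> polys) :=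
  [/\ forall f, linear (act^~ f), forall w, linear (act w) &
      forall v w f, act (wKLR_mul v w) f = act v (act w f)].

Definition acts_by (act : wKLR -> polys -> polys) d (b c : loading d)
    (D : diagram b c) (op : mpoly d K -> mpoly d K) :=
  forall (hb : B (ld b)) (hc : B (ld c)) (f : polys),
    component (act (wKLR_dg hb hc D) f) hc = op (component f hb) /\
    forall b', sval b' <> ld c -> act (wKLR_dg hb hc D) f b' = 0.

End Algebra.
End WeightedKLR.

(* Main.v *)
(* Let a diagram act by the ordered product, over its dots and crossings, of the
   prescribed operators, with one variable for each strand; a diagram with
   infinitely many crossings, which exists when the weights accumulate, acts by
   0.  Simultaneous crossings and dots have commuting operators, so the product
   is well defined.  In an isotopy the zeros of the differences of two curves
   are transversal, hence finite in number and continuous in the parameter, and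
   two of them exchange heights only when their operators commute: the operator
   is locally constant, hence constant.  It remains to check the local relations,
   whose diagrams have at most three crossings of curves: these are identities
   between divided differences, which hold over any commutative ring because
   [y_k - y_l] is not a zero divisor. *)

Require Import Defs.
From mathcomp Require Import all_boot all_order all_algebra all_fingroup.
From mathcomp Require Import boolp classical_sets cardinality reals.
From mathcomp Require Import topology normedtype derive zify ring lra.
From mathcomp Require Import freeg.
From mathcomp Require mpoly.
Import -(notations) mpoly.
Import Order.TTheory GRing.Theory Num.Theory numFieldNormedType.Exports.

Local Open Scope ring_scope.

(** * Divided differences *)

(** Two conventions keep the operators independent of one another. Variables keep the numbers of the
    bottom points of their strands all the way up, and the permutation of the diagram is applied
    once, at the end: the operator of an event then depends only on two strands and a translation,
    so that words of isotopic diagrams can be compared letter by letter, as in a partially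
    commutative monoid. Each meeting is read as a passage of one strand from left to right of a
    translate of another. A passage from right to left of a ghost is the event with the strands
    exchanged and the translation negated, and it acts by the identity because an edge matching the
    reverse of another has been merged with it. Weight 0 is the delicate case, since a ghost then
    lies on its strand: for equal labels, the factor Q_e and the Demazure operator come from the
    same point, and their product P_e (s - 1) satisfies the braid relation only up to a correction.
    There may be infinitely many edges, so finiteness of the events is not assumed along an isotopy:
    it is propagated from one parameter, one pair of strands and one translation at a time. *)

Section Polynomials.
Set Implicit Arguments.
Unset Strict Implicit.
Variables (K : comNzRingType) (d : nat).
Implicit Types (f g p q r a : mpoly d K) (k l : 'I_d).

Lemma msymXU (s : {perm 'I_d}) k : msym s (yy_ k : mpoly d K) = yy_ (s k).
Proof. by rewrite /msym mmapX mmap1U. Qed.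

(** Whichever of the two monomials leads, its coefficient is 1 or -1, which is regular over any
    commutative ring. This is what makes the quotients by [yy_ l - yy_ k] unique. *)
Lemma lreg_subX k l : k <> l -> GRing.lreg (yy_ l - yy_ k : mpoly d K).
Proof.
move=> kl; apply: lreg_mleadc.
set p := (_ - _); set m := mlead p.
have klF : (mnm1 k == mnm1 l) = false.
  apply/eqP => /(congr1 (fun m : multinom d => m k)).
  by rewrite !mnm1E eqxx; case: eqP => // lk; case: kl.
have cE : mcoeff m p = (mnm1 l == m)%:R - (mnm1 k == m)%:R.
  by rewrite mcoeffB !mcoeffX.
have pN0 : p != 0.
  apply/eqP => /(congr1 (mcoeff (mnm1 l))).
  by rewrite mcoeff0 mcoeffB !mcoeffX eqxx klF subr0 => /eqP; rewrite oner_eq0.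
have : mcoeff m p != 0 by rewrite mleadc_eq0.
rewrite cE; case: (eqVneq (mnm1 l) m) => [lm|_].
  by rewrite -lm klF subr0 => _; exact: lreg1.
case: (mnm1 k == m) => /= [_|]; last by rewrite subrr eqxx.
by rewrite mulr0n sub0r; apply: lregN; exact: lreg1.
Qed.

Lemma quoP p r : (exists q, q * r = p) -> quo p r * r = p.
Proof. by move=> [q h]; rewrite /quo; case: xgetP => [x _ //|/(_ q)]. Qed.

Lemma quo_eq p q r : GRing.lreg r -> q * r = p -> quo p r = q.
Proof.
move=> rr h; apply: rr; rewrite mulrC [RHS]mulrC h; apply: quoP; by exists q.
Qed.

(** Congruence modulo [r] is stable under sums and products, so it only has to be tested on
    constants and variables. With [msym (tperm k l)] and the identity this gives the divisibility
    behind the Demazure operator. *)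
Lemma dvd_rmorphB n (phi psi : {rmorphism mpoly n K -> mpoly d K}) r :
  (forall c : K, phi (mpolyC n c) = psi (mpolyC n c)) ->
  (forall i : 'I_n, exists q, q * r = phi (yy_ i) - psi (yy_ i)) ->
  forall p : mpoly n K, exists q, q * r = phi p - psi p.
Proof.
move=> phiC phiX; elim/mpolyind => [|c m p _ _ [q qr]].
  by exists 0; rewrite mul0r !rmorph0 subrr.
have [q' qr'] : exists q, q * r = phi (mpolyX K m) - psi (mpolyX K m).
  rewrite mpolyXE_id; elim/big_rec: _ => [|k y _ [b br]].
    by exists 0; rewrite mul0r !rmorph1 subrr.
  have [a ar] : exists q, q * r = phi (yy_ k ^+ m k) - psi (yy_ k ^+ m k).
    have [b' br'] := phiX k.
    elim: (m k) => [|i [a ar]].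
      by exists 0; rewrite mul0r !rmorph1 subrr.
    exists (b' * phi (yy_ k ^+ i) + psi (yy_ k) * a).
    transitivity (b' * r * phi (yy_ k ^+ i) + psi (yy_ k) * (a * r)).
      by ring.
    by rewrite ar br' !exprS !rmorphM; ring.
  exists (a * phi y + psi (yy_ k ^+ m k) * b).
  transitivity (a * r * phi y + psi (yy_ k ^+ m k) * (b * r)); first by ring.
  by rewrite ar br !rmorphM; ring.
exists (phi (mpolyC n c) * q' + q); rewrite -mul_mpolyC !rmorphD !rmorphM -phiC.
transitivity (phi (mpolyC n c) * (q' * r) + q * r); first by ring.
by rewrite qr' qr; ring.
Qed.

Lemma demazureP k l f : k <> l ->
  demazure k l f * (yy_ l - yy_ k) = msym (tperm k l) f - f.
Proof.
move=> kl; apply: quoP.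
have := @dvd_rmorphB d (msym (tperm k l)) idfun (yy_ l - yy_ k) _ _ f; apply.
- by move=> c; rewrite /= /msym mmapC.
- move=> m /=; rewrite msymXU; case: tpermP => [->|->|_ _].
  + by exists 1; rewrite mul1r.
  + by exists (-1); rewrite mulN1r opprB.
  + by exists 0; rewrite mul0r subrr.
Qed.

Lemma demazure_eq k l f g : k <> l ->
  g * (yy_ l - yy_ k) = msym (tperm k l) f - f -> demazure k l f = g.
Proof. by move=> kl; apply: quo_eq; apply: lreg_subX. Qed.

Lemma subX_inj k l p q : k <> l ->
  p * (yy_ l - yy_ k) = q * (yy_ l - yy_ k) -> p = q.
Proof. by move=> /lreg_subX h; rewrite mulrC [RHS]mulrC; apply: h. Qed.

End Polynomials.

Section Evaluation.
Set Implicit Arguments.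
Unset Strict Implicit.
Variables (K : comNzRingType) (d : nat).
Implicit Types (a b c r : mpoly d K) (q : mpoly 2 K).

Lemma ev2M q q' a b : ev2 (q * q') a b = ev2 q a b * ev2 q' a b.
Proof. by rewrite /ev2 rmorphM. Qed.

Lemma ev2B q q' a b : ev2 (q - q') a b = ev2 q a b - ev2 q' a b.
Proof. by rewrite /ev2 rmorphB. Qed.

Lemma ev21 a b : ev2 1 a b = 1 :> mpoly d K.
Proof. by rewrite /ev2 rmorph1. Qed.

Lemma ev20 a b : ev2 0 a b = 0 :> mpoly d K.
Proof. by rewrite /ev2 rmorph0. Qed.

Lemma ev2u a b : ev2 (yy_ (ord0 : 'I_2)) a b = a.
Proof. by rewrite /ev2 comp_mpolyXU. Qed.

Lemma ev2v a b : ev2 (yy_ (ord_max : 'I_2)) a b = b.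
Proof. by rewrite /ev2 comp_mpolyXU. Qed.

Lemma msym_ev2 (s : {perm 'I_d}) q a b :
  msym s (ev2 q a b) = ev2 q (msym s a) (msym s b).
Proof.
rewrite /ev2 !comp_mpolyEX raddf_sum; apply: eq_bigr => m _ /=.
rewrite msymZ !comp_mpolyX rmorph_prod; congr (_ *: _).
apply: eq_bigr => i _; rewrite rmorphXn; congr (_ ^+ _).
by case: i => [[|[|//]] h].
Qed.

Lemma ev2C q a b : msym (tperm ord0 ord_max) q = q -> ev2 q a b = ev2 q b a.
Proof.
move=> sq; rewrite /ev2 -{1}sq msym_mPo; congr (comp_mpoly _ _).
apply: eq_from_tnth => i; rewrite tnth_mktuple.
have [->|->] : i = ord0 \/ i = ord_max.
- by case: i => [[|[|//]] h]; [left|right]; apply: val_inj.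
- by rewrite tpermL !(tnth_nth 0).
- by rewrite tpermR !(tnth_nth 0).
Qed.

End Evaluation.

(** * Operators of events *)

Section Demazure.
Set Implicit Arguments.
Unset Strict Implicit.
Variables (K : comNzRingType) (d : nat).
Implicit Types (f g p : mpoly d K) (k l : 'I_d) (s : {perm 'I_d}).

Lemma demazure_linear a k l f g : k <> l ->
  demazure k l (a *: f + g) = a *: demazure k l f + demazure k l g.
Proof.
move=> kl; apply: demazure_eq => //.
rewrite mulrDl -scalerAl !demazureP // msymD msymZ scalerBr opprD.
by rewrite addrACA.
Qed.

Lemma demazureMl k l p f : k <> l -> msym (tperm k l) p = p ->
  demazure k l (p * f) = p * demazure k l f.
Proof.
move=> kl ps; apply: demazure_eq => //.
by rewrite -mulrA demazureP // msymM ps mulrBr.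
Qed.

(** Conjugation by [s] turns [tperm k l] into [tperm (s k) (s l)], so both sides are the quotient of
    the same polynomial by the same regular element. *)
Lemma msym_demazure s k l f : k <> l ->
  msym s (demazure k l f) = demazure (s k) (s l) (msym s f).
Proof.
move=> kl; apply/esym/demazure_eq; first by move/perm_inj.
have := congr1 (msym s) (demazureP f kl).
rewrite msymM msymB [msym s (_ - f)]msymB !msymXU => ->.
by rewrite -!msymMm -tpermJ conjgE !mulgA mulgV mul1g.
Qed.

Lemma msym_tperm_demazure k l f : k <> l ->
  msym (tperm k l) (demazure k l f) = demazure k l f.
Proof.
move=> kl; apply/esym/demazure_eq => //.
have := congr1 (msym (tperm k l)) (demazureP f kl).
rewrite msymM msymB [msym _ (_ - f)]msymB !msymXU tpermL tpermR.
rewrite -msymMm tperm2 msym1m => h.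
by rewrite -[RHS]opprB -h -mulrN opprB.
Qed.

End Demazure.

Section Events.
Set Implicit Arguments.
Unset Strict Implicit.
Variables (R : realType) (K : comNzRingType) (G : wgraph R K).

(* The event [(k, l, delta)] is the passage of strand [k] from the left of
   strand [l], translated by [delta], to its right; [(k, k, 0)] is a dot. *)
Definition event d := ('I_d * 'I_d * R)%type.

Section Operators.
Variable d : nat.
Implicit Types (lb : 'I_d -> vertex G) (f g p : mpoly d K) (k l : 'I_d).
Implicit Types (c : event d) (s : {perm 'I_d}) (e : edge G).

Definition joins lb c e :=
  [/\ etail e = lb c.1.1, ehead e = lb c.1.2 & weight e = c.2].

(** By [edges_merged] at most one edge joins the two labels with this weight, so the value does not
    depend on the choice. *)
Definition event_poly lb c : mpoly d K :=
  if pselect (exists e, joins lb c e) is left h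
  then ev2 (Qpoly (projT1 (cid h))) (yy_ c.1.2) (yy_ c.1.1) else 1.

Definition is_demazure lb c := [/\ c.1.1 <> c.1.2, c.2 = 0 & lb c.1.1 = lb c.1.2].

(* The variables are numbered by the bottom points of the strands throughout,
   so that a crossing of strands with different labels does nothing here. *)
Definition event_op lb c f : mpoly d K :=
  if c.1.1 == c.1.2 then yy_ c.1.1 * f
  else if pselect (is_demazure lb c) is left _
  then ev2 (loopQ (lb c.1.1)) (yy_ c.1.2) (yy_ c.1.1) * demazure c.1.1 c.1.2 f
  else event_poly lb c * f.

Lemma event_op_dot lb k delta f : event_op lb (k, k, delta) f = yy_ k * f.
Proof. by rewrite /event_op eqxx. Qed.

Lemma event_op_demazure lb k l f : k <> l -> lb k = lb l ->
  event_op lb (k, l, 0) f = ev2 (loopQ (lb k)) (yy_ l) (yy_ k) * demazure k l f.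
Proof.
move=> kl lkl; rewrite /event_op /=; case: eqP => // _.
by case: pselect => // -[]; split.
Qed.

Lemma event_op_mul lb k l delta f : k <> l -> ~ (delta = 0 /\ lb k = lb l) ->
  event_op lb (k, l, delta) f = event_poly lb (k, l, delta) * f.
Proof.
move=> kl ns; rewrite /event_op /=; case: eqP => // _.
by case: pselect => // -[/= _ d0 e]; case: ns.
Qed.

Lemma event_poly_edge lb c e : joins lb c e ->
  event_poly lb c = ev2 (Qpoly e) (yy_ c.1.2) (yy_ c.1.1).
Proof.
move=> je; rewrite /event_poly; case: pselect => [h|[]]; last by exists e.
have [t1 h1 w1] := projT2 (cid h); case: (je) => [t2 h2 w2].
by rewrite (@edges_merged _ _ _ (projT1 (cid h)) e) // (t1, h1, w1) ?t2 ?h2 ?w2.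
Qed.

Lemma event_poly_noedge lb c : (forall e, ~ joins lb c e) -> event_poly lb c = 1.
Proof.
by move=> nj; rewrite /event_poly; case: pselect => // h; have [e /nj] := h.
Qed.

Variant event_op_spec lb c : (mpoly d K -> mpoly d K) -> Prop :=
| EventMul p : ~ is_demazure lb c ->
    (forall s, s c.1.1 = c.1.1 -> s c.1.2 = c.1.2 -> msym s p = p) ->
    event_op_spec lb c ( *%R p)
| EventDemazure k l : c = (k, l, 0) -> k <> l -> lb k = lb l ->
    event_op_spec lb c
      (fun f => ev2 (loopQ (lb k)) (yy_ l) (yy_ k) * demazure k l f).

Lemma event_opP lb c : event_op_spec lb c (event_op lb c).
Proof.
case: c => [[k l] delta]; have [<-|/eqP kl] := eqVneq k l.
  rewrite (_ : event_op _ _ = *%R (yy_ k)); last first.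
    by apply/funext => f; rewrite event_op_dot.
  constructor; first by case.
  by move=> s /= sk _; rewrite msymXU sk.
have [[-> lkl]|nd] := pselect (delta = 0 /\ lb k = lb l).
  rewrite (_ : event_op _ _ = fun f => ev2 (loopQ (lb k)) (yy_ l) (yy_ k) *
    demazure k l f); first exact: EventDemazure.
  by apply/funext => f; rewrite event_op_demazure.
rewrite (_ : event_op _ _ = *%R (event_poly lb (k, l, delta))); last first.
  by apply/funext => f; rewrite event_op_mul.
constructor; first by case=> /= _ d0 lkl; apply: nd.
move=> s /= sk sl.
rewrite /event_poly; case: pselect => [h|_]; last by rewrite rmorph1.
by rewrite msym_ev2 !msymXU /= sk sl.
Qed.

Lemma event_op_linear lb c a f g :
  event_op lb c (a *: f + g) = a *: event_op lb c f + event_op lb c g.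
Proof.
case: event_opP => [p _ _|k l _ kl _]; first by rewrite mulrDr scalerAr.
by rewrite demazure_linear // mulrDr scalerAr.
Qed.

Lemma event_opMl lb c p f : msym (tperm c.1.1 c.1.2) p = p ->
  event_op lb c (p * f) = p * event_op lb c f.
Proof.
case: event_opP => [q _ _ _|k l -> kl _ ps]; first by rewrite mulrCA.
by rewrite demazureMl // mulrCA.
Qed.

Definition event_perm s c : event d := (s c.1.1, s c.1.2, c.2).

(** Events above a diagram are renumbered by its permutation; this equivariance moves the
    permutation past their operators when diagrams are stacked. *)
Lemma msym_event_op lb lb' s c f : (forall k, lb' (s k) = lb k) ->
  msym s (event_op lb c f) = event_op lb' (event_perm s c) (msym s f).
Proof.
case: c => [[k l] delta] lbs; rewrite /event_perm /=.
have [<-|/eqP kl] := eqVneq k l; first by rewrite !event_op_dot msymM msymXU.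
have skl : s k <> s l by move/perm_inj.
have [[-> lkl]|nd] := pselect (delta = 0 /\ lb k = lb l).
  rewrite !event_op_demazure ?lbs // msymM msym_ev2 !msymXU msym_demazure //.
rewrite !event_op_mul ?lbs // msymM; congr (_ * _).
rewrite /event_poly /joins /= !lbs; case: pselect => h; last by rewrite rmorph1.
by rewrite msym_ev2 !msymXU.
Qed.

(** The operator of [c] is linear, commutes with multiplication by [yy_ k] and [yy_ l], which the
    swap of its own strands fixes, and commutes with [tperm k l], which fixes its strands. It
    therefore commutes with the divided difference, whether [c] is a dot, a multiplication or
    another Demazure event. *)
Lemma event_op_demazure_comm lb k l c f : lb k = lb l -> k <> l ->
  c.1.1 <> k -> c.1.1 <> l -> c.1.2 <> k -> c.1.2 <> l ->
  event_op lb c (event_op lb (k, l, 0) f) = event_op lb (k, l, 0) (event_op lb c f).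
Proof.
move=> lkl kl mk ml nk nl.
have sX m : m = k \/ m = l ->
    msym (tperm c.1.1 c.1.2) (yy_ m) = yy_ m :> mpoly d K.
  move=> mkl; rewrite msymXU tpermD //; apply/eqP => e;
    by case: mkl => e'; congruence.
have sXk := sX k (or_introl erefl); have sXl := sX l (or_intror erefl).
rewrite !event_op_demazure // event_opMl; last by rewrite msym_ev2 sXk sXl.
congr (_ * _); apply/esym/demazure_eq => //.
have e1 : event_op lb c (demazure k l f) * (yy_ l - yy_ k) =
    event_op lb c (msym (tperm k l) f - f).
  by rewrite -demazureP // [in RHS]mulrC event_opMl ?msymB ?sXk ?sXl // mulrC.
rewrite e1 addrC -scaleN1r event_op_linear scaleN1r addrC; congr (_ - _).
rewrite (@msym_event_op lb lb) //; last by move=> m; case: tpermP => [->|->|].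
congr (event_op lb _ _); case: (c) mk ml nk nl => [[m n] delta] /= mk ml nk nl.
by rewrite /event_perm /= !tpermD //; apply/eqP => e; congruence.
Qed.

End Operators.
End Events.

(* [r] and [r'] are the orders of the letters in the words [u] and [u']. *)
Lemma foldl_trace (T : eqType) (A : Type) (op : T -> A -> A) (r r' : rel T)
    (u u' : seq T) :
  perm_eq u u' -> pairwise r u -> pairwise r' u' ->
  (forall x y, x \in u -> y \in u -> r x y -> r' y x ->
     forall a, op x (op y a) = op y (op x a)) ->
  forall a, foldl (fun a x => op x a) a u = foldl (fun a x => op x a) a u'.
Proof.
elim: u u' => [|x u IH] u' puu';
  first by move: puu'; rewrite perm_sym => /perm_nilP ->.
have : x \in u' by rewrite -(perm_mem puu') mem_head.
move=> xu' /= /andP[xu ru] ru'; move: xu' puu' ru'; case/splitPr=> u1 u2.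
rewrite -[x :: u2]cat1s perm_sym perm_catCA /= perm_cons perm_sym => puu'.
rewrite pairwise_cat => /= /and3P[u12 ru1 /andP[_ ru2]].
move=> com a.
have mu y : y \in u1 -> y \in x :: u.
  by move=> yu1; rewrite inE (perm_mem puu') mem_cat yu1 orbT.
rewrite foldl_cat /=.
have -> : op x (foldl (fun a x => op x a) a u1) =
    foldl (fun a x => op x a) (op x a) u1.
  have {}mu y : y \in u1 -> op x \o op y =1 op y \o op x.
    move=> yu1; have [->//|yx] := eqVneq y x => b /=.
    apply: com; rewrite ?mem_head ?mu //.
    - by have := mu _ yu1; rewrite inE (negPf yx) /= => /(allP xu).
    - by have /allrelP := u12; apply=> //; rewrite mem_head.
  elim: u1 a mu {puu' u12 ru1} => //= y u1 IH1 a mu.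
  rewrite IH1; first by rewrite -[op x (op y a)]/((op x \o op y) a) mu ?mem_head.
  by move=> z zu1; apply: mu; rewrite inE zu1 orbT.
rewrite -foldl_cat; apply: IH => //.
  rewrite pairwise_cat ru1 ru2 !andbT.
  by apply/allrelP => y z yu zu; have /allrelP := u12; apply=> //;
    rewrite inE zu orbT.
by move=> y z yu zu; apply: com; rewrite inE ?yu ?zu orbT.
Qed.

(** * Words of events and the operator of a diagram *)

Section Action.
Set Implicit Arguments.
Unset Strict Implicit.
Variables (R : realType) (K : comNzRingType) (G : wgraph R K).

Section Words.
Variables (d : nat) (b c : loading G d) (D : diagram b c).
Local Notation event := (event R d).
Implicit Types (w : seq (R * event)) (x : R * event) (f : mpoly d K).

(** The slopes select the passages from left to right. The opposite passage can only occur as the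
    event with the strands exchanged and the translation negated, if those labels interact too. *)
Definition occurs (q : event) (t : R) : Prop :=
  if q.1.1 == q.1.2 then q.2 = 0 /\ t \in dots D q.1.1
  else interaction (lab b) (strand D) t q.1.1 q.1.2 q.2 /\
       derive1 (strand D q.1.2) t < derive1 (strand D q.1.1) t.

Definition bytime : rel (R * event) := fun x y => x.1 <= y.1.

Definition run (lb : 'I_d -> vertex G) w f :=
  foldl (fun g x => event_op lb x.2 g) f w.

(** The order by height is weak: simultaneous events may be listed in any order, so a diagram can
    have several words. *)
Definition word_of w :=
  [/\ uniq w, sorted bytime w & forall x, x \in w <-> occurs x.2 x.1].

(* A diagram can have infinitely many events if the weights accumulate; these
   diagrams span an ideal, which acts by 0. *)
Definition diagram_op f : mpoly d K :=
  if pselect (exists w, word_of w) is left h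
  then msym (dperm D) (run (lab b) (projT1 (cid h)) f) else 0.

Lemma bytime_trans : transitive bytime.
Proof. by move=> y x z; exact: le_trans. Qed.

(** The strands [k] and [l] have the same label and meet at height [t], so a curve interacting with
    one of them there would interact with the other as well and form a triple point. Dots on
    crossings are excluded by [dots_generic]. *)
Lemma occurs_demazure_disjoint t k l q : lab b k = lab b l ->
  occurs (k, l, 0) t -> k <> l -> occurs q t ->
  q = (k, l, 0) \/
  [/\ q.1.1 <> k, q.1.1 <> l, q.1.2 <> k & q.1.2 <> l].
Proof.
move=> lkl + /eqP kl; rewrite /occurs /= (negPf kl) => -[ikl dkl].
have ilk : interaction (lab b) (strand D) t l k 0.
  case: ikl => kl' _ e; split; [by move/esym|by left|by rewrite e !addr0].
case: q => -[m n] delta /=; have [<-|/eqP mn] := eqVneq m n => /=.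
  case=> _ tD; right; case: ikl => _ _; rewrite addr0 => e.
  have mk : m <> k.
    by move=> mk; subst m; apply: (dots_generic tD (l := l)) => // lk;
       rewrite lk eqxx in kl.
  have ml : m <> l.
    by move=> ml; subst m; apply: (dots_generic tD (l := k)) => // lk;
       rewrite lk eqxx in kl.
  by split.
case=> imn dmn.
have [mk|/eqP mk] := eqVneq m k.
  subst m; have nl := no_triple_point imn ikl; subst n; left.
  case: ikl imn => _ _ e1 [_ _ e2]; congr (_, _, _).
  by apply: (@addrI _ (strand D l t)); rewrite -e2 -e1.
have [ml|/eqP ml] := eqVneq m l.
  subst m; have nk := no_triple_point imn ilk; subst n.
  by have := lt_trans dkl dmn; rewrite ltxx.
have [_ imn' emn] := imn; have [_ _ ekl] := ikl.
right; split=> //= nk; subst n; apply: (elimN eqP kl).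
- apply: no_triple_point imn (_ : interaction _ _ _ m l delta).
  by split; rewrite -?lkl // emn ekl addr0.
- apply: no_triple_point (_ : interaction _ _ _ m k delta) imn.
  by split; rewrite ?lkl // emn ekl addr0.
Qed.

(** Two multiplications commute, and a Demazure event shares no strand with another event at the
    same height. *)
Lemma simultaneous_event_op t q q' f : occurs q t -> occurs q' t ->
  event_op (lab b) q (event_op (lab b) q' f) = event_op (lab b) q' (event_op (lab b) q f).
Proof.
wlog dq : q q' / is_demazure (lab b) q.
  move=> H eq eq'; have [/H|nq] := pselect (is_demazure (lab b) q); first exact.
  have [dq'|nq'] := pselect (is_demazure (lab b) q'); first by rewrite (H q' q).
  case: (event_opP (K := K) (lab b) q) nq => [p _ _ _|k l -> kl lkl []//].
  case: (event_opP (K := K) (lab b) q') nq' => [p' _ _ _|k l -> kl lkl []//].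
  by rewrite mulrCA.
case: q dq => -[k l] delta [/= kl -> lkl] eq eq'.
have [->//|[]] := occurs_demazure_disjoint lkl eq kl eq'.
by move=> *; rewrite event_op_demazure_comm.
Qed.

Lemma diagram_op_word w f : word_of w -> diagram_op f = msym (dperm D) (run (lab b) w f).
Proof.
move=> [uw sw ww]; rewrite /diagram_op; case: pselect => [h|[]]; last by exists w.
have [uw' sw' ww'] := projT2 (cid h); set w' := projT1 _ in uw' sw' ww' *.
congr (msym _ _); apply: (@foldl_trace _ _ (fun x => event_op (lab b) x.2)
  bytime bytime).
- by apply: uniq_perm => // x; apply/idP/idP => /[!ww] /[!ww'].
- by rewrite -(sorted_pairwise bytime_trans).
- by rewrite -(sorted_pairwise bytime_trans).
move=> x y /ww' ex /ww' ey xy yx g; apply: (@simultaneous_event_op x.1) => //.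
by rewrite (@le_anti _ _ x.1 y.1) //; apply/andP.
Qed.

Lemma diagram_op_infinite f : (~ exists w, word_of w) -> diagram_op f = 0.
Proof. by rewrite /diagram_op; case: pselect. Qed.

Lemma diagram_op_weak_word w f : uniq w -> sorted bytime w ->
  (forall q t, occurs q t -> (t, q) \in w) ->
  (forall x, x \in w -> occurs x.2 x.1 \/ event_op (lab b) x.2 =1 (@id (mpoly d K))) ->
  diagram_op f = msym (dperm D) (run (lab b) w f).
Proof.
move=> uw sw evw wev.
rewrite (@diagram_op_word [seq x <- w | `[< occurs x.2 x.1 >]]); last first.
  split; [exact: filter_uniq|exact: sorted_filter bytime_trans _ _ sw|].
  move=> [t q]; rewrite mem_filter; split; first by case/andP => /asboolP.
  by move=> e; rewrite evw // andbT; apply/asboolP.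
congr (msym _ _); elim: w {uw sw evw} wev f => //= x w IH wev f.
have {}IH := IH (fun y yw => wev y (mem_behead (s := x :: w) yw)).
case: asboolP => ex /=; first exact: IH.
by rewrite IH; have [//|/= ->] := wev x (mem_head _ _).
Qed.

Lemma diagram_op_linear a f g : diagram_op (a *: f + g) = a *: diagram_op f + diagram_op g.
Proof.
rewrite /diagram_op; case: pselect => [h|_]; last by rewrite scaler0 addr0.
rewrite -msymZ -msymD; congr (msym _ _).
elim: (projT1 _) f g => //= x w IH f g.
by rewrite event_op_linear IH.
Qed.

(** Any finite list containing the events can be filtered and sorted, so finiteness is the only
    obstruction to having a word. *)
Lemma word_exists : (exists w, word_of w) <->
  exists s : seq (R * event), forall q t, occurs q t -> (t, q) \in s.
Proof.
split=> [[w [_ _ ww]]|[s ss]]; first by exists w => q t e; apply/ww.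
exists (sort bytime (undup [seq x <- s | `[< occurs x.2 x.1 >]])); split.
- by rewrite sort_uniq undup_uniq.
- by apply: sort_sorted => x y; apply: le_total.
move=> [t q]; rewrite mem_sort mem_undup mem_filter; split.
  by case/andP => /asboolP.
by move=> e; rewrite ss // andbT; apply/asboolP.
Qed.

End Words.

(** * Stacking becomes composition *)

Section Stack.
Variables (d : nat) (b c a : loading G d) (D2 : diagram c a) (D1 : diagram b c).

Definition shift_lo (x : R * event R d) : R * event R d := (x.1 / 2, x.2).

(** The strands of the stack are numbered at the bottom of [D1], those of [D2] at the top of [D1],
    whence the inverse permutation. *)
Definition shift_hi (x : R * event R d) : R * event R d :=
  ((1 + x.1) / 2, event_perm (dperm D1)^-1 x.2).

Lemma occurs_inside (b' c' : loading G d) (D : diagram b' c') q t :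
  occurs D q t -> 0 < t < 1.
Proof.
by rewrite /occurs; case: eqP => _ []; [move=> _ /dots_inside|move/interaction_out].
Qed.

Lemma occurs_stack_lo q t : t < 1 / 2 -> occurs (stack D2 D1) q t <-> occurs D1 q (2 * t).
Proof.
move=> ht; rewrite /occurs; case: eqP => _ /=.
  split=> -[q0 tD]; split=> //.
  - have [[u uD ->]|[u /dots_inside/andP[u0 _] tu]] := stack_dots_cases tD.
      by rewrite mulrC divfK ?pnatr_eq0.
    by exfalso; lra.
  - rewrite /stack_dots mem_cat; apply/orP; left; apply/mapP.
    by exists (2 * t) => //; lra.
rewrite !stack_derive !(derive1_lcst (@strand_bot _ _ _ _ _ _ D2 _)); [|lra..].
have lohi : stack_strand D2 D1 ^~ t = strand D1 ^~ (2 * t).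
  by apply/funext => k; rewrite stack_strand_lo //; lra.
rewrite /interaction (congr1 (@^~ q.1.1) lohi) (congr1 (@^~ q.1.2) lohi).
by split=> -[? ?]; split=> //; lra.
Qed.

Lemma occurs_stack_hi q t : 1 / 2 <= t ->
  occurs (stack D2 D1) q t <-> occurs D2 (event_perm (dperm D1) q) (2 * t - 1).
Proof.
move=> ht; rewrite /occurs /= (inj_eq perm_inj); case: eqP => [q12|q12].
  split=> -[q0 tD]; split=> //.
  - have [[u /dots_inside/andP[_ u1] tu]|[u uD ->]] := stack_dots_cases tD.
      by exfalso; lra.
    by rewrite mulrC divfK ?pnatr_eq0 // addrC addKr.
  - rewrite /stack_dots mem_cat; apply/orP; right; apply/mapP.
    by exists (2 * t - 1) => //; lra.
(* At the joint both sides are false, because interactions stay away from the ends of each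
   diagram. *)
have [t12|t12] := eqVneq t (1 / 2).
  split=> -[].
    move=> /stack_interaction [[ht' _]|[ht' _]] _; rewrite t12 ltxx in ht' => //.
  by move=> /interaction_out; lra.
have {t12} ht' : 1 / 2 < t by rewrite lt_neqAle eq_sym t12.
rewrite !stack_derive !(derive1_rcst (@strand_top _ _ _ _ _ _ D1 _)); [|lra..].
have lohi : stack_strand D2 D1 ^~ t = fun k => strand D2 (dperm D1 k) (2 * t - 1).
  by apply/funext => k; rewrite stack_strand_hi //; lra.
rewrite /interaction (congr1 (@^~ q.1.1) lohi) (congr1 (@^~ q.1.2) lohi).
rewrite !strand_lab.
by split=> -[[q12' i e] h]; (split; last lra); split=> // /perm_inj.
Qed.

Lemma event_permKV (s : {perm 'I_d}) : cancel (event_perm (R := R) s^-1) (event_perm s).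
Proof. by case=> -[k l] delta; rewrite /event_perm /= !permKV. Qed.

Lemma event_permK (s : {perm 'I_d}) : cancel (event_perm (R := R) s) (event_perm s^-1).
Proof. by case=> -[k l] delta; rewrite /event_perm /= !permK. Qed.

Lemma word_stack w1 w2 : word_of D1 w1 -> word_of D2 w2 ->
  word_of (stack D2 D1) (map shift_lo w1 ++ map shift_hi w2).
Proof.
move=> [u1 s1 m1] [u2 s2 m2].
have lo x : x \in map shift_lo w1 -> x.1 < 1 / 2.
  by move=> /mapP[y /m1/occurs_inside/andP[_ y1] ->] /=; lra.
have hi x : x \in map shift_hi w2 -> 1 / 2 < x.1.
  by move=> /mapP[y /m2/occurs_inside/andP[y0 _] ->] /=; lra.
split.
- rewrite cat_uniq; apply/and3P; split.
  + rewrite map_inj_uniq // => -[t q] [t' q'] [tt' ->].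
    by congr (_, _); lra.
  + by apply/hasPn => x /hi hx; apply/negP => /lo; lra.
  + rewrite map_inj_uniq // => -[t q] [t' q'] e.
    have /(can_inj (event_permKV _)) /= -> := congr1 snd e.
    by congr (_, _); have /= := congr1 fst e; lra.
- rewrite (sorted_pairwise (@bytime_trans d)) pairwise_cat.
  rewrite -!(sorted_pairwise (@bytime_trans d)); apply/and3P; split.
  + by apply/allrelP => x y /lo hx /hi hy; rewrite /bytime; lra.
  + by apply: homo_sorted s1 => x y; rewrite /bytime /=; lra.
  + by apply: homo_sorted s2 => x y; rewrite /bytime /=; lra.
move=> [t q]; rewrite mem_cat /=; split.
  case/orP => h.
    rewrite occurs_stack_lo; last exact: lo h.
    by case/mapP: h => -[t' q'] /m1 /= h [-> ->]; rewrite mulrC divfK ?pnatr_eq0.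
  rewrite occurs_stack_hi; last exact: ltW (hi _ h).
  case/mapP: h => -[t' q'] /m2 /= h [-> ->]; rewrite event_permKV.
  by rewrite mulrC divfK ?pnatr_eq0 // addrC addKr.
case: (ltP t (1 / 2)) => ht; last first.
  rewrite occurs_stack_hi // => h; apply/orP; right; apply/mapP.
  exists (2 * t - 1, event_perm (dperm D1) q); first exact/m2.
  by rewrite /shift_hi /= event_permK; congr (_, _); lra.
rewrite occurs_stack_lo // => h; apply/orP; left; apply/mapP.
exists (2 * t, q); first exact/m1.
by congr (_, _) => /=; lra.
Qed.

Lemma msym_run_hi w (f : mpoly d K) :
  msym (dperm D1) (run (lab b) (map shift_hi w) f) =
  run (lab c) w (msym (dperm D1) f).
Proof.
elim: w f => //= x w IH f; rewrite IH; congr (run _ _ _).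
rewrite (@msym_event_op _ _ _ _ _ (lab c)) /=; last exact: strand_lab.
by rewrite event_permKV.
Qed.

(** A word of the stack would give words of both factors. Acting by 0 on diagrams with infinitely
    many events is therefore compatible with composition; in the finite case the words are
    concatenated after renumbering. *)
Lemma diagram_op_stack (f : mpoly d K) :
  diagram_op (stack D2 D1) f = diagram_op D2 (diagram_op D1 f).
Proof.
have [[w1 h1]|n1] := pselect (exists w, word_of D1 w); last first.
  rewrite (@diagram_op_infinite _ _ _ D1) // (_ : diagram_op D2 0 = 0); last first.
    by have := diagram_op_linear D2 (-1) 0 0; rewrite scaler0 addr0 scaleN1r addNr.
  apply: diagram_op_infinite => -[w [_ _ hw]]; apply/n1/word_exists.
  exists [seq (2 * x.1, x.2) | x <- w] => q t e.
  apply/mapP; exists (t / 2, q); last by congr (_, _) => /=; lra.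
  apply/hw => /=; have /andP[_ t1] := occurs_inside e.
  by rewrite occurs_stack_lo; [rewrite mulrC divfK ?pnatr_eq0|lra].
have [[w2 h2]|n2] := pselect (exists w, word_of D2 w); last first.
  rewrite (@diagram_op_infinite _ _ _ D2) //.
  apply: diagram_op_infinite => -[w [_ _ hw]]; apply/n2/word_exists.
  exists [seq (2 * x.1 - 1, event_perm (dperm D1) x.2) | x <- w] => q t e.
  apply/mapP; exists ((1 + t) / 2, event_perm (dperm D1)^-1 q); last first.
    by rewrite /= event_permKV; congr (_, _) => /=; lra.
  apply/hw => /=; have /andP[t0 _] := occurs_inside e.
  rewrite occurs_stack_hi; last by lra.
  by rewrite event_permKV mulrC divfK ?pnatr_eq0 // addrC addKr.
rewrite (diagram_op_word _ (word_stack h1 h2)) (diagram_op_word _ h1).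
rewrite (diagram_op_word _ h2) /= msymMm.
rewrite /run foldl_cat -!/(run _ _ _) msym_run_hi. congr (msym _ (run _ _ (msym _ _))).
by elim: w1 {h1} f => //= x w1 IH f; rewrite IH.
Qed.

End Stack.
End Action.

(** * Crossings in a family of curves *)

Section RealCalculus.
Set Implicit Arguments.
Unset Strict Implicit.
Local Open Scope classical_set_scope.
Variable R : realType.
Implicit Types (f : R -> R) (g : R -> R -> R) (a b e s t z : R).

(** Only the height carries derivatives. An isotopy is merely continuous in its parameter, so
    monotonicity in the height replaces the implicit function theorem. *)
Definition family_C1 g (g' : R -> R -> R) :=
  [/\ continuous (fun p : R * R => g p.1 p.2),
      continuous (fun p : R * R => g' p.1 p.2) &
      forall s t, is_derive t (1 : R) (g s) (g' s t)].

Lemma near_pair (P : R -> R -> Prop) s t :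
  (\forall p \near (s, t), P p.1 p.2) ->
  \forall e \near 0^'+, forall s' t', `|s' - s| <= e -> `|t' - t| <= e -> P s' t'.
Proof.
case=> -[U V] /= [/nbhs_ballP[e1 /= e10 U1] /nbhs_ballP[e2 /= e20 V2]] UV.
near=> e => s' t' hs ht; apply: (UV (s', t')); split=> /=.
- apply: U1; rewrite /ball /= distrC (le_lt_trans hs) //; near: e;
  exact: nbhs_right_lt.
- apply: V2; rewrite /ball /= distrC (le_lt_trans ht) //; near: e;
  exact: nbhs_right_lt.
Unshelve. all: by end_near. Qed.

Lemma family_C1N g g' : family_C1 g g' ->
  family_C1 (fun s t => - g s t) (fun s t => - g' s t).
Proof.
case=> cg cg' dg; split=> [p|p|s t]; [exact: (cvgN (cg p))|exact: (cvgN (cg' p))|].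
exact: is_deriveN.
Qed.

Lemma family_slice g g' s : family_C1 g g' -> continuous (g s).
Proof.
case=> _ _ dg t; apply/differentiable_continuous/derivable1_diffP.
by have [] := dg s t.
Qed.

Lemma family_param g g' t : family_C1 g g' -> continuous (g ^~ t).
Proof.
case=> cg _ _ s.
move=> U /(cg (s, t)) [[A B] /= [As Bt] AB].
apply: filterS As => x Ax; apply: (AB (x, t)); split=> //=.
exact: nbhs_singleton Bt.
Qed.

Lemma increasing_C1 g g' s a b : family_C1 g g' ->
  (forall t, a <= t <= b -> 0 < g' s t) ->
  forall t t', a <= t -> t < t' -> t' <= b -> g s t < g s t'.
Proof.
move=> gC pos t t' at_ tt' t'b; have [_ _ dg] := gC.
have [u] := @MVT _ (g s) (g' s) t t' tt' (fun x _ => dg s x)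
  (continuous_subspaceT (family_slice (s := s) gC)).
rewrite in_itv /= => /andP[tu ut'] h.
rewrite -subr_gt0 h mulr_gt0 ?subr_gt0 // pos //; lra.
Qed.

Definition box_zero g (g' : R -> R -> R) t0 e s z := `|z - t0| < e /\
  forall t, `|t - t0| <= e ->
    [/\ 0 < g' s t, g s t = 0 <-> t = z, t < z -> g s t < 0
      & z < t -> 0 < g s t].

Lemma zero_box g g' s0 t0 : family_C1 g g' -> g s0 t0 = 0 -> 0 < g' s0 t0 ->
  \forall e \near 0^'+, \forall s \near s0, exists z, box_zero g g' t0 e s z.
Proof.
move=> gC g0 g'0; have [cg cg' dg] := gC.
have box : \forall e \near 0^'+, forall s t, `|s - s0| <= e -> `|t - t0| <= e ->
    0 < g' s t.
  apply: (@near_pair (fun s t => 0 < g' s t)).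
  exact: (cg' (s0, t0) _ (lt_nbhsr g'0)).
near=> e.
have e0 : 0 < e by near: e; exact: nbhs_right_gt.
have pos s t : `|s - s0| <= e -> `|t - t0| <= e -> 0 < g' s t.
  by move: s t; near: e.
have inc s : `|s - s0| <= e -> forall t t', `|t - t0| <= e -> `|t' - t0| <= e ->
    t < t' -> g s t < g s t'.
  move=> hs t t'; rewrite !ler_distl => /andP[? ?] /andP[? ?] tt'.
  apply: (@increasing_C1 g g' s (t0 - e) (t0 + e)) => // u hu.
  by apply: pos => //; rewrite ler_distl.
have lo : g s0 (t0 - e) < 0.
  rewrite -g0; apply: inc; rewrite ?subrr ?normr0 ?(ltW e0) //.
  - by rewrite addrC addKr normrN gtr0_norm.
  - by lra.
have hi : 0 < g s0 (t0 + e).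
  rewrite -g0; apply: inc; rewrite ?subrr ?normr0 ?(ltW e0) //.
  - by rewrite addrC addKr gtr0_norm.
  - by lra.
near=> s.
have se : `|s - s0| <= e.
  by rewrite distrC ltW //; near: s; exact: (nbhsx_ballx s0 e e0).
have slo : g s (t0 - e) < 0.
  by near: s; exact: (family_param (t := t0 - e) gC (lt_nbhsl lo)).
have shi : 0 < g s (t0 + e).
  by near: s; exact: (family_param (t := t0 + e) gC (lt_nbhsr hi)).
have [z] := @IVT _ (g s) (t0 - e) (t0 + e) 0 ltac:(lra)
  (continuous_subspaceT (family_slice (s := s) gC))
  ltac:(by rewrite ge_min le_max (ltW slo) (ltW shi) orbT).
rewrite in_itv /= => /andP[z1 z2] gz.
have ze : `|z - t0| <= e by rewrite ler_distl z1 z2.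
exists z; split.
  rewrite ltr_distl !lt_neqAle z1 z2 !andbT.
  apply/andP; split; apply/eqP => ez.
    by rewrite ez gz ltxx in slo.
  by rewrite -ez gz ltxx in shi.
move=> t te; split.
- exact: pos.
- split=> [gt|->//]; apply/eqP; case: (ltgtP t z) => // tz.
    by have := inc _ se _ _ te ze tz; rewrite gt gz ltxx.
  by have := inc _ se _ _ ze te tz; rewrite gt gz ltxx.
- by move=> /(inc _ se _ _ te ze); rewrite gz.
- by move=> /(inc _ se _ _ ze te); rewrite gz.
Unshelve. all: by end_near. Qed.

Lemma near_all (T : eqType) (I : Type) (F : set_system I) {FF : Filter F}
    (P : T -> I -> Prop) (u : seq T) :
  (forall x, x \in u -> \forall i \near F, P x i) ->
  \forall i \near F, forall x, x \in u -> P x i.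
Proof.
elim: u => [|x u IH] Pu; first exact: nearW.
have Px := Pu x (mem_head _ _).
have {}IH := IH (fun y yu => Pu y (mem_behead (s := x :: u) yu)).
near=> i => y; rewrite inE => /predU1P[->|]; first by near: i.
by move: y; near: i.
Unshelve. all: by end_near. Qed.

Definition upcrossing g (g' : R -> R -> R) s t := g s t = 0 /\ 0 < g' s t.

(** By transversality, one of the open conditions [g != 0] and [g' < 0] holds at such a point. *)
Lemma not_upcrossing_near g g' s0 t0 : family_C1 g g' ->
  (forall s t, g s t = 0 -> g' s t <> 0) ->
  ~ upcrossing g g' s0 t0 ->
  \forall p \near (s0, t0), ~ upcrossing g g' p.1 p.2.
Proof.
case=> cg cg' _ tr nu; have [g0|g0] := eqVneq (g s0 t0) 0.
  have : g' s0 t0 < 0.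
    rewrite lt_neqAle; apply/andP; split; first exact/eqP/tr.
    by rewrite leNgt; apply/negP => h; apply: nu.
  move=> h; have H : \forall p \near (s0, t0), g' p.1 p.2 < 0.
    exact: (cg' (s0, t0) _ (lt_nbhsl h)).
  near=> p => -[_]; suff : g' p.1 p.2 < 0 by lra.
  by near: p.
have H : nbhs (g s0 t0) [set x | x != 0].
  by apply: open_nbhs_nbhs; split=> //; exact: open_neq.
have {}H : \forall p \near (s0, t0), g p.1 p.2 != 0 by exact: (cg (s0, t0) _ H).
near=> p => -[+ _]; apply/eqP; by near: p.
Unshelve. all: by end_near. Qed.

(** Around each height there is at most that height itself as an upcrossing, and [[0, 1]] contains
    all of them and is compact. *)
Lemma upcrossings_finite g g' s0 : family_C1 g g' ->
  (forall s t, g s t = 0 -> 0 < t < 1) ->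
  (forall s t, g s t = 0 -> g' s t <> 0) ->
  exists zs : seq R, uniq zs /\ forall t, upcrossing g g' s0 t <-> t \in zs.
Proof.
move=> gC out tr.
(* Compactness yields a finite list because it applies to the filter of the
   lists which contain given points. *)
pose F : set_system (seq R) :=
  filter_from setT (fun u : seq R => [set v : seq R | {subset u <= v}]).
have FF : Filter F.
  apply: filter_from_filter; first by exists [::].
  move=> u v _ _; exists (u ++ v) => // w uvw; split=> x xu; apply: uvw;
    by rewrite mem_cat xu ?orbT.
suff [u _ /(_ u (fun _ => id)) uP] :
    \forall u \near F, `[0, 1] `<=` [set t | upcrossing g g' s0 t -> t \in u].
  exists (undup [seq t <- u | `[< upcrossing g g' s0 t >]]).
  rewrite undup_uniq; split=> // t; rewrite mem_undup mem_filter; split.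
    move=> ut; have [/out/andP[t0 t1] _] := ut.
    by apply/andP; split; [exact/asboolP|apply: uP; rewrite //= in_itv /= !ltW].
  by case/andP => /asboolP.
have /compact_near_coveringP ncov := @segment_compact R 0 1.
apply: (ncov _ F (fun u t => upcrossing g g' s0 t -> t \in u) FF) => t0 _.
have near0 : \forall t \near t0, upcrossing g g' s0 t -> t = t0.
  have [[g0 g'0]|nu] := pselect (upcrossing g g' s0 t0); last first.
    have [[A B] /= [As Bt] AB] := not_upcrossing_near gC tr nu.
    apply: filterS Bt => t Bt ut; exfalso; apply: (AB (s0, t)) ut.
    by split=> //=; exact: nbhs_singleton As.
  have [e [e0]] : exists e, 0 < e /\
      \forall s \near s0, exists z, box_zero g g' t0 e s z.
    have zb := zero_box gC g0 g'0.
    near (0 : R)^'+ => e; exists e; split.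
      by near: e; exact: nbhs_right_gt.
    by near: e; exact: zb.
  move=> /nbhs_singleton [z [_ zP]].
  near=> t; case=> gt _; have te : `|t - t0| <= e.
    rewrite distrC ltW //; near: t; exact: (nbhsx_ballx t0 e e0).
  have [_ [/(_ gt) -> _] _ _] := zP t te.
  by apply/esym; have [|_ [+ _] _ _] := zP t0; [rewrite subrr normr0 ltW|exact].
exists ([set t : R | upcrossing g g' s0 t -> t = t0],
  [set v : seq R | {subset [:: t0] <= v}]).
  by split=> //=; exists [:: t0].
by move=> -[t v] /= [ut vP] /ut ->; apply: vP; rewrite mem_head.
Unshelve. all: by end_near. Qed.

(** Each old upcrossing moves inside its own box; outside the boxes, compactness of [[0, 1]]
    excludes new ones for all parameters close to [s0] at once. *)
Lemma upcrossings_track g g' s0 zs e : family_C1 g g' ->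
  (forall s t, g s t = 0 -> 0 < t < 1) ->
  (forall s t, g s t = 0 -> g' s t <> 0) ->
  uniq zs -> (forall t, upcrossing g g' s0 t <-> t \in zs) -> 0 < e ->
  \forall s \near s0, exists phi : R -> R,
    [/\ uniq (map phi zs), forall t, upcrossing g g' s t <-> t \in map phi zs
      & forall t, t \in zs -> `|phi t - t| < e].
Proof.
move=> gC out tr uzs zsP e0.
(* The bound [2 * h] makes the boxes disjoint, so that distinct upcrossings have distinct images
   under [phi]. *)
have [h [h0 he hd hbox]] : exists h, [/\ 0 < h, h < e,
    forall x, x \in zs -> forall y, y \in zs -> x <> y -> 2 * h < `|x - y| &
    \forall s \near s0, forall x, x \in zs -> exists z, box_zero g g' x h s z].
  near (0 : R)^'+ => h; exists h; split.
  - by near: h; exact: nbhs_right_gt.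
  - by near: h; exact: nbhs_right_lt.
  - near: h; apply: near_all => x xz; apply: near_all => y yz.
    have [->|/eqP xy] := eqVneq x y; first exact: nearW.
    near=> h => _; suff : h < `|x - y| / 2 by lra.
    near: h; apply: nbhs_right_lt; rewrite divr_gt0 ?ltr0n // normr_gt0 subr_eq0.
    exact/eqP.
  - apply: (@near_all _ _ (nbhs s0) (nbhs_filter s0)
      (fun x s => exists z, box_zero g g' x h s z)).
    near: h.
    apply: (@near_all _ _ _ _ (fun x h => \forall s \near s0, exists z,
      box_zero g g' x h s z)) => x xz.
    by have [g0 g'0] := (zsP x).2 xz; exact: zero_box.
have hcov : \forall s \near s0, `[0, 1] `<=`
    [set t | (exists2 x, x \in zs & `|t - x| < h) \/ ~ upcrossing g g' s t].
  have /compact_near_coveringP ncov := @segment_compact R 0 1.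
  apply: (ncov _ (nbhs s0) (fun s t => (exists2 x, x \in zs & `|t - x| < h) \/
    ~ upcrossing g g' s t) (nbhs_filter s0)) => t0 _.
  have [t0z|/negP t0z] := boolP (t0 \in zs).
    exists (ball t0 h, setT) => /=; first by split; [exact: nbhsx_ballx|exact: filterT].
    by move=> -[t s] /= [bt _]; left; exists t0 => //; rewrite distrC.
  have nu : ~ upcrossing g g' s0 t0 by move/zsP.
  have [[A B] /= [As Bt] AB] := not_upcrossing_near gC tr nu.
  by exists (B, A) => // -[t s] /= [? ?]; right; apply: (AB (s, t)).
near=> s.
have boxs : forall x, exists z, x \in zs -> box_zero g g' x h s z.
  move=> x; have [xz|nx] := boolP (x \in zs); last by exists 0.
  suff [z] : exists z, box_zero g g' x h s z by exists z.
  by move: x xz; near: s; exact: hbox.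
have {boxs}[phi phiP] := choice boxs.
have phi_up x : x \in zs -> upcrossing g g' s (phi x).
  move=> /phiP[hx bx]; have [? [_ h2] _ _] := bx _ (ltW hx).
  by split=> //; apply: h2.
exists phi; split.
- rewrite map_inj_in_uniq // => x y xz yz pxy; apply/eqP; apply: contraT => /eqP.
  move=> /(hd _ xz _ yz); have [+ _] := phiP _ xz; have [+ _] := phiP _ yz.
  rewrite pxy (distrC _ x) => ? ?.
  have := ler_distD (phi y) x y; lra.
- move=> t; split=> [ut|/mapP[x xz ->]]; last exact: phi_up.
  have [/out/andP[t0 t1] _] := ut.
  have : `[0, 1] t by rewrite /= in_itv /= !ltW.
  have cov : `[0, 1] `<=` [set t | (exists2 x, x \in zs & `|t - x| < h) \/
      ~ upcrossing g g' s t] by near: s; exact: hcov.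
  move=> /cov [[x xz tx]|//]; apply/mapP; exists x => //.
  have [_ bx] := phiP _ xz; have [_ [+ _] _ _] := bx _ (ltW tx).
  by apply; case: ut.
- by move=> t /phiP[ht _]; exact: lt_trans ht he.
Unshelve. all: by end_near. Qed.

(** The set [P] is open and closed, and the line is connected. *)
Lemma locally_constant (P : R -> Prop) :
  (forall s0, \forall s \near s0, P s <-> P s0) -> forall s s', P s -> P s'.
Proof.
move=> lc s s' Ps.
have /connected_intervalP cR : is_interval [set: R] by [].
suff -> : P = [set: R] by [].
have oP : open P.
  by rewrite openE => x Px; apply: filterS (lc x) => y [_]; apply.
have cP : closed P.
  rewrite -openC openE => x Px.
  by apply: filterS (lc x) => y [h _] /h.
apply: cR; first by exists s.
- by exists P => //; rewrite setTI.
- by exists P => //; rewrite setTI.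
Qed.

End RealCalculus.

Section SingleCurve.
Set Implicit Arguments.
Unset Strict Implicit.
Local Open Scope classical_set_scope.
Variable R : realType.
Implicit Types (f : R -> R) (a b t : R).

Lemma neg_segment f a b : continuous f -> a <= b ->
  (forall t, a <= t <= b -> f t <> 0) -> f a < 0 -> f b < 0.
Proof.
move=> cf ab nz fa; rewrite ltNge; apply/negP => fb.
have [z] := @IVT _ f a b 0 ab (continuous_subspaceT cf)
  ltac:(by rewrite ge_min le_max (ltW fa) fb orbT).
by rewrite in_itv /= => /nz.
Qed.

(** A negative slope at [t0] would make [f] positive just before [t0], whereas [f] keeps its sign
    between [a] and its only zero. *)
Lemma cross_up f f' a b t0 : family_C1 (fun _ => f) (fun _ => f') ->
  a < t0 < b -> (forall t, a <= t <= b -> f t = 0 <-> t = t0) ->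
  f' t0 <> 0 -> f a < 0 -> 0 < f' t0 /\ 0 < f b.
Proof.
move=> fC /andP[at0 t0b] fz f'N0 fa.
have cf : continuous f := family_slice (s := 0) fC.
have f0 : f t0 = 0 by apply/fz => //; lra.
have lo t : a <= t < t0 -> f t < 0.
  move=> /andP[at_ tt0]; apply: neg_segment cf at_ _ fa => u hu.
  by rewrite fz; lra.
have f'pos : 0 < f' t0.
  rewrite lt_neqAle eq_sym; apply/andP; split; first exact/eqP.
  rewrite leNgt; apply/negP => f'neg.
  (* A single curve is regarded as a constant family; the sign is reversed because [zero_box]
     requires a positive slope. *)
  have zb := @zero_box _ _ _ 0 t0 (family_C1N fC) ltac:(by rewrite /= f0 oppr0)
    ltac:(by rewrite /= oppr_gt0).
  have [e [e0 ea]] : exists e, [/\ 0 < e, e <= t0 - a & \forall s \near (0 : R),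
      exists z, box_zero (fun _ t => - f t) (fun _ t => - f' t) t0 e s z].
    near (0 : R)^'+ => e; exists e; split.
    - by near: e; exact: nbhs_right_gt.
    - by near: e; apply: nbhs_right_ltW; rewrite subr_gt0.
    - by near: e; exact: zb.
  move=> /nbhs_singleton[z [_ zP]].
  have [_ [h _] _ _] := zP t0 ltac:(by rewrite subrr normr0 ltW).
  have := h ltac:(by rewrite f0 oppr0) => zt; subst z.
  have te : `|t0 - e - t0| <= e by rewrite addrAC subrr sub0r normrN gtr0_norm.
  have [_ _ h1 _] := zP _ te; have := lo (t0 - e) ltac:(lra).
  by have := h1 ltac:(lra); lra.
split=> //.
have zb := @zero_box _ _ _ 0 t0 fC f0 f'pos.
have [e [e0 ea]] : exists e, [/\ 0 < e, e <= b - t0 & \forall s \near (0 : R),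
    exists z, box_zero (fun _ => f) (fun _ => f') t0 e s z].
  near (0 : R)^'+ => e; exists e; split.
  - by near: e; exact: nbhs_right_gt.
  - by near: e; apply: nbhs_right_ltW; rewrite subr_gt0.
  - by near: e; exact: zb.
move=> /nbhs_singleton[z [_ zP]].
have [_ [h _] _ _] := zP t0 ltac:(by rewrite subrr normr0 ltW).
have zt := h f0; subst z.
have te : `|t0 + e - t0| <= e by rewrite addrAC subrr add0r gtr0_norm.
have [_ _ _ h2] := zP _ te.
have h3 := h2 ltac:(lra).
rewrite -oppr_lt0; apply: (@neg_segment (fun t => - f t) (t0 + e)).
- exact: (family_slice (s := 0) (family_C1N fC)).
- by lra.
- by move=> u hu; have [_ /= ] := fz u ltac:(lra); have := fz u ltac:(lra);
    move=> h4 _ /eqP; rewrite oppr_eq0 => /eqP /h4; lra.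
- by rewrite oppr_lt0.
Unshelve. all: by end_near. Qed.

Lemma cross_down f f' a b t0 : family_C1 (fun _ => f) (fun _ => f') ->
  a < t0 < b -> (forall t, a <= t <= b -> f t = 0 <-> t = t0) ->
  f' t0 <> 0 -> 0 < f a -> f' t0 < 0 /\ f b < 0.
Proof.
move=> fC ht fz f'N0 fa.
suff : 0 < - f' t0 /\ 0 < - f b by rewrite !oppr_gt0.
apply: (@cross_up (fun t => - f t) (fun t => - f' t) a).
- exact: family_C1N fC.
- by [].
- by move=> t /fz <-; split; lra.
- by lra.
- by rewrite oppr_lt0.
Qed.

End SingleCurve.

(** * Invariance under isotopy *)

Section Isotopy.
Set Implicit Arguments.
Unset Strict Implicit.
Local Open Scope classical_set_scope.
Variables (R : realType) (K : comNzRingType) (G : wgraph R K).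
Variables (d : nat) (b c : loading G d).

Lemma strand_is_derive (D : diagram b c) k t :
  is_derive t (1 : R) (strand D k) (derive1 (strand D k) t).
Proof.
rewrite derive1E; apply/derivableP.
exact: (@strand_smooth _ _ _ _ _ _ D k 0%N).
Qed.

Lemma dots_uniq (D : diagram b c) k : uniq (dots D k).
Proof. exact: lt_sorted_uniq (dots_sorted D k). Qed.

Variable H : R -> diagram b c.
Hypothesis cH : forall k, continuous (fun p : R * R => strand (H p.1) k p.2).
Hypothesis cH' :
  forall k, continuous (fun p : R * R => derive1 (strand (H p.1) k) p.2).
Hypothesis sH : forall k s s', size (dots (H s) k) = size (dots (H s') k).
Hypothesis cdH : forall k i, continuous (fun s => nth 0 (dots (H s) k) i).

Lemma dots_track k s0 e : 0 < e -> \forall s \near s0, exists phi : R -> R,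
    map phi (dots (H s0) k) = dots (H s) k /\
    forall t, t \in dots (H s0) k -> `|phi t - t| < e.
Proof.
move=> e0; set zs := dots (H s0) k.
have near_dot : \forall s \near s0, forall t, t \in zs ->
    `|nth 0 (dots (H s) k) (index t zs) - t| < e.
  apply: (@near_all _ _ (nbhs s0) (nbhs_filter s0) (fun t s =>
    `|nth 0 (dots (H s) k) (index t zs) - t| < e)) => t tz.
  have := @cdH k (index t zs) s0.
  move=> /cvgr_distC_lt /(_ _ e0).
  by rewrite -/zs nth_index.
near=> s; exists (fun t => nth 0 (dots (H s) k) (index t zs)); split.
  apply: (@eq_from_nth _ 0); rewrite size_map; first exact: sH.
  move=> i iz; rewrite (nth_map 0) // index_uniq //; exact: dots_uniq.
by near: s; exact: near_dot.
Unshelve. all: by end_near. Qed.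

Definition gap (q : event R d) s t :=
  strand (H s) q.1.1 t - strand (H s) q.1.2 t - q.2.

Definition gap' (q : event R d) s t :=
  derive1 (strand (H s) q.1.1) t - derive1 (strand (H s) q.1.2) t.

Lemma gap_C1 q : family_C1 (gap q) (gap' q).
Proof.
split=> [p|p|s t].
- apply: cvgB; last exact: cvg_cst.
  by apply: cvgB; apply: cH.
- by apply: cvgB; apply: cH'.
- have h : is_derive t (1 : R) (gap q s) (gap' q s t - 0).
    apply: is_deriveB; apply: is_deriveB; exact: strand_is_derive.
  by rewrite subr0 in h.
Qed.

Lemma event_track q s0 : exists zs : seq R,
  [/\ uniq zs, forall t, occurs (H s0) q t <-> t \in zs &
   forall e, 0 < e -> \forall s \near s0, exists phi : R -> R,
    [/\ uniq (map phi zs), forall t, occurs (H s) q t <-> t \in map phi zs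
      & forall t, t \in zs -> `|phi t - t| < e]].
Proof.
have none : (forall s t, ~ occurs (H s) q t) -> exists zs : seq R,
  [/\ uniq zs, forall t, occurs (H s0) q t <-> t \in zs &
   forall e, 0 < e -> \forall s \near s0, exists phi : R -> R,
    [/\ uniq (map phi zs), forall t, occurs (H s) q t <-> t \in map phi zs
      & forall t, t \in zs -> `|phi t - t| < e]].
  move=> nev; exists [::]; split=> [//|t|e e0].
    by split=> // /nev.
  by near=> s; exists id; split=> // t; split=> // /nev.
have [q12|/eqP q12] := eqVneq q.1.1 q.1.2.
  have evE s t : occurs (H s) q t <-> q.2 = 0 /\ t \in dots (H s) q.1.1.
    by rewrite /occurs q12 eqxx.
  have [q0|q0] := pselect (q.2 = 0); last by apply: none => s t /evE[].
  exists (dots (H s0) q.1.1); split; first exact: dots_uniq.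
    by move=> t; rewrite evE; split=> [[]|].
  move=> e e0; have := dots_track q.1.1 s0 e0.
  apply: filterS => s [phi [phiE phic]]; exists phi; rewrite phiE; split=> //.
    exact: dots_uniq.
  by move=> t; rewrite evE; split=> [[]|].
have evE s t : occurs (H s) q t <->
    interacts (lab b q.1.1) (lab b q.1.2) q.2 /\ upcrossing (gap q) (gap' q) s t.
  rewrite /occurs (introF eqP q12) /upcrossing /gap /gap' subr_gt0.
  split=> [[[_ i e] h]|[i [e h]]]; do ?split=> //; lra.
have [i|ni] := pselect (interacts (lab b q.1.1) (lab b q.1.2) q.2); last first.
  by apply: none => s t /evE[].
have ie s t : gap q s t = 0 ->
    interaction (lab b) (strand (H s)) t q.1.1 q.1.2 q.2.
  by rewrite /gap => e; split=> //; lra.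
have out s t : gap q s t = 0 -> 0 < t < 1.
  by move/ie/interaction_out.
have tr s t : gap q s t = 0 -> gap' q s t <> 0.
  by move/ie/no_tangency => h /eqP; rewrite subr_eq0 => /eqP.
have [zs [uzs zsP]] := upcrossings_finite s0 (gap_C1 q) out tr.
exists zs; split=> // [t|e e0].
  by rewrite evE zsP; split=> [[]|].
have := upcrossings_track (gap_C1 q) out tr uzs zsP e0.
apply: filterS => s [phi [up phiP phic]]; exists phi; split=> // t.
by rewrite evE phiP; split=> [[]|].
Unshelve. all: by end_near. Qed.

(** The position of a strand at height 1 varies continuously with the parameter and stays among the
    finitely many distinct points of [c]. *)
Lemma dperm_const s s' : dperm (H s) = dperm (H s').
Proof.
apply/permP => k.
apply: (@locally_constant R (fun s0 => dperm (H s0) k = dperm (H s') k) _ s' s);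
  last by [].
move=> s0.
have cs : continuous (fun s => strand (H s) k 1).
  move=> s1 U /(@cH k (s1, 1)) [[A B] /= [As Bt] AB].
  apply: filterS As => x Ax; apply: (AB (x, 1)); split=> //=.
  exact: nbhs_singleton Bt.
have nr : \forall s \near s0, forall j, j \in enum 'I_d ->
    j <> dperm (H s0) k -> strand (H s) k 1 <> pt c j.
  apply: (@near_all _ _ (nbhs s0) (nbhs_filter s0) (fun j s =>
    j <> dperm (H s0) k -> strand (H s) k 1 <> pt c j)) => j _.
  have [->|/eqP jk] := eqVneq j (dperm (H s0) k); first exact: nearW.
  have nj : nbhs (strand (H s0) k 1) [set x | x != pt c j].
    apply: open_nbhs_nbhs; split; first exact: open_neq.
    rewrite /= (strand_top (H s0)) //; apply/eqP.
    have : (j != dperm (H s0) k) by exact/eqP.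
    by rewrite neq_ltn => /orP[] /(pt_mono c) h e; rewrite e ltxx in h.
  have {}nj : \forall s \near s0, strand (H s) k 1 != pt c j := cs s0 _ nj.
  by near=> u => _; apply/eqP; near: u.
near=> s0'; suff -> : dperm (H s0') k = dperm (H s0) k by [].
have h : forall j, j \in enum 'I_d -> j <> dperm (H s0) k ->
  strand (H s0') k 1 <> pt c j by near: s0'; exact: nr.
apply: contrapT => /(h _ (mem_enum _ _)); apply; exact: strand_top.
Unshelve. all: by end_near. Qed.

(** For a fixed [q], occurring at some height is a locally constant property of the parameter, hence
    a constant one. One finite word thus bounds the events of the whole path, even when there are
    infinitely many edges. *)
Lemma events_bounded s0 w : word_of (H s0) w ->
  forall s q t, occurs (H s) q t -> q \in undup (map snd w).
Proof.
move=> [_ _ ww] s q t e; suff [t' et'] : exists t', occurs (H s0) q t'.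
  by rewrite mem_undup; apply/mapP; exists (t', q) => //; apply/ww.
apply: (@locally_constant R (fun s => exists t, occurs (H s) q t) _ s); last by exists t.
move=> s1; have [zs [_ zsP]] := event_track q s1.
move=> /(_ 1 ltr01) tr; near=> s2.
have [phi [_ phiP _]] : exists phi : R -> R,
  [/\ uniq (map phi zs), forall t, occurs (H s2) q t <-> t \in map phi zs
    & forall t, t \in zs -> `|phi t - t| < 1] by near: s2; exact: tr.
split=> -[t1].
  by move=> /phiP/mapP[z zz _]; exists z; apply/zsP.
by move=> /zsP zz; exists (phi t1); apply/phiP/map_f.
Unshelve. all: by end_near. Qed.

(** Finiteness of [F] allows the neighbourhoods of [s0] obtained for the separate events to be
    intersected. *)
Lemma diagram_op_locally_constant (F : seq (event R d)) (f : mpoly d K) s0 :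
  uniq F -> (forall s q t, occurs (H s) q t -> q \in F) ->
  \forall s \near s0, diagram_op (H s) f = diagram_op (H s0) f.
Proof.
move=> uF FP.
have [zs zsP] := choice (fun q => event_track q s0).
pose w := [seq (t, q) | q <- F, t <- zs q].
have uw : uniq w.
  apply: allpairs_uniq_dep => //; first by move=> q _; case: (zsP q).
  by move=> [q t] [q' t'] _ _ [-> ->].
have wP t q : (t, q) \in w <-> occurs (H s0) q t.
  split=> [/allpairsPdep[q' [t' [_ tz [-> ->]]]]|e].
    by have [_ h _] := zsP q'; apply/h.
  by apply/allpairsPdep; exists q, t; split=> //;
    [exact: FP e|have [_ h _] := zsP q; apply/h].
have ww : word_of (H s0) (sort (@bytime R d) w).
  split; first by rewrite sort_uniq.
  - by apply: sort_sorted => x y; apply: le_total.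
  - by move=> [t q]; rewrite mem_sort wP.
(* Heights will move by less than [e], so two events at distinct heights at [s0] keep their order;
   only simultaneous events, whose operators commute, can be exchanged. *)
have [e e0 eP] : exists2 e : R, 0 < e & forall x, x \in w -> forall y, y \in w ->
    x.1 <> y.1 -> 2 * e < `|x.1 - y.1|.
  suff h : \forall e \near (0 : R)^'+, forall x, x \in w -> forall y, y \in w ->
      x.1 <> y.1 -> 2 * e < `|x.1 - y.1|.
    by near (0 : R)^'+ => e; exists e; near: e; [exact: nbhs_right_gt|exact: h].
  apply: near_all => x xw; apply: near_all => y yw.
  have [->|/eqP xy] := eqVneq x.1 y.1; first exact: nearW.
  near=> e => _; suff : e < `|x.1 - y.1| / 2 by lra.
  near: e; apply: nbhs_right_lt; rewrite divr_gt0 ?ltr0n // normr_gt0 subr_eq0.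
  exact/eqP.
have tracked : \forall s \near s0, forall q, q \in F -> exists phi : R -> R,
    [/\ uniq (map phi (zs q)), forall t, occurs (H s) q t <-> t \in map phi (zs q)
      & forall t, t \in zs q -> `|phi t - t| < e].
  apply: (@near_all _ _ (nbhs s0) (nbhs_filter s0) (fun q s => exists phi : R -> R,
    [/\ uniq (map phi (zs q)), forall t, occurs (H s) q t <-> t \in map phi (zs q)
      & forall t, t \in zs q -> `|phi t - t| < e])) => q _.
  by have [_ _] := zsP q; apply.
near=> s.
have tracked_s : forall q, exists phi : R -> R, q \in F ->
    [/\ uniq (map phi (zs q)), forall t, occurs (H s) q t <-> t \in map phi (zs q)
      & forall t, t \in zs q -> `|phi t - t| < e].
  move=> q; have [qF|_] := boolP (q \in F); last by exists id.
  suff [phi h] : exists phi : R -> R,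
    [/\ uniq (map phi (zs q)), forall t, occurs (H s) q t <-> t \in map phi (zs q)
      & forall t, t \in zs q -> `|phi t - t| < e] by exists phi.
  by move: q qF; near: s; exact: tracked.
have [phi phiP] := choice tracked_s.
pose Phi (x : R * event R d) := (phi x.2 x.1, x.2).
have w_F t q : (t, q) \in w -> q \in F /\ t \in zs q.
  by move=> /allpairsPdep[q' [t' [qF tz [-> ->]]]].
have close x : x \in w -> `|(Phi x).1 - x.1| < e.
  by case: x => t q /w_F[qF tz]; have [_ _ h] := phiP _ qF; exact: h.
have uPhi : uniq (map Phi w).
  rewrite map_inj_in_uniq // => -[t q] [t' q'] /w_F[qF tz] /w_F[_ tz'] [].
  move=> + qq'; rewrite -qq' in tz' * => h; congr (_, _).
  have [up _ _] := phiP _ qF.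
  have := @nth_uniq _ 0 (map (phi q) (zs q)) (index t (zs q)) (index t' (zs q)).
  rewrite size_map !index_mem => /(_ tz tz' up).
  rewrite !(nth_map 0) ?index_mem // !nth_index // h eqxx => /esym/eqP.
  exact: index_inj.
have wPhi : word_of (H s) (sort (@bytime R d) (map Phi w)).
  split; first by rewrite sort_uniq.
  - by apply: sort_sorted => x y; apply: le_total.
  - move=> [t q]; rewrite mem_sort /=; split.
      move=> /mapP[[t' q'] /w_F[qF tz] [-> ->]].
      by have [_ h _] := phiP _ qF; apply/h/map_f.
    move=> et; have qF := FP _ _ _ et; have [_ h _] := phiP _ qF.
    have /h/mapP[t' tz ->] := et; apply/mapP; exists (t', q) => //.
    by apply/allpairsPdep; exists q, t'.
rewrite (diagram_op_word f ww) (diagram_op_word f wPhi) (dperm_const s s0).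
congr (msym _ _).
(* [Phi] changes heights but not events: both operators run over the letters of [w], sorted by the
   new heights on one side and by the old ones on the other. *)
rewrite sort_map.
have runPhi u g : run (lab b) (map Phi u) g = run (lab b) u g.
  by elim: u g => //= x u IH g; rewrite IH.
rewrite runPhi; apply: (@foldl_trace _ _ (fun x => event_op (lab b) x.2)
  (relpre Phi (@bytime R d)) (@bytime R d)).
- by rewrite perm_sort perm_sym perm_sort.
- rewrite -sorted_pairwise; last by move=> y x z; apply: le_trans.
  by apply: sort_sorted => x y; apply: le_total.
- rewrite -sorted_pairwise; last by move=> y x z; apply: le_trans.
  by apply: sort_sorted => x y; apply: le_total.
move=> x y; rewrite !mem_sort => xw yw.
rewrite /= /bytime => xy yx g.
have [xy1|/eqP xy1] := eqVneq x.1 y.1.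
  apply: (@simultaneous_event_op _ _ _ _ _ _ (H s0) x.1).
  - by apply/wP; rewrite -surjective_pairing.
  - by rewrite xy1; apply/wP; rewrite -surjective_pairing.
have := close _ xw; have := close _ yw; have := eP _ xw _ yw xy1.
rewrite [`|x.1 - y.1|]ger0_norm ?subr_ge0 // !ltr_norml.
by move=> h1 /andP[h2 h3] /andP[h4 h5]; exfalso; lra.
Unshelve. all: by end_near. Qed.

End Isotopy.

Section IsotopyInvariance.
Set Implicit Arguments.
Unset Strict Implicit.
Variables (R : realType) (K : comNzRingType) (G : wgraph R K).

(** Either some diagram of the path has a word, and then its finitely many events control the whole
    path, or none has, and both ends act by 0. *)
Lemma diagram_op_isotopic d (b c : loading G d) (D D' : diagram b c) (f : mpoly d K) :
  isotopic D D' -> diagram_op D f = diagram_op D' f.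
Proof.
move=> [H [<- <- cH cH' cdH]].
have sH k s s' : size (dots (H s) k) = size (dots (H s') k).
  by have [h _] := cdH k; rewrite (h s) (h s').
have {}cdH k : forall i, continuous (fun s => nth 0 (dots (H s) k) i).
  by have [_] := cdH k.
have [[s1 [w1 w1P]]|nw] := pselect (exists s, exists w, word_of (H s) w).
  have FP := events_bounded cH cH' sH cdH w1P.
  apply/esym; apply: (@locally_constant R
    (fun s => diagram_op (H s) f = diagram_op (H 0) f) _ 0) => //.
  move=> s0; near=> s.
  suff -> : diagram_op (H s) f = diagram_op (H s0) f by [].
  near: s; exact: (diagram_op_locally_constant cH cH' sH cdH f s0 (undup_uniq _) FP).
by rewrite !diagram_op_infinite // => h; apply: nw; [exists 1|exists 0].
Unshelve. all: by end_near. Qed.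

End IsotopyInvariance.

(** * Diagrams with few crossings *)

Section Inversions.
Set Implicit Arguments.
Unset Strict Implicit.
Variable d : nat.
Implicit Types (s t : {perm 'I_d}) (i j k l m : 'I_d).

Lemma perm_rank s k : s k = #|[pred l | (s l < s k)%N]| :> nat.
Proof.
have -> : #|[pred l | (s l < s k)%N]| = #|[preim s of [pred m : 'I_d | (m < s k)%N]]| by [].
rewrite (card_preim (perm_inj (s := s))).
have -> : #|[predI codom s & [pred m : 'I_d | (m < s k)%N]]| =
    #|[pred m : 'I_d | (m < s k)%N]|.
  apply: eq_card => m; rewrite !inE; case: (m < s k)%N; rewrite ?andbF //= andbT.
  by apply/codomP; exists (s^-1 m)%g; rewrite permKV.
have := ltn_ord (s k); move: (nat_of_ord (s k)) => n nd.
rewrite -[LHS](card_ord n).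
have wi : injective (widen_ord (ltnW nd)).
  by move=> x y /(congr1 val) /= /val_inj.
rewrite -(fintype.card_image wi).
apply: eq_card => m; rewrite [RHS]inE; apply/fintype.imageP/idP => [[x _ ->] //=|mn].
by exists (Ordinal mn) => //; apply: val_inj.
Qed.

(** Each value of a permutation is the number of smaller values, which the inversions determine. The
    permutation of a diagram is identified in this way from the pairs of strands that cross. *)
Lemma perm_eq_inversions s t :
  (forall i j, (i < j)%N -> (s j < s i)%N = (t j < t i)%N) -> s = t.
Proof.
move=> inv; apply/permP => k; apply: val_inj => /=.
rewrite (perm_rank s) (perm_rank t); apply: eq_card => l; rewrite !inE.
have ord (u : {perm 'I_d}) i j : i != j -> (u i < u j)%N = ~~ (u j < u i)%N.
  move=> ij; rewrite -leqNgt ltn_neqAle; case: eqP => // /val_inj/perm_inj e.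
  by rewrite e eqxx in ij.
have [->|lk] := eqVneq l k; first by rewrite !ltnn.
have := lk; rewrite neq_ltn => /orP[h|h]; last exact: inv.
by rewrite (ord s) // (ord t) // inv.
Qed.

Lemma perm_no_inversion s :
  (forall i j, (i < j)%N -> ~~ (s j < s i)%N) -> s = 1%g.
Proof.
move=> inv; apply: perm_eq_inversions => i j ij.
by rewrite (negPf (inv i j ij)) !perm1 ltnNge ltnW.
Qed.

Let ord_neq k l : k <> l -> k <> l :> nat.
Proof. by move=> kl /val_inj. Qed.

Lemma perm_one_inversion s k l : (k < l)%N ->
  (forall i j, (i < j)%N -> (s j < s i)%N = ((i, j) == (k, l))) ->
  s = tperm k l.
Proof.
move=> kl inv; have skl : (s l < s k)%N by rewrite inv ?eqxx.
(* An index strictly between [k] and [l] would form an inversion with neither, so its value would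
   lie between those of [k] and [l], which are in the wrong order. *)
have adj : l = k.+1 :> nat.
  apply/eqP; rewrite eqn_leq kl andbT leqNgt; apply/negP => h.
  have md : (k.+1 < d)%N by apply: ltn_trans h (ltn_ord l).
  pose m := Ordinal md.
  have := inv k m (ltnSn _); have := inv m l h; rewrite !xpair_eqE !eqxx andbT /=.
  have -> : m == k = false by apply/eqP => /(congr1 val) /=; lia.
  have -> : m == l = false by apply/eqP => /(congr1 val) /=; lia.
  by lia.
apply: perm_eq_inversions => i j ij; rewrite inv // xpair_eqE.
move: ij; case: tpermP => [->|->|/ord_neq nik /ord_neq nil];
  case: tpermP => [->|->|/ord_neq njk /ord_neq njl]; rewrite -!val_eqE /=; lia.
Qed.

Lemma perm_three_inversions s k l m : (k < l)%N -> (l < m)%N ->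
  (forall i j, (i < j)%N -> (s j < s i)%N =
     [|| (i, j) == (k, l), (i, j) == (k, m) | (i, j) == (l, m)]) ->
  s = tperm k m.
Proof.
move=> kl lm inv.
have skl : (s l < s k)%N by rewrite inv ?eqxx.
have slm : (s m < s l)%N by rewrite inv ?eqxx ?orbT.
have adj1 : l = k.+1 :> nat.
  apply/eqP; rewrite eqn_leq kl andbT leqNgt; apply/negP => h.
  have md : (k.+1 < d)%N by apply: ltn_trans h (ltn_ord l).
  pose x := Ordinal md.
  have := inv k x (ltnSn _); have := inv x l h; rewrite !xpair_eqE !eqxx /=.
  rewrite -!val_eqE /=; lia.
have adj2 : m = l.+1 :> nat.
  apply/eqP; rewrite eqn_leq lm andbT leqNgt; apply/negP => h.
  have md : (l.+1 < d)%N by apply: ltn_trans h (ltn_ord m).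
  pose x := Ordinal md.
  have := inv l x (ltnSn _); have := inv x m h; rewrite !xpair_eqE !eqxx /=.
  rewrite -!val_eqE /=; lia.
apply: perm_eq_inversions => i j ij; rewrite inv // !xpair_eqE.
move: ij; case: tpermP => [->|->|/ord_neq nik /ord_neq nil];
  case: tpermP => [->|->|/ord_neq njk /ord_neq njl]; rewrite -!val_eqE /=; lia.
Qed.

End Inversions.

(** * Operators and permutations of diagrams with prescribed meetings *)

Section Shapes.
Set Implicit Arguments.
Unset Strict Implicit.
Local Open Scope classical_set_scope.
Variables (R : realType) (K : comNzRingType) (G : wgraph R K).
Variables (d : nat) (b c : loading G d).
Implicit Types (D : diagram b c) (g : 'I_d * R) (f : mpoly d K) (t : R).

Definition passage g g' : event R d := (g.1, g'.1, g'.2 - g.2).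

Definition touches g g' := interacts (lab b g.1) (lab b g'.1) (g'.2 - g.2).

Definition slope D g t := derive1 (strand D g.1) t.

Lemma continuous_second (h : R -> R) :
  continuous h -> continuous (fun p : R * R => h p.2).
Proof.
move=> ch p U /ch V; exists (setT, h @^-1` U) => /=; last by move=> q [_].
by split=> //; exact: filterT.
Qed.

Lemma curves_C1 D g g' :
  family_C1 (fun _ t => curve_at D g t - curve_at D g' t)
    (fun _ t => slope D g t - slope D g' t).
Proof.
have e : (fun _ t => curve_at D g t - curve_at D g' t) =
    gap (fun _ => D) (passage g g').
  by apply/funext => s; apply/funext => t; rewrite /gap /curve_at /=; ring.
rewrite e; apply: (@gap_C1 _ _ _ _ _ _ (fun _ => D) _ _ (passage g g')).
- move=> k; apply: continuous_second => t; apply: differentiable_continuous.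
  by apply/derivable1_diffP; apply: (@strand_smooth _ _ _ _ _ _ _ k 0%N).
- move=> k; apply: continuous_second => t; apply: differentiable_continuous.
  by apply/derivable1_diffP; apply: (@strand_smooth _ _ _ _ _ _ _ k 1%N).
Qed.

Lemma meet_interaction D g g' t : g.1 <> g'.1 -> touches g g' ->
  curve_at D g t = curve_at D g' t ->
  interaction (lab b) (strand D) t g.1 g'.1 (g'.2 - g.2).
Proof. by move=> gg' i e; split=> //; move: e; rewrite /curve_at; lra. Qed.

Lemma meet_transversal D g g' t : g.1 <> g'.1 -> touches g g' \/ touches g' g ->
  curve_at D g t = curve_at D g' t -> 0 < t < 1 /\ slope D g t <> slope D g' t.
Proof.
move=> ne [i|i] e.
  have it := meet_interaction ne i e; split; first exact: interaction_out it.
  exact: no_tangency it.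
have it := meet_interaction (nesym ne) i (esym e).
split; first exact: interaction_out it.
by move=> /esym; apply: no_tangency it.
Qed.

(** Two translates of the same strand meet at all heights or at none. *)
Lemma meet_distinct D g g' ts t u : meet_at D g g' ts -> t \in ts ->
  u \notin ts -> g.1 <> g'.1.
Proof.
move=> m /m e /negP nu gg'; apply: nu; apply/m.
by move: e; rewrite /curve_at gg' => /addrI ->.
Qed.

Lemma curve_bot D g : curve_at D g 0 = pt b g.1 + g.2.
Proof. by rewrite /curve_at strand_bot. Qed.

Lemma curve_order D g g' : g.2 = g'.2 -> curve_at D g 0 < curve_at D g' 0 ->
  (g.1 < g'.1)%N.
Proof.
move=> e; rewrite !curve_bot e ltrD2r => h.
rewrite ltnNge leq_eqVlt; apply/negP => /orP[/eqP/val_inj e'|/(pt_mono b)].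
  by rewrite e' ltxx in h.
by move/(lt_trans h); rewrite ltxx.
Qed.

Lemma once_cross D g g' t : meet_at D g g' [:: t] ->
  touches g g' \/ touches g' g ->
  curve_at D g 0 < curve_at D g' 0 ->
  slope D g' t < slope D g t /\ curve_at D g' 1 < curve_at D g 1.
Proof.
move=> m i lt0.
have ne : g.1 <> g'.1.
  apply: (meet_distinct (u := t + 1) m (mem_head _ _)).
  by rewrite inE; apply/eqP; lra.
have et : curve_at D g t = curve_at D g' t by apply/m; rewrite mem_head.
have [t01 nt] := meet_transversal ne i et.
have := @cross_up _ _ _ 0 1 t (curves_C1 D g g') t01.
rewrite !subr_gt0 subr_lt0; apply=> //.
  by move=> u _; split=> [/eqP|->]; rewrite ?et ?subrr // subr_eq0 => /eqP/m;
    rewrite inE => /eqP.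
by move/eqP; rewrite subr_eq0 => /eqP; apply: nt.
Qed.

Lemma twice_cross D g g' t1 t2 : t1 < t2 -> meet_at D g g' [:: t1; t2] ->
  touches g g' \/ touches g' g -> curve_at D g 0 < curve_at D g' 0 ->
  [/\ slope D g' t1 < slope D g t1, slope D g t2 < slope D g' t2
    & curve_at D g 1 < curve_at D g' 1].
Proof.
move=> t12 m i lt0.
have ne : g.1 <> g'.1.
  apply: (meet_distinct (u := t2 + 1) m (mem_head _ _)).
  by rewrite !inE; apply/norP; split; apply/eqP; lra.
have et1 : curve_at D g t1 = curve_at D g' t1 by apply/m; rewrite mem_head.
have et2 : curve_at D g t2 = curve_at D g' t2.
  by apply/m; rewrite !inE eqxx orbT.
have [/andP[t10 t11] nt1] := meet_transversal ne i et1.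
have [/andP[t20 t21] nt2] := meet_transversal ne i et2.
(* The zeros are located exactly, so that the midpoint of [t1] and [t2] separates two intervals with
   a single crossing each. *)
have zero u : curve_at D g u - curve_at D g' u = 0 <-> u = t1 \/ u = t2.
  split=> [/eqP|[]->]; rewrite ?et1 ?et2 ?subrr // subr_eq0 => /eqP/m.
  by rewrite !inE => /orP[/eqP|/eqP]; [left|right].
have [] := @cross_up _ _ _ 0 ((t1 + t2) / 2) t1 (curves_C1 D g g').
- by apply/andP; split; lra.
- by move=> u hu; rewrite zero; lra.
- by move/eqP; rewrite subr_eq0 => /eqP; apply: nt1.
- by rewrite subr_lt0.
rewrite [0 < slope D g t1 - _]subr_gt0 => s1 mid.
have [] := @cross_down _ _ _ ((t1 + t2) / 2) 1 t2 (curves_C1 D g g').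
- by apply/andP; split; lra.
- by move=> u hu; rewrite zero; lra.
- by move/eqP; rewrite subr_eq0 => /eqP; apply: nt2.
- by [].
by rewrite !subr_lt0.
Qed.

Lemma event_op_not_touching g g' f : g.1 <> g'.1 -> ~ touches g g' ->
  event_op (lab b) (passage g g') f = f.
Proof.
move=> gg' ni; rewrite /passage event_op_mul // => [|[d0 _]]; last first.
  by apply: ni; left.
rewrite event_poly_noedge ?mul1r // => e [/= t h w].
by apply: ni; right; exists e.
Qed.

(** The list [w] records meetings of curves in [gs], whether or not their labels interact: a passage
    of curves that do not touch acts by the identity. One word thus serves for all labellings of a
    shape. *)
Lemma diagram_op_only_meet D gs (w : seq (R * (('I_d * R) * ('I_d * R)))) f :
  dotless D -> only_meet D gs ->
  sorted (fun x y => x.1 <= y.1) w ->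
  uniq [seq (x.1, passage x.2.1 x.2.2) | x <- w] ->
  (forall g g' t, g \in gs -> g' \in gs -> g.1 <> g'.1 -> touches g g' ->
     curve_at D g t = curve_at D g' t -> slope D g' t < slope D g t ->
     (t, (g, g')) \in w) ->
  (forall g g' t, (t, (g, g')) \in w -> [/\ g.1 <> g'.1,
     curve_at D g t = curve_at D g' t &
     touches g g' -> slope D g' t < slope D g t]) ->
  diagram_op D f = msym (dperm D)
    (foldl (fun h x => event_op (lab b) (passage x.2.1 x.2.2) h) f w).
Proof.
move=> nodots om sw uw evw wev.
rewrite (@diagram_op_weak_word _ _ _ _ _ _ D [seq (x.1, passage x.2.1 x.2.2) | x <- w]) //.
- congr (msym _ _); move: f; elim: w {sw uw evw wev} => [//|x w IH] f /=.
  by rewrite -IH.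
- rewrite sorted_map; exact: sw.
- move=> q t; rewrite /occurs; case: eqP => [_ []|q12 [it ds]].
    by rewrite nodots.
  have [g [g' [gg gg' e1 e2 e3]]] := om _ _ _ _ it.
  have qE : q = passage g g'.
    by case: q e1 e2 e3 {it ds q12} => -[k l] delta /= -> -> ->.
  subst q; apply/mapP; exists (t, (g, g')) => //; apply: evw => //.
  + by case: it.
  + by case: it => _ _; rewrite /curve_at /=; lra.
- move=> x /mapP[[t [g g']] xw ->] /=; have [ne e s] := wev _ _ _ xw.
  have [i|ni] := pselect (touches g g'); last first.
    by right=> h /=; exact: event_op_not_touching.
  left; rewrite /occurs /= (introF eqP ne); split; first exact: meet_interaction.
  exact: s.
Qed.

(** Strands that change order must cross, by the intermediate value theorem, and any two strands
    interact with translation 0. The crossing is therefore one of the allowed meetings, between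
    curves with equal translations. *)
Lemma flip_meet D gs (i j : 'I_d) : only_meet D gs -> (i < j)%N ->
  (dperm D j < dperm D i)%N -> exists g g' t, [/\ g \in gs, g' \in gs,
    g.1 = i, g'.1 = j & g.2 = g'.2 /\ curve_at D g t = curve_at D g' t].
Proof.
move=> om ij fl.
have [t te] : exists t, strand D i t = strand D j t.
  apply: contrapT => ne.
  have nz t : 0 <= t <= 1 -> curve_at D (i, 0) t - curve_at D (j, 0) t <> 0.
    move=> _ /eqP; rewrite /curve_at /= !addr0 subr_eq0 => /eqP e.
    by apply: ne; exists t.
  have := @neg_segment _ _ 0 1
    (family_slice (s := 0) (curves_C1 D (i, 0) (j, 0))) ler01 nz.
  rewrite /curve_at /= !addr0 !(strand_bot D _ (lexx 0)).
  rewrite !(strand_top D _ (lexx 1)) !subr_lt0 => /(_ (pt_mono b ij)).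
  by move/(lt_trans (pt_mono c fl)); rewrite ltxx.
have it : interaction (lab b) (strand D) t i j 0.
  split; [by move=> e; rewrite e ltnn in ij|by left|by rewrite addr0].
have [g [g' [gg gg' e1 e2 e]]] := om _ _ _ _ it.
exists g, g', t; split=> //; have e3 : g.2 = g'.2 by lra.
by split=> //; rewrite /curve_at -e1 -e2 te e3.
Qed.

Lemma uncrossed_dperm D : uncrossed D -> dperm D = 1%g.
Proof.
move=> [_ om]; apply: perm_no_inversion => i j ij; apply/negP => fl.
by have [g [g' [t [? _ _ _ _]]]] := flip_meet om ij fl.
Qed.

Lemma diagram_op_uncrossed D f : uncrossed D -> diagram_op D f = f.
Proof.
move=> uD; have [nodots om] := uD; rewrite (@diagram_op_only_meet D [::] [::]) //=.
by rewrite uncrossed_dperm // msym1m.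
Qed.

Lemma once_distinct D g g' : once D g g' -> g.1 <> g'.1.
Proof.
case=> _ _ [t m]; apply: (meet_distinct (u := t + 1) m (mem_head _ _)).
by rewrite inE; apply/eqP; lra.
Qed.

Lemma top_order D g g' : g.2 = g'.2 -> curve_at D g' 1 < curve_at D g 1 ->
  (dperm D g'.1 < dperm D g.1)%N.
Proof.
move=> e; rewrite /curve_at !strand_top // e ltrD2r => h.
rewrite ltnNge leq_eqVlt; apply/negP => /orP[/eqP/val_inj e'|/(pt_mono c)].
  by rewrite e' ltxx in h.
by move/(lt_trans h); rewrite ltxx.
Qed.

(** At its only meeting, the curve that starts on the left moves to the right, so the reverse
    passage would have the wrong slope. *)
Lemma once_backwards D g g' t u : meet_at D g g' [:: t] ->
  curve_at D g 0 < curve_at D g' 0 -> touches g' g ->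
  curve_at D g' u = curve_at D g u -> ~ slope D g u < slope D g' u.
Proof.
move=> m lt0 i e s; have /esym/m := e; rewrite inE => /eqP ut; subst u.
have [s' _] := once_cross m (or_intror i) lt0.
by have := lt_trans s s'; rewrite ltxx.
Qed.

Lemma once_forward D g g' t : meet_at D g g' [:: t] ->
  curve_at D g 0 < curve_at D g' 0 ->
  [/\ g.1 <> g'.1, curve_at D g t = curve_at D g' t
    & touches g g' -> slope D g' t < slope D g t].
Proof.
move=> m lt0; split.
- apply: (meet_distinct (u := t + 1) m (mem_head _ _)).
  by rewrite inE; apply/eqP; lra.
- by apply/m; rewrite mem_head.
- by move=> i; have [] := once_cross m (or_introl i) lt0.
Qed.

Lemma once_flip D g g' t : meet_at D g g' [:: t] -> g.2 = g'.2 ->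
  curve_at D g 0 < curve_at D g' 0 -> (dperm D g'.1 < dperm D g.1)%N.
Proof.
move=> m e lt0; apply: top_order => //.
have i : touches g g' by left; rewrite e subrr.
by have [] := once_cross m (or_introl i) lt0.
Qed.

Lemma diagram_op_once D g g' f : once D g g' -> curve_at D g 0 < curve_at D g' 0 ->
  diagram_op D f = msym (dperm D) (event_op (lab b) (passage g g') f).
Proof.
move=> [nodots om [t m]] lt0; have [ne et fw] := once_forward m lt0.
rewrite (@diagram_op_only_meet D [:: g; g'] [:: (t, (g, g'))]) //=.
- move=> h h' u; rewrite !inE => /orP[]/eqP-> /orP[]/eqP-> // _ i e s.
    by have /m := e; rewrite inE => /eqP ->.
  by have := once_backwards m lt0 i e s.
- by move=> h h' u; rewrite inE => /eqP[-> -> ->].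
Qed.

Lemma dperm_once D g g' : once D g g' -> curve_at D g 0 < curve_at D g' 0 ->
  g.2 = g'.2 -> dperm D = tperm g.1 g'.1.
Proof.
move=> [_ om [t m]] lt0 e; have kl := curve_order e lt0.
apply: perm_one_inversion => // i j ij; apply/idP/eqP => [fl|[-> ->]]; last first.
  exact: once_flip m e lt0.
have [h [h' [u [+ + ih jh' _]]]] := flip_meet om ij fl.
rewrite !inE => /orP[]/eqP eh /orP[]/eqP eh'; subst h h' i j => //;
  by move: ij kl; rewrite ?ltnn => // /ltn_trans h /h; rewrite ltnn.
Qed.

Lemma dperm_once_ghost D g g' : once D g g' -> g.2 <> g'.2 -> dperm D = 1%g.
Proof.
move=> [_ om _] ne; apply: perm_no_inversion => i j ij; apply/negP => fl.
have [h [h' [u [+ + ih jh' [e _]]]]] := flip_meet om ij fl.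
rewrite !inE => /orP[]/eqP eh /orP[]/eqP eh'; subst h h' => //.
- by rewrite -ih -jh' ltnn in ij.
- exact: (ne (esym e)).
- by rewrite -ih -jh' ltnn in ij.
Qed.

Lemma diagram_op_twice D g g' f : twice D g g' -> touches g g' \/ touches g' g ->
  curve_at D g 0 < curve_at D g' 0 ->
  diagram_op D f = event_op (lab b) (passage g' g) (event_op (lab b) (passage g g') f).
Proof.
move=> [nodots om [t1 [t2 [t12 m]]]] i lt0.
have [s1 s2 lt1] := twice_cross t12 m i lt0.
have ne : g.1 <> g'.1.
  apply: (meet_distinct (u := t2 + 1) m (mem_head _ _)).
  by rewrite !inE; apply/norP; split; apply/eqP; lra.
have et1 : curve_at D g t1 = curve_at D g' t1 by apply/m; rewrite mem_head.
have et2 : curve_at D g t2 = curve_at D g' t2.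
  by apply/m; rewrite !inE eqxx orbT.
rewrite (@diagram_op_only_meet D [:: g; g'] [:: (t1, (g, g')); (t2, (g', g))]) //=.
- have -> : dperm D = 1%g; last by rewrite msym1m.
  apply: perm_no_inversion => k l kl; apply/negP => fl.
  have [h [h' [u [+ + kh lh' [e _]]]]] := flip_meet om kl fl.
  rewrite !inE => /orP[]/eqP eh /orP[]/eqP eh'; subst h h' k l.
  + by rewrite ltnn in kl.
  + have := top_order (esym e) lt1; by move/(ltn_trans fl); rewrite ltnn.
  + have := curve_order (esym e) lt0; by move/(ltn_trans kl); rewrite ltnn.
  + by rewrite ltnn in kl.
- by rewrite andbT ltW.
- by rewrite inE andbT; apply/eqP => -[]; lra.
- move=> h h' u; rewrite !inE => /orP[]/eqP-> /orP[]/eqP-> // _ _ e s.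
    have /m := e; rewrite !inE => /orP[]/eqP ut; subst u; first by rewrite eqxx.
    by have := lt_trans s s2; rewrite ltxx.
  have /esym/m := e; rewrite !inE => /orP[]/eqP ut; subst u; last by rewrite eqxx orbT.
  by have := lt_trans s s1; rewrite ltxx.
- by move=> h h' u; rewrite !inE => /orP[]/eqP[-> -> ->]; split=> //; exact: nesym.
Qed.

Section Thrice.
Variables (D : diagram b c) (g1 g2 g3 : 'I_d * R) (t12 t13 t23 : R).
Hypothesis D3 : thrice D g1 g2 g3 t12 t13 t23.

Let lt12 : curve_at D g1 0 < curve_at D g2 0.
Proof. by case: D3 => _ _ []. Qed.
Let lt23 : curve_at D g2 0 < curve_at D g3 0.
Proof. by case: D3 => _ _ []. Qed.
Let lt13 : curve_at D g1 0 < curve_at D g3 0.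
Proof. exact: lt_trans lt12 lt23. Qed.
Let m12 : meet_at D g1 g2 [:: t12]. Proof. by case: D3 => _ _ _ []. Qed.
Let m13 : meet_at D g1 g3 [:: t13]. Proof. by case: D3 => _ _ _ []. Qed.
Let m23 : meet_at D g2 g3 [:: t23]. Proof. by case: D3 => _ _ _ []. Qed.

Lemma thrice_distinct : [/\ g1.1 <> g2.1, g1.1 <> g3.1 & g2.1 <> g3.1].
Proof.
by split; [have [] := once_forward m12 lt12 | have [] := once_forward m13 lt13 |
  have [] := once_forward m23 lt23].
Qed.

Lemma thrice_pairs (w : seq (R * (('I_d * R) * ('I_d * R)))) f :
  perm_eq w [:: (t12, (g1, g2)); (t13, (g1, g3)); (t23, (g2, g3))] ->
  sorted (fun x y => x.1 <= y.1) w ->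
  diagram_op D f = msym (dperm D)
    (foldl (fun h x => event_op (lab b) (passage x.2.1 x.2.2) h) f w).
Proof.
have [nodots om _ _] := D3; have [n12 n13 n23] := thrice_distinct => pw sw.
apply: (@diagram_op_only_meet D [:: g1; g2; g3]) => //.
- rewrite (perm_uniq (perm_map _ pw)) /= !inE andbT.
  apply/andP; split; last by apply/eqP => /(congr1 (fun x => x.2.1.1)).
  apply/norP; split; apply/eqP.
    by move=> /(congr1 (fun x => x.2.1.2)).
  by move=> /(congr1 (fun x => x.2.1.1)).
- move=> h h' u; rewrite (perm_mem pw) !inE.
  move=> /or3P[]/eqP-> /or3P[]/eqP-> // _ i e s.
  + by have /m12 := e; rewrite inE => /eqP ->; rewrite eqxx.
  + by have /m13 := e; rewrite inE => /eqP ->; rewrite eqxx orbT.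
  + by have := once_backwards m12 lt12 i e s.
  + by have /m23 := e; rewrite inE => /eqP ->; rewrite eqxx !orbT.
  + by have := once_backwards m13 lt13 i e s.
  + by have := once_backwards m23 lt23 i e s.
- move=> h h' u; rewrite (perm_mem pw) !inE.
  by move=> /or3P[]/eqP[-> -> ->]; exact: once_forward.
Qed.

Lemma diagram_op_thrice_left f : t12 < t13 < t23 ->
  diagram_op D f = msym (dperm D) (event_op (lab b) (passage g2 g3)
    (event_op (lab b) (passage g1 g3) (event_op (lab b) (passage g1 g2) f))).
Proof.
move=> /andP[h1 h2].
rewrite (@thrice_pairs [:: (t12, (g1, g2)); (t13, (g1, g3)); (t23, (g2, g3))]) //=.
by rewrite !ltW.
Qed.

Lemma diagram_op_thrice_right f : t23 < t13 < t12 ->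
  diagram_op D f = msym (dperm D) (event_op (lab b) (passage g1 g2)
    (event_op (lab b) (passage g1 g3) (event_op (lab b) (passage g2 g3) f))).
Proof.
move=> /andP[h1 h2].
rewrite (@thrice_pairs [:: (t23, (g2, g3)); (t13, (g1, g3)); (t12, (g1, g2))]).
- by [].
- have /permPl := perm_rev [:: (t12, (g1, g2)); (t13, (g1, g3)); (t23, (g2, g3))].
  exact.
- by rewrite /= !ltW.
Qed.

(** A meeting of two curves is a crossing of their strands exactly when they carry the same
    translation. The right-hand side does not involve the order of the meetings, so both sides of a
    triangle move have the same permutation. *)
Lemma thrice_flips (i j : 'I_d) : (i < j)%N -> (dperm D j < dperm D i)%N =
  [|| ((i, j) == (g1.1, g2.1)) && (g1.2 == g2.2),
      ((i, j) == (g1.1, g3.1)) && (g1.2 == g3.2) |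
      ((i, j) == (g2.1, g3.1)) && (g2.2 == g3.2)].
Proof.
have [_ om _ _] := D3 => ij.
apply/idP/or3P => [fl|[]/andP[/eqP[-> ->] /eqP e]].
- have [h [h' [u [+ + ih jh' [e _]]]]] := flip_meet om ij fl.
  rewrite !inE => /or3P[]/eqP eh /or3P[]/eqP eh'; subst h h' i j;
    do ?[by rewrite ltnn in ij].
  + by apply: Or31; rewrite eqxx e eqxx.
  + by apply: Or32; rewrite eqxx e eqxx.
  + by have := curve_order (esym e) lt12; move/(ltn_trans ij); rewrite ltnn.
  + by apply: Or33; rewrite eqxx e eqxx.
  + by have := curve_order (esym e) lt13; move/(ltn_trans ij); rewrite ltnn.
  + by have := curve_order (esym e) lt23; move/(ltn_trans ij); rewrite ltnn.
- exact: once_flip m12 e lt12.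
- exact: once_flip m13 e lt13.
- exact: once_flip m23 e lt23.
Qed.

(** Either all three translations agree and there are three inversions, or only the outer strands
    cross; the result is the same transposition. *)
Lemma dperm_thrice : g1.2 = g3.2 -> dperm D = tperm g1.1 g3.1.
Proof.
have [n12 n13 n23] := thrice_distinct => e13.
have [e12|/eqP n] := eqVneq g1.2 g2.2.
  apply: (@perm_three_inversions _ _ _ g2.1).
  - exact: curve_order e12 lt12.
  - by apply: curve_order lt23; rewrite -e12.
  by move=> i j /thrice_flips ->; rewrite -e12 -e13 !eqxx !andbT.
apply: perm_one_inversion; first exact: curve_order e13 lt13.
move=> i j /thrice_flips ->; rewrite -e13 !eqxx andbT.
by rewrite (introF eqP n) (introF eqP (nesym n)) !andbF orbF.
Qed.

End Thrice.

Lemma dperm_thrice2 D D' g1 g2 g3 t12 t13 t23 u12 u13 u23 :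
  thrice D g1 g2 g3 t12 t13 t23 -> thrice D' g1 g2 g3 u12 u13 u23 ->
  dperm D = dperm D'.
Proof.
move=> h h'; apply: perm_eq_inversions => i j ij.
by rewrite (thrice_flips h) // (thrice_flips h').
Qed.

End Shapes.

(** * Linear extension to combinations of diagrams *)

Section FreeModules.
Set Implicit Arguments.
Unset Strict Implicit.
Variables (K : comNzRingType) (T : choiceType) (M : lmodType K).
Implicit Types (h : T -> M) (x y : {freeg T / K}).

Lemma fgliftE h x :
  fglift h x = \sum_(z <- generic_quotient.repr x : seq (K * T)) z.1 *: h z.2.
Proof. by unlock fglift; rewrite /lift /prelift. Qed.

Lemma fgliftD h x y : fglift h (x + y) = fglift h x + fglift h y.
Proof.
have := @lift_is_additive _ _ _ h x (- y); rewrite opprK => ->.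
by have := @lift_is_additive _ _ _ h 0 y; rewrite sub0r => ->;
  have := @lift_is_additive _ _ _ h 0 0; rewrite !subrr => ->; rewrite sub0r opprK.
Qed.

Lemma scale_gen a k z : a *: << k *g z >> = << a * k *g z >> :> {freeg T / K}.
Proof. by apply/eqP/freeg_eqP => y; rewrite coeffZ !coeffU mulrA. Qed.

Lemma fgliftZ h a x : fglift h (a *: x) = a *: fglift h x.
Proof.
elim/freeg_ind_dom0: x => [|k z D _ _ IH].
  have e : fglift h 0 = 0 by have := fgliftD h 0 0; rewrite addr0 => /eqP;
    rewrite addrC -subr_eq subrr => /eqP.
  by rewrite scaler0 e scaler0.
by rewrite scalerDr scale_gen !fgliftD IH !liftU scalerDr scalerA.
Qed.

Lemma fglift_gen h z : fglift h << z >> = h z.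
Proof. by rewrite liftU scale1r. Qed.

End FreeModules.

Section Linear.
Set Implicit Arguments.
Unset Strict Implicit.
Variables (K : comNzRingType) (M N : lmodType K) (L : M -> N).
Hypothesis lL : linear L.

Lemma linear_zero : L 0 = 0.
Proof. by have := lL (-1) 0 0; rewrite scaler0 addr0 scaleN1r addNr. Qed.

Lemma linear_fglift (T : choiceType) (h : T -> M) (x : {freeg T / K}) :
  L (fglift h x) = fglift (fun z => L (h z)) x.
Proof.
rewrite !fgliftE; elim: (generic_quotient.repr x : seq _) => [|z s IH].
  by rewrite !big_nil linear_zero.
by rewrite !big_cons lL IH.
Qed.

End Linear.

Section Homs.
Set Implicit Arguments.
Unset Strict Implicit.
Variables (R : realType) (K : comNzRingType) (G : wgraph R K).

Definition hom_op d (b c : loading G d) (x : Defs.hom b c) (f : mpoly d K) :=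
  fglift (fun D => diagram_op D f) x.

Lemma hom_op_dg d (b c : loading G d) (D : diagram b c) (f : mpoly d K) :
  hom_op (dg D) f = diagram_op D f.
Proof. exact: fglift_gen. Qed.

Lemma linear_diagram_op d (b c : loading G d) (D : diagram b c) :
  linear (diagram_op D : mpoly d K -> mpoly d K).
Proof. exact: diagram_op_linear. Qed.

Lemma hom_opD d (b c : loading G d) (x y : Defs.hom b c) (f : mpoly d K) :
  hom_op (x + y) f = hom_op x f + hom_op y f.
Proof. exact: fgliftD. Qed.

Lemma hom_opZ d (b c : loading G d) a (x : Defs.hom b c) (f : mpoly d K) :
  hom_op (a *: x) f = a *: hom_op x f.
Proof. exact: fgliftZ. Qed.

Lemma hom_opB d (b c : loading G d) (x y : Defs.hom b c) (f : mpoly d K) :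
  hom_op (x - y) f = hom_op x f - hom_op y f.
Proof. by rewrite -[X in hom_op (_ + X) _]scaleN1r hom_opD hom_opZ scaleN1r. Qed.

Lemma hom_op_hmul d (b c a : loading G d) (x : Defs.hom c a) (y : Defs.hom b c)
    (f : mpoly d K) : hom_op (hmul x y) f = hom_op x (hom_op y f).
Proof.
have lOPh g : linear (fun z : Defs.hom b a => hom_op z g).
  by move=> k u v; rewrite hom_opD hom_opZ.
rewrite /hmul (linear_fglift (lOPh f)) {2}/hom_op; congr (fglift _ x).
apply/funext => D2; rewrite (linear_fglift (lOPh f)) /hom_op.
rewrite (linear_fglift (linear_diagram_op D2)); congr (fglift _ y).
by apply/funext => D1; rewrite fglift_gen diagram_op_stack.
Qed.

Lemma run_mul d lb (w : seq (R * event R d)) (p : R * event R d -> mpoly d K) :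
  (forall x, x \in w -> event_op (G := G) lb x.2 =1 *%R (p x)) ->
  forall f, run lb w f = \prod_(x <- w) p x * f.
Proof.
elim: w => [|x w IH] h f; first by rewrite big_nil mul1r.
rewrite big_cons /= h ?mem_head // IH; first by rewrite mulrCA mulrA.
by move=> y yw; apply: h; rewrite inE yw orbT.
Qed.

Lemma diagram_op_straight d (b : loading G d) (gb : generic_loading b)
    (m : multinom d) (f : mpoly d K) :
  diagram_op (straight m gb) f = mpolyX K m * f.
Proof.
set D := straight m gb.
pose w : seq (R * event R d) := [seq (t, (k, k, 0)) | k <- enum 'I_d, t <- dots D k].
have wP x : x \in w <-> occurs D x.2 x.1.
  case: x => t [[k l] delta]; rewrite /occurs /=; split.
    by move=> /allpairsPdep[k' [t' [_ tD [-> -> -> ->]]]]; rewrite eqxx.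
  case: eqP => [<- [-> tD]|_ []].
    by apply/allpairsPdep; exists k, t; rewrite mem_enum.
  by move=> /straight_interaction.
rewrite (@diagram_op_word _ _ _ _ _ _ D (sort (@bytime R d) w)); last first.
  split.
  - rewrite sort_uniq; apply: allpairs_uniq_dep; first exact: enum_uniq.
      by move=> k _; exact: dots_uniq.
    by move=> [k t] [k' t'] _ _ [-> ->].
  - by apply: sort_sorted => x y; apply: le_total.
  - by move=> x; rewrite mem_sort.
rewrite [dperm _]/= msym1m (@run_mul _ _ _ (fun x => yy_ x.2.1.1)); last first.
  move=> x; rewrite mem_sort => /allpairsPdep[k [t [_ _ ->]]] g /=.
  by rewrite event_op_dot.
congr (_ * _); rewrite (perm_big w) /=; last by rewrite perm_sort.
rewrite big_allpairs_dep big_enum /= mpolyXE_id; apply: eq_bigr => k _.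
rewrite big_const_seq count_predT /= size_map size_iota.
by elim: (m k) => [|n IH]; rewrite ?expr0 //= exprS -IH.
Qed.

Lemma hom_op_pol d (b : loading G d) (p f : mpoly d K) : generic_loading b ->
  hom_op (pol b p) f = p * f.
Proof.
move=> gb; rewrite /pol; case: pselect => // gb'.
rewrite [in RHS](mpolyE p) mulr_suml.
elim: (msupp p) => [|m s IH].
  by rewrite !big_nil; have := hom_opZ 0 (0 : Defs.hom b b) f;
    rewrite !scale0r.
by rewrite !big_cons hom_opD hom_opZ hom_op_dg IH diagram_op_straight scalerAl.
Qed.

(** Strands continue vertically, so a coincidence at the bottom would persist at height -1, where
    interactions are impossible. Beside an actual diagram, [pol] thus never takes its default value
    0. *)
Lemma generic_bottom d (b c : loading G d) (D : diagram b c) :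
  generic_loading b.
Proof.
move=> k l delta kl i e.
have : interaction (lab b) (strand D) (-1) k l delta.
  by split=> //; rewrite !strand_bot ?lerN10.
by move/interaction_out/andP => []; rewrite ltNge lerN10.
Qed.

Lemma generic_top d (b c : loading G d) (D : diagram b c) :
  generic_loading c.
Proof.
move=> k l delta kl i e.
have : interaction (lab b) (strand D) 2 ((dperm D)^-1 k)%g ((dperm D)^-1 l)%g delta.
  split; first by move/perm_inj.
    by rewrite -!(strand_lab D) !permKV.
  by rewrite !strand_top ?ler1n // !permKV.
by move/interaction_out/andP => [_]; rewrite ltrn1.
Qed.

End Homs.

(** * Local relations *)

Section TripleIdentities.
Set Implicit Arguments.
Unset Strict Implicit.
Variables (A : comNzRingType) (S12 S13 S23 : {rmorphism A -> A}).
Hypotheses (S12K : involutive S12) (S13K : involutive S13) (S23K : involutive S23).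
Hypotheses (S23_S13 : forall x, S23 (S13 x) = S13 (S12 x))
  (S12_S23 : forall x, S12 (S23 x) = S13 (S12 x))
  (S23_S12 : forall x, S23 (S12 x) = S12 (S13 x))
  (S13_S23 : forall x, S13 (S23 x) = S12 (S13 x)).
Implicit Types f g h r : A.

Let S23_c f : S23 (S13 (S12 f)) = S13 f.
Proof. by rewrite -S23_S13 S23K. Qed.

Let S23_c' f : S23 (S12 (S13 f)) = S12 f.
Proof. by rewrite -S23_S12 S23K. Qed.

Let S13_c' f : S13 (S12 (S13 f)) = S23 f.
Proof. by rewrite -S13_S23 S13K. Qed.

Let S12_c f : S12 (S13 (S12 f)) = S23 f.
Proof. by rewrite -S12_S23 S12K. Qed.

(* [y3 - y2] occurs twice because [S23 (S13 h)] also has it as denominator. *)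
Lemma alternating_sum y1 y2 y3 f g h r :
  S13 y1 = y3 -> S13 y2 = y2 -> S23 y1 = y1 -> S23 y2 = y3 -> S23 y3 = y2 ->
  h * (y2 - y1) = S12 f - f -> g * (y3 - y1) = S13 h - h ->
  r * (y3 - y2) = S23 g - g ->
  r * (y3 - y2) * ((y3 - y2) * (y3 - y1) * (y2 - y1)) =
  (y3 - y2) * (S12 f + S13 f + S23 f - f - S13 (S12 f) - S12 (S13 f)).
Proof.
move=> b1 b2 c1 c2 c3 eh eg er.
have e1 : S13 h * (y2 - y3) = S13 (S12 f) - S13 f.
  by rewrite -rmorphB -eh rmorphM rmorphB b1 b2.
have e2 : S23 h * (y3 - y1) = S12 (S13 f) - S23 f.
  by rewrite -S23_S12 -rmorphB -eh rmorphM rmorphB c1 c2.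
have e3 : S23 (S13 h) * (y3 - y2) = S13 f - S13 (S12 f).
  have := congr1 S23 e1; rewrite rmorphM !rmorphB c2 c3 S23_c => ->.
  by rewrite S23_S13.
have e4 : S23 g * (y2 - y1) = S23 (S13 h) - S23 h.
  by rewrite -rmorphB -eg rmorphM rmorphB c1 c3.
rewrite er.
transitivity ((S23 g * (y2 - y1)) * (y3 - y2) * (y3 - y1) -
  (g * (y3 - y1)) * ((y3 - y2) * (y2 - y1))); first by ring.
rewrite e4 eg.
transitivity ((S23 (S13 h) * (y3 - y2)) * (y3 - y1) -
  (S23 h * (y3 - y1)) * (y3 - y2) + (S13 h * (y2 - y3)) * (y2 - y1) +
  (h * (y2 - y1)) * (y3 - y2)); first by ring.
by rewrite e3 e2 e1 eh; ring.
Qed.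

(** The involutions compose as the transpositions of three letters. Once they are pushed through the
    coefficients, both sides are combinations of the six images of [f], which [ring] treats as
    independent variables. *)
Lemma loop_sum p12 p13 p23 f (T12 := fun f => p12 * (S12 f - f))
    (T13 := fun f => p13 * (S13 f - f)) (T23 := fun f => p23 * (S23 f - f)) :
  S12 p12 = p12 -> S12 p13 = p23 -> S12 p23 = p13 ->
  S13 p12 = p23 -> S13 p13 = p13 -> S13 p23 = p12 ->
  S23 p12 = p13 -> S23 p13 = p12 -> S23 p23 = p23 ->
  S13 (T23 (T13 (T12 f))) - S13 (T12 (T13 (T23 f))) =
  (p12 * p23 + p13 * p12 - p13 * p23) * S12 (T12 f) -
  (p12 * p23 + p13 * p23 - p13 * p12) * S23 (T23 f).
Proof.
move=> a1 a2 a3 b1 b2 b3 c1 c2 c3; rewrite /T12 /T13 /T23.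
do 4 rewrite ?(rmorphM, rmorphB) ?(a1, a2, a3, b1, b2, b3, c1, c2, c3).
rewrite !(S23_S13, S12_S23, S23_S12, S13_S23, S12K, S13K, S23K, S23_c, S23_c',
  S13_c', S12_c).
ring.
Qed.

End TripleIdentities.

(* Comparing two of these terms that differ unfolds them and does not end. *)
Local Opaque msym demazure ev2 mpolyX tperm.

Section ThreeVariables.
Set Implicit Arguments.
Unset Strict Implicit.
Variables (K : comNzRingType) (d : nat) (k1 k2 k3 : 'I_d).
Hypotheses (n12 : k1 <> k2) (n13 : k1 <> k3) (n23 : k2 <> k3).
Implicit Types f : mpoly d K.
Local Notation S12 := (msym (tperm k1 k2)).
Local Notation S13 := (msym (tperm k1 k3)).
Local Notation S23 := (msym (tperm k2 k3)).

Lemma msym_conj (s : {perm 'I_d}) k l f :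
  msym s (msym (tperm k l) f) = msym (tperm (s k) (s l)) (msym s f).
Proof. by rewrite -!msymMm conjgC tpermJ. Qed.

Lemma msym_tpermK k l : involutive (msym (tperm k l) : mpoly d K -> mpoly d K).
Proof. by move=> f; rewrite -msymMm tperm2 msym1m. Qed.

Let neq (k l : 'I_d) : k <> l -> (k != l) * (l != k).
Proof. by move=> kl; split; apply/eqP => // /esym. Qed.

Let D12 := tpermD (neq n13).1 (neq n23).1.
Let D13 := tpermD (neq n12).1 (neq n23).2.
Let D23 := tpermD (neq n12).2 (neq n13).2.

Let S23_S13 f : S23 (S13 f) = S13 (S12 f).
Proof. by rewrite [RHS]msym_conj tpermL D13 tpermC. Qed.

Let S12_S23 f : S12 (S23 f) = S13 (S12 f).
Proof. by rewrite msym_conj tpermR D12. Qed.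

Let S23_S12 f : S23 (S12 f) = S12 (S13 f).
Proof. by rewrite [RHS]msym_conj tpermL D12. Qed.

Let S13_S23 f : S13 (S23 f) = S12 (S13 f).
Proof. by rewrite msym_conj D13 tpermR tpermC. Qed.

(** Up to sign, this is the classical formula for the Demazure operator of the longest permutation:
    an alternating sum over the Vandermonde product. The middle operator has indices [k1] and [k3]
    because variables keep their bottom numbers. *)
Lemma demazure_alternating f :
  demazure k2 k3 (demazure k1 k3 (demazure k1 k2 f)) *
    ((yy_ k3 - yy_ k2) * (yy_ k3 - yy_ k1) * (yy_ k2 - yy_ k1)) =
  S12 f + S13 f + S23 f - f - S13 (S12 f) - S12 (S13 f).
Proof.
(* Both sides are multiplied by the extra factor [yy_ k3 - yy_ k2] that occurs in
   [alternating_sum]. *)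
apply: (subX_inj n23); rewrite [RHS]mulrC mulrAC.
apply: (@alternating_sum _ S12 S13 S23 _ _ _ _ _ _ f
  (demazure k1 k3 (demazure k1 k2 f)) (demazure k1 k2 f));
  rewrite /= ?msymXU ?tpermL ?tpermR ?D12 ?D13 ?D23 //; try exact: msym_tpermK.
- exact: demazureP n12.
- exact: demazureP n13.
- exact: demazureP n23.
Qed.

Lemma loop_braid (p : mpoly 2 K) f
    (T := fun k l f => ev2 p (yy_ k) (yy_ l) * (msym (tperm k l) f - f))
    (P := fun k l => ev2 p (yy_ k) (yy_ l) : mpoly d K) :
  msym (tperm ord0 ord_max) p = p ->
  S13 (T k2 k3 (T k1 k3 (T k1 k2 f))) - S13 (T k1 k2 (T k1 k3 (T k2 k3 f))) =
  (P k1 k2 * P k2 k3 + P k1 k3 * P k1 k2 - P k1 k3 * P k2 k3)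
    * S12 (T k1 k2 f) -
  (P k1 k2 * P k2 k3 + P k1 k3 * P k2 k3 - P k1 k3 * P k1 k2)
    * S23 (T k2 k3 f).
Proof.
move=> sp; have PC k l : ev2 p (yy_ k) (yy_ l) = P l k by rewrite ev2C.
apply: (@loop_sum _ S12 S13 S23); try exact: msym_tpermK;
  rewrite /= ?msym_ev2 ?msymXU ?tpermL ?tpermR ?D12 ?D13 ?D23 //;
  first [exact: PC | exact: S12_S23 | exact: S13_S23].
Qed.

End ThreeVariables.

Lemma demazureC (K : comNzRingType) d (k l : 'I_d) (f : mpoly d K) : k <> l ->
  demazure l k f = - demazure k l f.
Proof.
move=> kl; apply: demazure_eq; first exact: nesym.
by rewrite mulNr -mulrN opprB tpermC demazureP.
Qed.

(** Exchanging [k1] and [k3] in [demazure_alternating] preserves the alternating sum, while the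
    Vandermonde product changes sign; reversing the indices of the three operators gives a second
    sign, which cancels it. *)
Lemma demazure_braid (K : comNzRingType) d (k1 k2 k3 : 'I_d) (f : mpoly d K) :
  k1 <> k2 -> k1 <> k3 -> k2 <> k3 ->
  demazure k2 k3 (demazure k1 k3 (demazure k1 k2 f)) =
  demazure k1 k2 (demazure k1 k3 (demazure k2 k3 f)).
Proof.
move=> n12 n13 n23.
have dN k l (g : mpoly d K) : k <> l -> demazure k l (- g) = - demazure k l g.
  move=> kl; apply: demazure_eq => //.
  by rewrite mulNr demazureP // msymN opprB opprK addrC.
have e := demazure_alternating n12 n13 n23 f.
have e3 : demazure k2 k1 (demazure k3 k1 (demazure k3 k2 f)) =
    - demazure k1 k2 (demazure k1 k3 (demazure k2 k3 f)).
  have -> : demazure k3 k2 f = - demazure k2 k3 f := demazureC f n23.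
  set u := demazure k2 k3 f.
  have -> : demazure k3 k1 (- u) = demazure k1 k3 u.
    by rewrite (demazureC (- u) n13) (dN _ _ u n13) opprK.
  exact: demazureC.
have := demazure_alternating (nesym n23) (nesym n13) (nesym n12) f.
rewrite e3.
rewrite (tpermC k3 k2) (tpermC k2 k1) (tpermC k3 k1).
have -> : msym (tperm k1 k3) (msym (tperm k2 k3) f) =
    msym (tperm k1 k2) (msym (tperm k1 k3) f).
  by rewrite msym_conj tpermR tpermC tpermD //; apply/eqP => // /esym.
have -> : msym (tperm k2 k3) (msym (tperm k1 k3) f) =
    msym (tperm k1 k3) (msym (tperm k1 k2) f).
  rewrite [RHS]msym_conj tpermL tpermC tpermD //; by apply/eqP => // /esym.
move=> e'; apply: (subX_inj n12); apply: (subX_inj n13); apply: (subX_inj n23).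
move: (demazure k2 k3 _) e (demazure k1 k2 _) e' => x e x'.
move: (yy_ k1 : mpoly d K) (yy_ k2 : mpoly d K) (yy_ k3 : mpoly d K) e.
move: (msym (tperm k1 k2) (msym (tperm k1 k3) f))
  (msym (tperm k1 k3) (msym (tperm k1 k2) f)).
move: (msym (tperm k1 k2) f) (msym (tperm k1 k3) f) (msym (tperm k2 k3) f).
move=> f12 f13 f23 c2 c1 y1 y2 y3 e e'.
transitivity (x * ((y3 - y2) * (y3 - y1) * (y2 - y1))); first by ring.
rewrite e.
transitivity (- x' * ((y1 - y2) * (y1 - y3) * (y2 - y3))); last by ring.
by rewrite e'; ring.
Qed.

Section Loops.
Set Implicit Arguments.
Unset Strict Implicit.
Variables (R : realType) (K : comNzRingType) (G : wgraph R K).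
Implicit Types (i : vertex G) (e : edge G).

Lemma Ppoly_loop i e : loop0_at i e ->
  msym (tperm ord0 ord_max) (Ppoly e) = Ppoly e /\
  Qpoly e = (yy_ (ord0 : 'I_2) - yy_ (ord_max : 'I_2)) * Ppoly e.
Proof.
case=> te he we; have [P sP QP] := Qpoly_loop (etrans te (esym he)) we.
suff -> : Ppoly e = P by [].
by apply: quo_eq; [exact: lreg_subX|rewrite mulrC QP].
Qed.

Lemma loopQ_loop i e : loop0_at i e -> loopQ i = Qpoly e.
Proof.
move=> le; rewrite /loopQ; case: pselect => [h|[]]; last by exists e.
have [t h' w] := projT2 (cid h); case: le => t' h'' w'; congr (Qpoly _).
by apply: edges_merged; rewrite ?t ?h' ?w.
Qed.

Lemma loopP_loop i e : loop0_at i e -> loopP i = Ppoly e.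
Proof.
move=> le; rewrite /loopP; case: pselect => [h|[]]; last by exists e.
have [t h' w] := projT2 (cid h); case: le => t' h'' w'; congr (Ppoly _).
by apply: edges_merged; rewrite ?t ?h' ?w.
Qed.

Lemma loopQ_noloop i : (forall e, ~ loop0_at i e) -> loopQ i = 1.
Proof. by move=> n; rewrite /loopQ; case: pselect => // h; have [e /n] := h. Qed.

Lemma loopP_noloop i : (forall e, ~ loop0_at i e) -> loopP i = 0.
Proof. by move=> n; rewrite /loopP; case: pselect => // h; have [e /n] := h. Qed.

Lemma loopP_sym i : msym (tperm ord0 ord_max) (loopP i) = loopP i.
Proof.
have [[e le]|n] := pselect (exists e, loop0_at i e).
  by rewrite (loopP_loop le); have [] := Ppoly_loop le.
by rewrite loopP_noloop ?msym0 // => e le; apply: n; exists e.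
Qed.

(** The factor [uu - vv] of Q_e cancels the denominator of the Demazure operator. *)
Lemma loopQ_demazure d i (k l : 'I_d) (f : mpoly d K) : k <> l ->
  (exists e, loop0_at i e) ->
  ev2 (loopQ i) (yy_ l) (yy_ k) * demazure k l f =
  ev2 (loopP i) (yy_ k) (yy_ l) * (msym (tperm k l) f - f).
Proof.
move=> kl [e le]; rewrite (loopQ_loop le) (loopP_loop le).
have [sP ->] := Ppoly_loop le.
rewrite ev2M ev2B ev2u ev2v (ev2C _ _ sP) -demazureP //.
by rewrite mulrAC mulrC [demazure _ _ _ * _]mulrC.
Qed.

Lemma loopQ_demazure_swap d i (k l : 'I_d) (f : mpoly d K) : k <> l ->
  (exists e, loop0_at i e) ->
  ev2 (loopQ i) (yy_ k) (yy_ l) * demazure k l f =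
  ev2 (loopP i) (yy_ k) (yy_ l) * (f - msym (tperm k l) f).
Proof.
move=> kl el; rewrite -[demazure k l f]opprK -(demazureC _ kl) mulrN.
rewrite (loopQ_demazure _ (nesym kl) el) (ev2C _ _ (loopP_sym i)) (tpermC l k).
by rewrite -mulrN opprB.
Qed.

End Loops.

Section CrossingOperators.
Set Implicit Arguments.
Unset Strict Implicit.
Variables (R : realType) (K : comNzRingType) (G : wgraph R K) (d : nat).
Implicit Types (lb : 'I_d -> vertex G) (f : mpoly d K) (k l : 'I_d).

Lemma msym_event_poly (lb lb' : 'I_d -> vertex G) (s : {perm 'I_d}) (q : event R d) :
  (forall k, lb' (s k) = lb k) ->
  msym s (event_poly lb q) = event_poly lb' (event_perm s q) :> mpoly d K.
Proof.
move=> lbs; rewrite /event_poly /joins /= !lbs.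
by case: pselect => h; rewrite ?msym_ev2 ?msymXU ?msym1.
Qed.

(** The three last hypotheses exclude the exceptional triples. If the outer curves form a Demazure
    event, either all three pairs do and the braid relation applies, or the middle curve acts by the
    identity. If another pair forms one, the remaining two factors are exchanged by its
    transposition. Otherwise all three operators are multiplications. *)
Lemma event_op_braid lb (k1 k2 k3 : 'I_d) a12 a13 a23 f :
  k1 <> k2 -> k1 <> k3 -> k2 <> k3 -> a12 + a23 = a13 ->
  (a13 = 0 -> lb k1 = lb k3 -> forall e, joins lb (k1, k2, a12) e ->
    loop0_at (etail e) e) ->
  (a13 = 0 -> lb k1 = lb k3 -> forall e, joins lb (k2, k3, a23) e ->
    loop0_at (etail e) e) ->
  (a12 = 0 -> a23 = 0 -> lb k1 = lb k2 -> lb k2 = lb k3 ->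
    forall e, ~ loop0_at (lb k1) e) ->
  event_op lb (k2, k3, a23) (event_op lb (k1, k3, a13) (event_op lb (k1, k2, a12) f)) =
  event_op lb (k1, k2, a12) (event_op lb (k1, k3, a13) (event_op lb (k2, k3, a23) f)).
Proof.
move=> n12 n13 n23 a123 g12 g23 noloop.
have [[a13_0 l13]|nd13] := pselect (a13 = 0 /\ lb k1 = lb k3).
  have [[a12_0 l12]|nd12] := pselect (a12 = 0 /\ lb k1 = lb k2).
    have a23_0 : a23 = 0 by lra.
    have l23 : lb k2 = lb k3 by rewrite -l12.
    clear a123; subst a12 a13 a23.
    have nl := noloop erefl erefl l12 l23.
    have e k l g : k <> l -> lb k = lb k1 -> lb l = lb k1 ->
        event_op lb (k, l, 0) g = demazure k l g.
      move=> kl lk ll; rewrite event_op_demazure ?lk ?ll //.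
      by rewrite (loopQ_noloop nl) ev21 mul1r.
    have e12 g := e k1 k2 g n12 erefl (esym l12).
    have e13 g := e k1 k3 g n13 erefl (esym l13).
    have e23 g := e k2 k3 g n23 (esym l12) (esym l13).
    rewrite e12 e13 e23 e23 e13 e12.
    exact: demazure_braid.
  have nd23 : ~ (a23 = 0 /\ lb k2 = lb k3).
    by case=> a0 l23; apply: nd12; split; [lra|rewrite l13 l23].
  (* An edge here would be a loop of weight 0, which would make this pair a Demazure event. *)
  have e12 g : event_op lb (k1, k2, a12) g = g.
    rewrite (event_op_mul _ n12 nd12) event_poly_noedge ?mul1r // => e je; apply: nd12.
    have [t1 h1 w1] := g12 a13_0 l13 e je; case: je => /= t2 h2 w2.
    by rewrite -w2 -t2 -h2 h1.
  have e23 g : event_op lb (k2, k3, a23) g = g.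
    rewrite (event_op_mul _ n23 nd23) event_poly_noedge ?mul1r // => e je; apply: nd23.
    have [t1 h1 w1] := g23 a13_0 l13 e je; case: je => /= t2 h2 w2.
    by rewrite -w2 -t2 -h2 h1.
  by rewrite !e12 !e23.
have [[a12_0 l12]|nd12] := pselect (a12 = 0 /\ lb k1 = lb k2).
  have nd23 : ~ (a23 = 0 /\ lb k2 = lb k3).
    by case=> a0 l23; apply: nd13; split; [lra|rewrite l12 l23].
  (* The factors of the pairs (1, 3) and (2, 3) are exchanged by the swap of 1 and 2, so their
     product is invariant and passes through the crossing. *)
  rewrite !(event_op_mul _ n13 nd13) !(event_op_mul _ n23 nd23).
  rewrite mulrA [event_poly _ _ * event_poly _ _]mulrC -mulrA [in RHS]mulrA.
  rewrite [in RHS]event_opMl ?mulrA //= msymM.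
  have lb12 k : lb (tperm k1 k2 k) = lb k by case: tpermP => [->|->|].
  have a1323 : a13 = a23 by lra.
  rewrite !(msym_event_poly _ lb12) /event_perm /= tpermL tpermR a1323.
  by rewrite !tpermD; [rewrite mulrC| apply/eqP => // /esym ..].
have [[a23_0 l23]|nd23] := pselect (a23 = 0 /\ lb k2 = lb k3).
  rewrite !(event_op_mul _ n13 nd13) !(event_op_mul _ n12 nd12).
  rewrite mulrA event_opMl ?mulrA /=.
    by rewrite [event_poly _ _ * event_poly _ _]mulrC.
  rewrite msymM.
  have lb23 k : lb (tperm k2 k3 k) = lb k by case: tpermP => [->|->|].
  have a1312 : a13 = a12 by lra.
  rewrite !(msym_event_poly _ lb23) /event_perm /= tpermL tpermR a1312.
  by rewrite !tpermD; [rewrite mulrC| apply/eqP => // /esym ..].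
rewrite !(event_op_mul _ n12 nd12) !(event_op_mul _ n13 nd13) !(event_op_mul _ n23 nd23).
move: (event_poly lb (k1, k2, a12)) (event_poly lb (k1, k3, a13))
  (event_poly lb (k2, k3, a23)).
by move=> p12 p13 p23; ring.
Qed.

End CrossingOperators.

(** * Dots and bigons *)

Section Relations.
Set Implicit Arguments.
Unset Strict Implicit.
Variables (R : realType) (K : comNzRingType) (G : wgraph R K).
Variables (d : nat) (b c : loading G d).
Implicit Types (D X O : diagram b c) (f : mpoly d K) (k l m n : 'I_d).

Lemma succ_lt k l D : l = k.+1 :> nat ->
  curve_at D (k, 0) 0 < curve_at D (l, 0) 0.
Proof. by move=> kl; rewrite !curve_bot !addr0; apply: pt_mono; rewrite kl. Qed.

Lemma diagram_op_cross X k l : cross X k l -> k <> l /\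
  forall f, diagram_op X f = msym (tperm k l) (event_op (lab b) (k, l, 0) f).
Proof.
case=> kl X1; have lt0 := succ_lt X kl; split; first exact: once_distinct X1.
by move=> f; rewrite (diagram_op_once f X1 lt0) (dperm_once X1 lt0 erefl) /passage /= subrr.
Qed.

(** The final permutation exchanges the arguments of [loopQ] and fixes the Demazure quotient, which
    is invariant. *)
Lemma diagram_op_cross_same X k l : cross X k l -> lab b k = lab b l -> forall f,
  diagram_op X f = ev2 (loopQ (lab b k)) (yy_ k) (yy_ l) * demazure k l f.
Proof.
move=> /diagram_op_cross[kl XE] lkl f.
rewrite XE (event_op_demazure _ kl lkl) msymM msym_ev2.
by rewrite !msymXU tpermL tpermR (msym_tperm_demazure _ kl).
Qed.

Lemma cross_dot_diff X k l f : cross X k l -> lab b k <> lab b l ->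
  yy_ k * diagram_op X f = diagram_op X (yy_ l * f) /\
  diagram_op X (yy_ k * f) = yy_ l * diagram_op X f.
Proof.
move=> /diagram_op_cross[kl XE] lkl; rewrite !XE.
have nd : ~ ((0 : R) = 0 /\ lab b k = lab b l) by case.
rewrite !(event_op_mul _ kl nd) !msymM !msymXU tpermL tpermR.
by split; rewrite mulrCA.
Qed.

Lemma demazure_Xl k l f : k <> l ->
  yy_ k * demazure k l f = demazure k l (yy_ l * f) + f.
Proof.
move=> kl; apply: (subX_inj kl); rewrite mulrDl -mulrA !(demazureP _ kl).
rewrite msymM msymXU tpermR.
by move: (msym _ f) (yy_ k : mpoly d K) (yy_ l : mpoly d K) => g u v; ring.
Qed.

Lemma demazure_Xk k l f : k <> l ->
  demazure k l (yy_ k * f) = yy_ l * demazure k l f + f.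
Proof.
move=> kl; apply: (subX_inj kl); rewrite mulrDl -mulrA !(demazureP _ kl).
rewrite msymM msymXU tpermL.
by move: (msym _ f) (yy_ k : mpoly d K) (yy_ l : mpoly d K) => g u v; ring.
Qed.

Lemma cross_dot_same X k l f (Q := ev2 (loopQ (lab b k)) (yy_ k) (yy_ l)) :
  cross X k l -> lab b k = lab b l ->
  yy_ k * diagram_op X f = diagram_op X (yy_ l * f) + Q * f /\
  diagram_op X (yy_ k * f) = yy_ l * diagram_op X f + Q * f.
Proof.
move=> Xkl lkl; have [kl _] := diagram_op_cross Xkl.
rewrite !(diagram_op_cross_same Xkl lkl) -/Q; split.
  by rewrite mulrCA (demazure_Xl _ kl) mulrDr.
by rewrite (demazure_Xk _ kl) mulrDr mulrCA.
Qed.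

(** For the reverse passage, an edge would run opposite to [e] with negated weight; by
    [edges_merged_rev] it would be [e], which would then be a loop of weight 0. *)
Lemma event_op_ghost (lb : 'I_d -> vertex G) e m n f : m <> n ->
  lb m = etail e -> lb n = ehead e -> ~ loop0_at (etail e) e ->
  event_op lb (m, n, weight e) f = ev2 (Qpoly e) (yy_ n) (yy_ m) * f /\
  event_op lb (n, m, - weight e) f = f.
Proof.
move=> mn lm ln nl; split.
  rewrite event_op_mul //; last first.
    by case=> w0 lmn; apply: nl; split=> //; rewrite -ln -lmn.
  by rewrite (@event_poly_edge _ _ _ _ _ _ e).
rewrite event_op_mul; [|exact: nesym|]; last first.
  case=> w0 lmn; apply: nl; split=> //; first by rewrite -ln lmn.
  by apply: oppr_inj; rewrite w0 oppr0.
rewrite event_poly_noedge ?mul1r // => e' [/= t h w].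
have ee : e' = e by apply: edges_merged_rev; rewrite ?t ?h ?w.
subst e'; apply: nl; split=> //; first by rewrite h.
lra.
Qed.

Lemma diagram_op_ghost_bigon D e m n f : twice D (m, 0) (n, weight e) ->
  lab b m = etail e -> lab b n = ehead e -> ~ loop0_at (etail e) e ->
  diagram_op D f = ev2 (Qpoly e) (yy_ n) (yy_ m) * f.
Proof.
move=> D2 lm ln nl; have i : touches b (m, 0) (n, weight e).
  by right; exists e; rewrite /= subr0.
have mn : m <> n.
  have [_ _ [t1 [t2 [t12 mt]]]] := D2.
  apply: (meet_distinct (u := t2 + 1) mt (mem_head _ _)).
  by rewrite !inE; apply/norP; split; apply/eqP; lra.
have gE g := event_op_ghost g mn lm ln nl.
have D2' : twice D (n, weight e) (m, 0).
  case: D2 => nodots om [t1 [t2 [t12 mt]]]; split=> //.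
    move=> t k l delta /om[g [g' [gg gg' *]]]; exists g, g'.
    by split=> //; move: gg gg'; rewrite !inE orbC => gg; rewrite orbC => gg'.
  by exists t1, t2; split=> // t; rewrite -mt; split=> ->.
have p1 : passage (m, 0) (n, weight e) = (m, n, weight e) by rewrite /passage /= subr0.
have p2 : passage (n, weight e) (m, 0) = (n, m, - weight e) by rewrite /passage /= sub0r.
(* On whichever side the strand starts, exactly one of the two meetings takes it from left to right
   of the ghost. A common starting point is impossible. *)
have [lt0|gt0|eq0] := ltgtP (curve_at D (m, 0) 0) (curve_at D (n, weight e) 0).
- by rewrite (diagram_op_twice f D2 (or_introl i) lt0) p1 p2 (gE _).2 (gE _).1.
- by rewrite (diagram_op_twice f D2' (or_intror i) gt0) p1 p2 (gE _).1 (gE _).2.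
- have [] := meet_transversal (D := D) (g := (m, 0)) (g' := (n, weight e)) mn
    (or_introl i) eq0.
  by rewrite ltxx.
Qed.

Lemma diagram_op_bigon D k l f : bigon D k l -> k <> l /\
  diagram_op D f = event_op (lab b) (l, k, 0) (event_op (lab b) (k, l, 0) f).
Proof.
case=> kl D2; have i : touches b (k, 0) (l, 0) by left; rewrite /= subrr.
rewrite (diagram_op_twice f D2 (or_introl i) (succ_lt D kl)) /passage /= subrr; split=> //.
by move=> e; rewrite e in kl; apply: n_Sn kl.
Qed.

Lemma diagram_op_bigon_diff D k l f : bigon D k l -> lab b k <> lab b l ->
  (forall e : edge G, weight e = 0 ->
    ~ (etail e = lab b k /\ ehead e = lab b l) /\
    ~ (etail e = lab b l /\ ehead e = lab b k)) -> diagram_op D f = f.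
Proof.
move=> Dkl lkl noe; have [kl ->] := diagram_op_bigon f Dkl.
rewrite !event_op_mul //; [|by case|exact: nesym|by case=> _ /esym].
rewrite !event_poly_noedge ?mul1r // => e [/= t h w]; have [n1 n2] := noe e w.
  by apply: n1.
by apply: n2.
Qed.

(** Without a loop, the Demazure operator kills its own image. With one, as P is symmetric, the
    square of P (s - 1) is 2 P times P (1 - s). *)
Lemma diagram_op_bigon_same D X k l f : bigon D k l -> cross X k l ->
  lab b k = lab b l ->
  diagram_op D f = 2%:R * ev2 (loopP (lab b k)) (yy_ k) (yy_ l) * diagram_op X f.
Proof.
move=> Dkl Xkl lkl; have [kl ->] := diagram_op_bigon f Dkl.
rewrite (diagram_op_cross_same Xkl lkl) (event_op_demazure _ kl lkl).
rewrite (event_op_demazure _ (nesym kl) (esym lkl)).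
rewrite -lkl; set i := lab b k.
have [[e le]|n] := pselect (exists e, loop0_at i e); last first.
  have n' e : ~ loop0_at i e by move=> le; apply: n; exists e.
  rewrite (loopQ_noloop n') (loopP_noloop n') ev20 mulr0 mul0r !ev21 !mul1r.
  rewrite (demazureC _ kl) (demazure_eq (g := 0) kl) ?oppr0 //.
  by rewrite mul0r (msym_tperm_demazure _ kl) subrr.
have el : exists e, loop0_at i e by exists e.
have sP := loopP_sym i.
rewrite (loopQ_demazure_swap _ kl el) (loopQ_demazure _ kl el).
rewrite (loopQ_demazure _ (nesym kl) el).
rewrite (tpermC l k) (ev2C (yy_ l) _ sP) msymM msymB msym_ev2 !msymXU tpermL tpermR.
rewrite (ev2C (yy_ l) _ sP) msym_tpermK.
move: (ev2 _ _ _) (msym _ f) => p g.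
by ring.
Qed.

End Relations.

Local Opaque hmul dg pol hom_op diagram_op quo.

(** * Triple points *)

Section TripleRelations.
Set Implicit Arguments.
Unset Strict Implicit.
Variables (R : realType) (K : comNzRingType) (G : wgraph R K).
Variables (d : nat) (b c : loading G d).
Implicit Types (D X O : diagram b c) (f p : mpoly d K) (k l m n : 'I_d).
Implicit Types (g : 'I_d * R).

Lemma demazure_leibniz k l p f : k <> l ->
  demazure k l (p * f) =
  p * demazure k l f + demazure k l p * msym (tperm k l) f.
Proof.
move=> kl; apply: (subX_inj kl).
rewrite mulrDl -mulrA [demazure k l p * _ * _]mulrAC !(demazureP _ kl) msymM.
by move: (msym _ p) (msym _ f) => p' f'; ring.
Qed.

Lemma quo_demazure k l p q : k <> l -> msym (tperm k l) p = q ->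
  quo (p - q) (yy_ k - yy_ l) = demazure k l p.
Proof.
move=> kl pq; apply: quo_eq; first exact/lreg_subX/nesym.
by rewrite -[LHS]opprK -mulrN opprB (demazureP _ kl) pq opprB.
Qed.

Lemma middle_left_order D g1 g2 g3 : middle_left D g1 g2 g3 ->
  curve_at D g1 0 < curve_at D g2 0 /\ curve_at D g2 0 < curve_at D g3 0.
Proof. by move=> [t12 [t13 [t23 [[]]]]]. Qed.

Lemma diagram_op_middle_left D g1 g2 g3 : middle_left D g1 g2 g3 ->
  [/\ g1.1 <> g2.1, g1.1 <> g3.1 & g2.1 <> g3.1] /\
  forall f, diagram_op D f = msym (dperm D) (event_op (lab b) (passage g2 g3)
    (event_op (lab b) (passage g1 g3) (event_op (lab b) (passage g1 g2) f))).
Proof.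
move=> [t12 [t13 [t23 [h lt3]]]]; split; first exact: thrice_distinct h.
by move=> f; exact: diagram_op_thrice_left h f lt3.
Qed.

Lemma diagram_op_middle_right D g1 g2 g3 : middle_right D g1 g2 g3 ->
  forall f, diagram_op D f = msym (dperm D) (event_op (lab b) (passage g1 g2)
    (event_op (lab b) (passage g1 g3) (event_op (lab b) (passage g2 g3) f))).
Proof. by move=> [t12 [t13 [t23 [h lt3]]]] f; exact: diagram_op_thrice_right h f lt3. Qed.

Lemma dperm_middle D D' g1 g2 g3 : middle_left D g1 g2 g3 ->
  middle_right D' g1 g2 g3 -> dperm D' = dperm D.
Proof.
by move=> [? [? [? [h _]]]] [? [? [? [h' _]]]]; exact: dperm_thrice2 h' h.
Qed.

Lemma dperm_middle_left D g1 g2 g3 : middle_left D g1 g2 g3 ->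
  g1.2 = g3.2 -> dperm D = tperm g1.1 g3.1.
Proof. by move=> [? [? [? [h _]]]]; exact: dperm_thrice h. Qed.

Lemma diagram_op_triple D D' g1 g2 g3 f :
  middle_left D g1 g2 g3 -> middle_right D' g1 g2 g3 ->
  (forall e, ~ ghost_triple b e g1 g2 g3) ->
  (forall e, ~ strand_triple b e g1 g2 g3) ->
  (forall i, ~ loop_triple b i g1 g2 g3) -> diagram_op D f = diagram_op D' f.
Proof.
move=> DL DR ng ns nl; have [[n12 n13 n23] ->] := diagram_op_middle_left DL.
rewrite (diagram_op_middle_right DR) (dperm_middle DL DR); congr (msym _ _).
rewrite /passage; apply: event_op_braid => //.
- by lra.
- move=> a0 l13 e [/= t h w]; apply: contrapT => nle.
  by apply: (ng e); split; split=> //; rewrite ?t ?h //; lra.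
- move=> a0 l13 e [/= t h w]; apply: contrapT => nle.
  by apply: (ns e); split; split=> //; rewrite ?t ?h //; lra.
- move=> a12 a23 l12 l23 e le; apply: (nl (lab b g1.1)).
  by split; split; rewrite -?l23 -?l12 //; [exists e|lra|lra].
Qed.

(** The factor Q_e is multiplied before the crossing in [D] and after it in [D']. By the Leibniz
    rule the difference is the divided difference of Q_e times the swapped [f], and the final
    permutation undoes the swap. *)
Lemma diagram_op_ghost_triple D D' g1 g2 g3 e f (y1 := yy_ g1.1) (y2 := yy_ g2.1)
    (y3 := yy_ g3.1) :
  middle_left D g1 g2 g3 -> middle_right D' g1 g2 g3 ->
  ghost_triple b e g1 g2 g3 ->
  diagram_op D f - diagram_op D' f = ev2 (loopQ (etail e)) y1 y3 *
    quo (ev2 (Qpoly e) y2 y1 - ev2 (Qpoly e) y2 y3) (y1 - y3) * f.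
Proof.
move=> DL DR [[nle d13 w] [l1 l3 l2]].
have [[n12 n13 n23] ->] := diagram_op_middle_left DL.
rewrite (diagram_op_middle_right DR) (dperm_middle DL DR) (dperm_middle_left DL d13).
have p12 : passage g1 g2 = (g1.1, g2.1, weight e) by rewrite /passage w.
have p23 : passage g2 g3 = (g2.1, g3.1, - weight e).
  by rewrite /passage w -d13 opprB.
have p13 : passage g1 g3 = (g1.1, g3.1, 0) by rewrite /passage d13 subrr.
rewrite p12 p13 p23.
have e12 h : event_op (lab b) (g1.1, g2.1, weight e) h = ev2 (Qpoly e) y2 y1 * h.
  by have [] := event_op_ghost h n12 l1 l2 nle.
have e23 h : event_op (lab b) (g2.1, g3.1, - weight e) h = h.
  by have [] := event_op_ghost h (nesym n23) l3 l2 nle.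
have e13 h : event_op (lab b) (g1.1, g3.1, 0) h =
    ev2 (loopQ (etail e)) y3 y1 * demazure g1.1 g3.1 h.
  by rewrite event_op_demazure ?l1.
rewrite e12 e13 e23 e23 e12 e13 -msymB.
have swap : msym (tperm g1.1 g3.1) (ev2 (Qpoly e) y2 y1) = ev2 (Qpoly e) y2 y3.
  rewrite msym_ev2 /y1 /y2 !msymXU tpermL tpermD //; apply/eqP => //.
  exact: nesym.
rewrite (quo_demazure n13 swap) (demazure_leibniz _ _ n13).
rewrite mulrDr mulrCA addrC addKr !msymM msym_ev2 /y1 /y3 !msymXU tpermL tpermR.
by rewrite (msym_tperm_demazure _ n13) msym_tpermK mulrA.
Qed.

(** Here Q_e is multiplied after the crossing in [D] and before it in [D']. The opposite sign is
    compensated because the factor is Q_e in [y3] and [y2], the swap of the polynomial in the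
    relation. *)
Lemma diagram_op_strand_triple D D' g1 g2 g3 e f (y1 := yy_ g1.1) (y2 := yy_ g2.1)
    (y3 := yy_ g3.1) :
  middle_left D g1 g2 g3 -> middle_right D' g1 g2 g3 ->
  strand_triple b e g1 g2 g3 ->
  diagram_op D f - diagram_op D' f = ev2 (loopQ (ehead e)) y1 y3 *
    quo (ev2 (Qpoly e) y1 y2 - ev2 (Qpoly e) y3 y2) (y1 - y3) * f.
Proof.
move=> DL DR [[nle d13 w] [l1 l3 l2]].
have [[n12 n13 n23] ->] := diagram_op_middle_left DL.
rewrite (diagram_op_middle_right DR) (dperm_middle DL DR) (dperm_middle_left DL d13).
have p12 : passage g1 g2 = (g1.1, g2.1, - weight e) by rewrite /passage w opprB.
have p23 : passage g2 g3 = (g2.1, g3.1, weight e) by rewrite /passage w d13.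
have p13 : passage g1 g3 = (g1.1, g3.1, 0) by rewrite /passage d13 subrr.
rewrite p12 p13 p23.
have e12 h : event_op (lab b) (g1.1, g2.1, - weight e) h = h.
  by have [] := event_op_ghost h (nesym n12) l2 l1 nle.
have e23 h : event_op (lab b) (g2.1, g3.1, weight e) h = ev2 (Qpoly e) y3 y2 * h.
  by have [] := event_op_ghost h n23 l2 l3 nle.
have e13 h : event_op (lab b) (g1.1, g3.1, 0) h =
    ev2 (loopQ (ehead e)) y3 y1 * demazure g1.1 g3.1 h.
  by rewrite event_op_demazure ?l1.
rewrite e12 e13 e23 e23 e12 e13 -msymB.
have swap : msym (tperm g1.1 g3.1) (ev2 (Qpoly e) y1 y2) = ev2 (Qpoly e) y3 y2.
  rewrite msym_ev2 /y1 /y2 !msymXU tpermL tpermD //; apply/eqP => //.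
  exact: nesym.
have swap' : msym (tperm g1.1 g3.1) (ev2 (Qpoly e) y3 y2) = ev2 (Qpoly e) y1 y2.
  by rewrite -swap msym_tpermK.
rewrite (quo_demazure n13 swap) (demazure_leibniz _ _ n13).
have -> : demazure g1.1 g3.1 (ev2 (Qpoly e) y3 y2) =
    - demazure g1.1 g3.1 (ev2 (Qpoly e) y1 y2).
  apply: (subX_inj n13); rewrite (demazureP _ n13) swap'.
  move: (demazureP (ev2 (Qpoly e) y1 y2) n13); rewrite swap.
  by move: (demazure _ _ _) => z ez; rewrite mulNr ez opprB.
rewrite mulrDr mulrCA opprD addNKr mulNr mulrN opprK.
rewrite !msymM msym_ev2 /y1 /y3 !msymXU tpermL tpermR.
by rewrite (msym_tperm_demazure _ n13) msym_tpermK mulrA.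
Qed.

Lemma diagram_op_loop_triple D D' X1 X2 g1 g2 g3 i f
    (P_ := fun g g' => ev2 (loopP i) (yy_ g.1) (yy_ g'.1) : mpoly d K) :
  middle_left D g1 g2 g3 -> middle_right D' g1 g2 g3 ->
  once X1 g1 g2 -> once X2 g2 g3 -> loop_triple b i g1 g2 g3 ->
  diagram_op D f - diagram_op D' f =
    (P_ g1 g2 * P_ g2 g3 + P_ g1 g3 * P_ g2 g1 - P_ g1 g3 * P_ g2 g3) * diagram_op X1 f -
    (P_ g1 g2 * P_ g2 g3 + P_ g1 g3 * P_ g3 g2 - P_ g1 g3 * P_ g1 g2) * diagram_op X2 f.
Proof.
move=> DL DR X12 X23 [[el d12 d23] [l1 l2 l3]].
have [lt12 lt23] := middle_left_order DL.
have d13 : g1.2 = g3.2 by rewrite d12.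
(* The order at the bottom depends only on [b], so [X1] and [X2] start as [D] does. *)
have lt12' : curve_at X1 g1 0 < curve_at X1 g2 0.
  by move: lt12; rewrite !curve_bot.
have lt23' : curve_at X2 g2 0 < curve_at X2 g3 0.
  by move: lt23; rewrite !curve_bot.
have [[n12 n13 n23] ->] := diagram_op_middle_left DL.
rewrite (diagram_op_middle_right DR) (dperm_middle DL DR) (dperm_middle_left DL d13).
rewrite (diagram_op_once f X12 lt12') (diagram_op_once f X23 lt23').
rewrite (dperm_once X12 lt12' d12) (dperm_once X23 lt23' d23).
have p12 : passage g1 g2 = (g1.1, g2.1, 0) by rewrite /passage d12 subrr.
have p23 : passage g2 g3 = (g2.1, g3.1, 0) by rewrite /passage d23 subrr.
have p13 : passage g1 g3 = (g1.1, g3.1, 0) by rewrite /passage d13 subrr.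
rewrite p12 p13 p23.
have copE k l h : k <> l -> lab b k = i -> lab b l = i ->
    event_op (lab b) (k, l, 0) h =
    ev2 (loopP i) (yy_ k) (yy_ l) * (msym (tperm k l) h - h).
  by move=> kl lk ll; rewrite event_op_demazure ?lk ?ll // loopQ_demazure.
have e12 h := copE g1.1 g2.1 h n12 l1 l2.
have e13 h := copE g1.1 g3.1 h n13 l1 l3.
have e23 h := copE g2.1 g3.1 h n23 l2 l3.
have sP := loopP_sym i.
rewrite /P_ (ev2C (yy_ g2.1) (yy_ g1.1) sP) (ev2C (yy_ g3.1) (yy_ g2.1) sP).
rewrite e12 e13 e23 e23 e13 e12.
exact: loop_braid n12 n13 n23 _ _ sP.
Qed.

Lemma hom_op_pol_dg X p f : hom_op (hmul (pol c p) (dg X)) f = p * diagram_op X f.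
Proof. by rewrite hom_op_hmul hom_op_dg (hom_op_pol _ _ (generic_top X)). Qed.

Lemma hom_op_dg_pol X p f : hom_op (hmul (dg X) (pol b p)) f = diagram_op X (p * f).
Proof. by rewrite hom_op_hmul hom_op_dg (hom_op_pol _ _ (generic_bottom X)). Qed.

Lemma local_rel_hom_op (x y : Defs.hom b c) f : local_rel x y -> hom_op x f = hom_op y f.
Proof.
case=> {x y}.
- move=> X k l Xkl lkl; rewrite hom_op_pol_dg hom_op_dg_pol.
  by have [] := cross_dot_diff f Xkl lkl.
- move=> X k l Xkl lkl; rewrite hom_op_pol_dg hom_op_dg_pol.
  by have [] := cross_dot_diff f Xkl lkl.
- move=> X O k l i Xkl lk ll uO.
  rewrite hom_opD !hom_op_pol_dg hom_op_dg_pol (diagram_op_uncrossed f uO) -lk.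
  by have [] := cross_dot_same f Xkl (etrans lk (esym ll)).
- move=> X O k l i Xkl lk ll uO.
  rewrite hom_opD !hom_op_pol_dg hom_op_dg_pol (diagram_op_uncrossed f uO) -lk.
  by have [] := cross_dot_same f Xkl (etrans lk (esym ll)).
- move=> D O e m n D2 lm ln nl uO.
  rewrite hom_op_pol_dg hom_op_dg (diagram_op_uncrossed f uO).
  exact: diagram_op_ghost_bigon.
- move=> D O k l Dkl lkl uO noe; rewrite !hom_op_dg (diagram_op_uncrossed f uO).
  exact: diagram_op_bigon_diff Dkl lkl noe.
- move=> D X k l i Dkl Xkl lk ll; rewrite hom_op_pol_dg hom_op_dg -lk.
  exact: diagram_op_bigon_same Dkl Xkl (etrans lk (esym ll)).
- move=> D D' g1 g2 g3 _ _ _ DL DR ng ns nl; rewrite !hom_op_dg.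
  exact: diagram_op_triple DL DR ng ns nl.
- move=> D D' O g1 g2 g3 e y1 y2 y3 _ _ _ DL DR uO gt.
  rewrite (hom_opB (dg D)) hom_op_pol_dg !hom_op_dg (diagram_op_uncrossed f uO).
  exact: diagram_op_ghost_triple.
- move=> D D' O g1 g2 g3 e y1 y2 y3 _ _ _ DL DR uO st.
  rewrite (hom_opB (dg D)) hom_op_pol_dg !hom_op_dg (diagram_op_uncrossed f uO).
  exact: diagram_op_strand_triple.
- move=> D D' X1 X2 g1 g2 g3 i P_ _ _ _ DL DR X12 X23 lt.
  rewrite (hom_opB (dg D)) (hom_op_dg D) (hom_op_dg D').
  apply: etrans (esym (hom_opB _ _ _)).
  apply: (etrans (diagram_op_loop_triple f DL DR X12 X23 lt)); apply/esym.
  exact: (congr2 (fun u v => u - v) (hom_op_pol_dg X1 _ f) (hom_op_pol_dg X2 _ f)).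
Qed.

End TripleRelations.

(** * The representation *)

Local Transparent hmul dg pol hom_op.

Section Representation.
Set Implicit Arguments.
Unset Strict Implicit.
Variables (R : realType) (K : comNzRingType) (G : wgraph R K).
Variable B : set (aloading G).
Implicit Types (X Y : bdiagram B) (x y : diagram_span B) (f g : polys B).

(** Extension by zero. The number of variables is part of the loading, so the polynomial is
    transported along an equality of pairs. *)
Definition place (c : aloading G) (p : mpoly (tag c) K) : polys B := fun b =>
  if pselect (c = sval b) is left h
  then eq_rect c (fun L => mpoly (tag L) K) p _ h else 0.

Lemma place_linear (c : aloading G) : linear (@place c).
Proof.
move=> a p q; apply: polysP => -[L hL]; rewrite /place.
rewrite -[RHS]/(a *: (if pselect (c = L) is left h then _ else 0) + _) /=.
case: pselect => [h|_]; last by rewrite scaler0 addr0.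
by case: L / h hL.
Qed.

Lemma place_here d (c : loading G d) (p : mpoly d K) (hc : B (ld c)) :
  component (place (c := ld c) p) hc = p.
Proof.
rewrite /component /place; case: pselect => [h|//].
by rewrite (Prop_irrelevance h erefl).
Qed.

Lemma place_elsewhere (c : aloading G) (p : mpoly (tag c) K) b :
  sval b <> c -> place p b = 0.
Proof. by move=> n; rewrite /place; case: pselect => // e; case: n. Qed.

Definition bdiagram_act X f : polys B :=
  place (c := ld (btop X)) (diagram_op (bdiag X) (component f (bbotP X))).

Definition act_span x f : polys B := fglift (fun X => bdiagram_act X f) x.

Lemma bdiagram_act_linear X : linear (bdiagram_act X).
Proof.
move=> a f g; rewrite /bdiagram_act -place_linear; congr place.
exact: diagram_op_linear.
Qed.

Lemma act_span_linearl f : linear (act_span^~ f).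
Proof. by move=> a x y; rewrite /act_span fgliftD fgliftZ. Qed.

Lemma act_span_linearr x : linear (act_span x).
Proof.
move=> a f g; rewrite /act_span !fgliftE.
elim: (generic_quotient.repr x : seq _) => [|z s IH].
  by rewrite !big_nil scaler0 addr0.
rewrite !big_cons IH bdiagram_act_linear !scalerDr !scalerA addrACA.
by rewrite [z.1 * a]mulrC.
Qed.

Lemma act_span_dg d (b c : loading G d) (hb : B (ld b)) (hc : B (ld c))
    (D : diagram b c) f :
  act_span (span_dg hb hc D) f = place (c := ld c) (diagram_op D (component f hb)).
Proof. exact: fglift_gen. Qed.

Lemma ld_inj d (b c : loading G d) : ld b = ld c -> b = c.
Proof. exact: Eqdep_dec.inj_pair2_eq_dec (@eq_comparable nat) _ _ _ _. Qed.

Lemma bstack_match d (b c a : loading G d) (hb : B (ld b)) (hc hc' : B (ld c))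
    (ha : B (ld a)) (D2 : diagram c a) (D1 : diagram b c) :
  bstack (BDiagram D2 hc ha) (BDiagram D1 hb hc') = span_dg hb ha (stack D2 D1).
Proof.
rewrite /bstack /=; case: pselect => [h|//].
by rewrite (Prop_irrelevance h erefl).
Qed.

(** If the loadings do not match, both sides vanish: the image of [Y] has no component at the bottom
    of [X]. *)
Lemma act_bstack X Y f : act_span (bstack X Y) f = bdiagram_act X (bdiagram_act Y f).
Proof.
have [h|n] := pselect (ld (bbot X) = ld (btop Y)); last first.
  rewrite /bstack; case: pselect => // _.
  have e : component (bdiagram_act Y f) (bbotP X) = 0.
    by rewrite /component /bdiagram_act place_elsewhere.
  rewrite (linear_zero (act_span_linearl f)) [RHS]/bdiagram_act e.
  rewrite (linear_zero (linear_diagram_op (bdiag X))).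
  exact/esym/(linear_zero (@place_linear (ld (btop X)))).
case: X Y h => d2 b2 c2 D2 hb2 hc2 [d1 b1 c1 D1 hb1 hc1] /= h.
have dd : d2 = d1 := congr1 (@tag _ _) h.
subst d2; have bc := ld_inj h; subst b2.
rewrite bstack_match act_span_dg /bdiagram_act /=; congr place.
by rewrite place_here diagram_op_stack.
Qed.

Lemma act_span_mul x y f :
  act_span (span_mul x y) f = act_span x (act_span y f).
Proof.
rewrite /span_mul (linear_fglift (act_span_linearl f)) {2}/act_span.
congr (fglift _ x); apply/funext => X.
rewrite (linear_fglift (act_span_linearl f)) {2}/act_span.
rewrite (linear_fglift (bdiagram_act_linear X)); congr (fglift _ y).
by apply/funext => Y; exact: act_bstack.
Qed.

(** Stacking has become composition, so it is enough to compare the two sides of a local relation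
    themselves, without their surroundings. *)
Lemma act_in_context d (b b' c' c : loading G d) (hb : B (ld b)) (hc : B (ld c))
    (U : diagram c' c) (L : diagram b b') (x : Defs.hom b' c') f :
  act_span (in_context hb hc U L x) f =
  place (c := ld c) (diagram_op U (hom_op x (diagram_op L (component f hb)))).
Proof.
rewrite /in_context (linear_fglift (act_span_linearl f)).
have lin : linear (fun p => place (c := ld c) (diagram_op U p)).
  by move=> a p q; rewrite diagram_op_linear place_linear.
rewrite /hom_op (linear_fglift lin); congr (fglift _ x).
by apply/funext => D; rewrite act_span_dg !diagram_op_stack.
Qed.

Lemma act_null x f : null_comb x -> act_span x f = 0.
Proof.
move=> nx; elim: nx f => {x} [|x y _ IHx _ IHy|a x _ IH|x y _ IH|x y _ IH
  |d b c hb hc D D' iso|d b b' c' c hb hc U L x y xy] f.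
- exact: linear_zero (act_span_linearl f).
- by rewrite /act_span fgliftD -!/(act_span _ _) IHx IHy addr0.
- by rewrite /act_span fgliftZ -/(act_span _ _) IH scaler0.
- by rewrite act_span_mul IH (linear_zero (act_span_linearr x)).
- by rewrite act_span_mul IH.
- rewrite -[X in _ + X]scaleN1r addrC act_span_linearl !act_span_dg.
  by rewrite (diagram_op_isotopic _ iso) scaleN1r addNr.
- rewrite -[X in _ + X]scaleN1r addrC act_span_linearl !act_in_context.
  by rewrite (local_rel_hom_op _ xy) scaleN1r addNr.
Qed.

Definition wKLR_act (w : wKLR B) f : polys B := act_span (generic_quotient.repr w) f.

(** Two representatives differ by an element that acts by 0, so the action does not depend on the
    chosen one. *)
Lemma wKLR_act_to x f : wKLR_act (to_wKLR x) f = act_span x f.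
Proof.
apply/eqP; rewrite -subr_eq0; apply/eqP.
rewrite -[RHS](@act_null (generic_quotient.repr (to_wKLR x) - x) f).
  rewrite -[X in act_span (_ + X)]scaleN1r [in RHS]addrC act_span_linearl.
  by rewrite scaleN1r addrC.
by apply/toW_eq; exact: toW_repr.
Qed.

Lemma wKLR_act_algebra : algebra_action wKLR_act.
Proof.
split.
- move=> f a v w; rewrite -(toW_repr v) -(toW_repr w).
  rewrite -[a *: _]/(wKLR_scale a _) toWZ -toWD !wKLR_act_to.
  exact: act_span_linearl.
- by move=> w; exact: act_span_linearr.
- by move=> v w f; rewrite [LHS]wKLR_act_to act_span_mul.
Qed.

Lemma wKLR_acts_by d (b c : loading G d) (D : diagram b c) (op : mpoly d K -> mpoly d K) :
  (forall p, diagram_op D p = op p) -> acts_by wKLR_act D op.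
Proof.
move=> Dop hb hc f; rewrite /wKLR_dg wKLR_act_to act_span_dg Dop; split.
  exact: place_here.
by move=> b' nb; exact: place_elsewhere.
Qed.

End Representation.

(** * Operators of the generating diagrams *)

Section Generators.
Set Implicit Arguments.
Unset Strict Implicit.
Variables (R : realType) (K : comNzRingType) (G : wgraph R K).
Variables (d : nat) (b c : loading G d) (D : diagram b c).
Implicit Types f : mpoly d K.

Lemma diagram_op_single_dot (k : 'I_d) f : only_meet D [::] -> size (dots D k) = 1%N ->
  (forall l, l <> k -> dots D l = [::]) -> diagram_op D f = yy_ k * f.
Proof.
move=> om; case dE : (dots D k) => [|t [|//]] // _ nodot.
rewrite (@diagram_op_word _ _ _ _ _ _ D [:: (t, (k, k, 0))]).
  rewrite /= event_op_dot (_ : dperm D = 1%g) ?msym1m //.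
  apply: perm_no_inversion => i j ij; apply/negP => fl.
  by have [g [g' [u [? _ _ _ _]]]] := flip_meet om ij fl.
split=> // -[u [[i j] delta]]; rewrite inE /occurs /=; split.
  by move=> /eqP[-> -> -> ->]; rewrite eqxx dE mem_head.
case: eqP => [<- [-> ]|_ [/om[g [g' [?]]] //]].
have [-> |/eqP/nodot ->//] := eqVneq i k.
by rewrite dE inE => /eqP ->.
Qed.

Lemma once_sym g g' : once D g g' -> once D g' g.
Proof.
case=> nodots om [t m]; split=> //; last by exists t => u; rewrite -m; split=> ->.
move=> u k l delta /om[h [h' [hg hg' *]]]; exists h, h'.
by split=> //; move: hg hg'; rewrite !inE orbC => hg; rewrite orbC.
Qed.

(** As the weight is not 0, the curves that meet have different translations: no strands cross and
    the permutation is trivial. *)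
Lemma diagram_op_ghost (e : edge G) (j k : 'I_d) f : weight e <> 0 ->
  lab b j = etail e -> lab b k = ehead e -> once D (j, 0) (k, weight e) ->
  (curve_at D (k, weight e) 0 < curve_at D (j, 0) 0 -> diagram_op D f = f) /\
  (curve_at D (j, 0) 0 < curve_at D (k, weight e) 0 ->
     diagram_op D f = ev2 (Qpoly e) (yy_ k) (yy_ j) * f).
Proof.
move=> w0 lj lk D1; have jk : j <> k := once_distinct D1.
have nl : ~ loop0_at (etail e) e by case.
have [ejk ekj] := event_op_ghost f jk lj lk nl.
have d1 : dperm D = 1%g by apply: dperm_once_ghost D1 (nesym w0).
split=> lt0.
  by rewrite (diagram_op_once f (once_sym D1) lt0) /passage /= sub0r ekj d1 msym1m.
by rewrite (diagram_op_once f D1 lt0) /passage /= subr0 ejk d1 msym1m.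
Qed.

End Generators.

(** For an edge of weight 0 the ghost lies on its strand, so the passage takes place at the crossing
    itself: for different labels, the fourth clause then combines the factor Q_e with the
    permutation, and the clause on ghosts is restricted to nonzero weights. *)
Theorem proposition2p7 (R : realType) (K : comNzRingType) (G : wgraph R K)
    (B : set (aloading G)) (finB : finite_set B) :
  exists act : wKLR B -> polys B -> polys B,
    algebra_action act /\
    (forall d (b c : loading G d) (D : diagram b c),
      (uncrossed D -> acts_by act D id) /\
      (forall k, only_meet D [::] -> size (dots D k) = 1%N ->
         (forall l, l <> k -> dots D l = [::]) ->
         acts_by act D (fun f => yy_ k * f)) /\
      (forall (e : edge G) (j k : 'I_d), weight e <> 0 ->
         lab b j = etail e -> lab b k = ehead e ->
         once D (j, 0) (k, weight e) ->
         (curve_at D (k, weight e) 0 < curve_at D (j, 0) 0 ->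
            acts_by act D id) /\
         (curve_at D (j, 0) 0 < curve_at D (k, weight e) 0 ->
            acts_by act D (fun f => ev2 (Qpoly e) (yy_ k) (yy_ j) * f))) /\
      (forall j k : 'I_d, cross D j k -> lab b j <> lab b k ->
         ((forall e : edge G, weight e = 0 ->
             ~ (etail e = lab b j /\ ehead e = lab b k)) ->
            acts_by act D (msym (tperm j k))) /\
         (forall e : edge G, weight e = 0 ->
            etail e = lab b j -> ehead e = lab b k ->
            acts_by act D (fun f =>
              msym (tperm j k) (ev2 (Qpoly e) (yy_ k) (yy_ j) * f)))) /\
      (forall j k : 'I_d, cross D j k -> lab b j = lab b k ->
         ((forall e, ~ loop0_at (lab b j) e) ->
            acts_by act D (demazure j k)) /\
         (forall e, loop0_at (lab b j) e ->
            acts_by act D (fun f =>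
              ev2 (Qpoly e) (yy_ j) (yy_ k) * demazure j k f) /\
            acts_by act D (fun f =>
              ev2 (Ppoly e) (yy_ j) (yy_ k) * (f - msym (tperm j k) f))))).
Proof.
exists (@wKLR_act R K G B); split; first exact: wKLR_act_algebra.
move=> d b c D; split; last split; last split; last split.
- by move=> uD; apply: wKLR_acts_by => f; exact: diagram_op_uncrossed.
- by move=> k om sk nodot; apply: wKLR_acts_by => f; exact: diagram_op_single_dot.
- move=> e j k w0 lj lk D1; split=> lt0; apply: wKLR_acts_by => f.
    by have [+ _] := diagram_op_ghost f w0 lj lk D1; apply.
  by have [_ +] := diagram_op_ghost f w0 lj lk D1; apply.
- move=> j k Djk ljk; have [jk DE] := diagram_op_cross Djk.
  have nd : ~ ((0 : R) = 0 /\ lab b j = lab b k) by case.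
  split=> [noe|e w t h]; apply: wKLR_acts_by => f.
    rewrite DE (event_op_mul _ jk nd) event_poly_noedge ?mul1r // => e [/= t h w].
    by apply: (noe e w).
  by rewrite DE (event_op_mul _ jk nd) (event_poly_edge (e := e)).
- move=> j k Djk ljk; have [jk _] := diagram_op_cross Djk.
  have DE := diagram_op_cross_same Djk ljk; split=> [nl|e le].
    by apply: wKLR_acts_by => f; rewrite DE (loopQ_noloop nl) ev21 mul1r.
  split; apply: wKLR_acts_by => f; rewrite DE.
    by rewrite (loopQ_loop le).
  rewrite -(loopP_loop le); apply: loopQ_demazure_swap => //.
  by exists e.
Qed.
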